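(* Let $p>2$. For every $A>0$ and $c>-\frac{\bar K}{A}$ there exists $\varepsilon=\varepsilon(c,A,\bar K)>0$ with the following property. Let $u_0\equiv\frac12\log(A)\in\mathcal{C}_{p,A}$ and let $f\in C^\infty(M)$ satisfy $-c\le f\le 0$ and $\|f+c\|_{L^1(M,\bar g)}<\varepsilon$. Let $u$ be the global solution of the flow with prescribed function $f$, volume $A$ and initial value $u_0$, and let $u_\infty$ be any limit in $H^2(M,\bar g)$ of $u(t_l)$ along a sequence $t_l\to\infty$. Then the value $$\lambda=\frac1A\left(\bar K-\int_M f e^{2u_\infty}\,d\mu_{\bar g}\right)$$ is positive. In particular, if $f$ has zeros on $M$, then $f_\lambda=f+\lambda$ is sign changing.
   Context: $(M,\bar g)$ is a fixed two-dimensional, smooth, closed, connected, oriented Riemannian manifold with $\chi(M)<0$, normalised so that $\bar g$ has constant Gauss curvature $\bar K$ and volume $1$; hence $\bar K=2\pi\chi(M)<0$. For $A>0$, $p>2$: $\mathcal{C}_A=\{u\in H^1(M,\bar g)\mid \int_M e^{2u}\,d\mu_{\bar g}=A\}$ and $\mathcal{C}_{p,A}=\{v\in W^{2,p}(M,\bar g)\mid\int_M e^{2v}\,d\mu_{\bar g}=A\}$. The flow with prescribed function $f\in C^\infty(M)$, volume $A$ and initial value $u_0\in\mathcal{C}_{p,A}$ is the initial value problem $\partial_t u(t)=f-K_{g(t)}-\alpha(t)$ in $(0,\infty)\times M$, $u(0)=u_0$, with $g(t)=e^{2u(t)}\bar g$, $K_{g(t)}=e^{-2u(t)}(-\Delta_{\bar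 g}u(t)+\bar K)$, $\alpha(t)=\frac1A\left(\int_M f e^{2u(t)}\,d\mu_{\bar g}-\bar K\right)$. It is known that it has a unique global solution $u\in C([0,\infty)\times M)\cap C([0,\infty);H^1(M,\bar g))\cap C^\infty((0,\infty)\times M)$, and that for every sequence $t_l\to\infty$, after passing to a subsequence, $u(t_l)$ converges in $H^2(M,\bar g)$ to some $u_\infty\in H^2(M,\bar g)\cap\mathcal{C}_A$ solving $-\Delta_{\bar g}u_\infty+\bar K=(f+\lambda)e^{2u_\infty}$ with $\lambda=\frac1A\left(\bar K-\int_M f e^{2u_\infty}\,d\mu_{\bar g}\right)$. The constant $\varepsilon$ may depend on the fixed surface $(M,\bar g)$. *)

(* Defs.v *)
From HB Require Import structures.
From mathcomp Require Import all_boot all_order all_algebra.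
From mathcomp Require Import all_classical all_reals all_analysis.

Set Implicit Arguments.
Unset Strict Implicit.
Unset Printing Implicit Defensive.

Import Order.TTheory GRing.Theory Num.Theory.
Import numFieldNormedType.Exports.

Local Open Scope classical_set_scope.
Local Open Scope ring_scope.

(* C^n on an open set U: all iterated directional derivatives up to order n
   exist and are continuous at the points of U (V is finite-dimensional in all
   uses below). *)
Fixpoint Ck_on (R : realType) (V W : normedModType R) (n : nat)
    (U : set V) (F : V -> W) : Prop :=
  (forall x, U x -> {for x, continuous F}) /\
  match n with
  | 0 => True
  | m.+1 => forall v : V, (forall x, U x -> derivable F x v) /\
                          Ck_on m U (fun x => 'D_v F x)
  end.

Definition smooth_on (R : realType) (V W : normedModType R)
    (U : set V) (F : V -> W) : Prop := forall n, Ck_on n U F.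

Section Coordinates.
Variable R : realType.

Definition coord (a : 'I_2) (z : R * R) : R := if a == ord0 then z.1 else z.2.

Definition basis_vec (a : 'I_2) : R * R :=
  ((a == ord0)%:R, (a != ord0)%:R).

Definition pderiv (a : 'I_2) (F : R * R -> R) (z : R * R) : R :=
  'D_(basis_vec a) F z.

Definition jacobian (F : R * R -> R * R) (z : R * R) : 'M[R]_2 :=
  \matrix_(a, b) coord a ('D_(basis_vec b) F z).

Definition lebesgue2 := ((@lebesgue_measure R) \x (@lebesgue_measure R))%E.

Variable g : R * R -> 'M[R]_2.

(* Gamma^c_{ab} of the metric with matrix g in coordinates. *)
Definition christoffel (c a b : 'I_2) (z : R * R) : R :=
  2^-1 * \sum_(d < 2) invmx (g z) c d *
    (pderiv a (fun w => g w d b) z + pderiv b (fun w => g w d a) z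
     - pderiv d (fun w => g w a b) z).

(* R(d_i, d_j) d_k = \sum_l riemann l k i j d_l, with the convention
   R(X, Y) Z = nabla_X nabla_Y Z - nabla_Y nabla_X Z - nabla_[X, Y] Z. *)
Definition riemann (l k i j : 'I_2) (z : R * R) : R :=
  pderiv i (christoffel l j k) z - pderiv j (christoffel l i k) z
  + \sum_(m < 2) (christoffel l i m z * christoffel m j k z
                  - christoffel l j m z * christoffel m i k z).

(* <R(d_0, d_1) d_1, d_0> / det g; ord_max is the index 1. *)
Definition gauss_curv (z : R * R) : R :=
  (\sum_(l < 2) riemann l ord_max ord0 ord_max z * g z l ord0) / \det (g z).

Definition hessian (F : R * R -> R) (z : R * R) : 'M[R]_2 :=
  \matrix_(a, b) (pderiv a (pderiv b F) z
                  - \sum_(c < 2) christoffel c a b z * pderiv c F z).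

Definition laplacian (F : R * R -> R) (z : R * R) : R :=
  \tr (invmx (g z) *m hessian F z).

Definition grad_sqnorm (F : R * R -> R) (z : R * R) : R :=
  \sum_(a < 2) \sum_(b < 2) invmx (g z) a b * pderiv a F z * pderiv b F z.

(* g^{ac} g^{bd} H_ab H_cd, for the symmetric matrix H of the covariant
   Hessian. *)
Definition hess_sqnorm (F : R * R -> R) (z : R * R) : R :=
  \tr (invmx (g z) *m hessian F z *m invmx (g z) *m (hessian F z)^T).

End Coordinates.

Definition borel (T : ptopologicalType) := g_sigma_algebraType (@open T).

(* A smooth, closed, connected, oriented Riemannian surface.  [sf_inv i] is
   meaningful on the open image of the chart only, and [sf_metric i z] is the
   matrix of the metric in the chart [i] at the coordinates [z].  [sf_vol] is
   the Riemannian measure, which [sf_volE] determines. *)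
Record closed_surface (R : realType) := ClosedSurface {
  sf_car :> ptopologicalType;
  sf_hausdorff : hausdorff_space sf_car;
  sf_compact : compact [set: sf_car];
  sf_connected : connected [set: sf_car];
  sf_idx : Type;
  sf_dom : sf_idx -> set sf_car;
  sf_chart : sf_idx -> sf_car -> R * R;
  sf_inv : sf_idx -> R * R -> sf_car;
  sf_at : sf_car -> sf_idx;
  sf_atP : forall x, sf_dom (sf_at x) x;
  sf_dom_open : forall i, open (sf_dom i);
  sf_img_open : forall i, open (sf_chart i @` sf_dom i);
  sf_chartK : forall i x, sf_dom i x -> sf_inv i (sf_chart i x) = x;
  sf_chart_cont : forall i x, sf_dom i x -> {for x, continuous (sf_chart i)};
  sf_inv_cont : forall i z, (sf_chart i @` sf_dom i) z ->
    {for z, continuous (sf_inv i)};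
  sf_trans_smooth : forall i j,
    smooth_on (sf_chart i @` (sf_dom i `&` sf_dom j))
              (sf_chart j \o sf_inv i);
  sf_oriented : forall i j z, (sf_chart i @` (sf_dom i `&` sf_dom j)) z ->
    0 < \det (jacobian (sf_chart j \o sf_inv i) z);
  sf_metric : sf_idx -> R * R -> 'M[R]_2;
  sf_metric_smooth : forall i (a b : 'I_2),
    smooth_on (sf_chart i @` sf_dom i) (fun z => sf_metric i z a b);
  sf_metric_sym : forall i z, (sf_chart i @` sf_dom i) z ->
    (sf_metric i z)^T = sf_metric i z;
  sf_metric_pos : forall i z, (sf_chart i @` sf_dom i) z ->
    forall v : 'rV[R]_2, v != 0 -> 0 < (v *m sf_metric i z *m v^T) 0 0;
  sf_metric_trans : forall i j z,
    (sf_chart i @` (sf_dom i `&` sf_dom j)) z ->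
    let tau := sf_chart j \o sf_inv i in
    sf_metric i z =
      (jacobian tau z)^T *m sf_metric j (tau z) *m jacobian tau z;
  sf_vol : {measure set (borel sf_car) -> \bar R};
  sf_volE : forall i (B : set (borel sf_car)),
    measurable B -> B `<=` sf_dom i ->
    sf_vol B = (\int[@lebesgue2 R]_(z in sf_chart i @` B)
                  (Num.sqrt (\det (sf_metric i z)))%:E)%E
}.

(* The geometric realization of the simplicial complex S on n.+1 vertices,
   in barycentric coordinates. *)
Definition realization (R : realType) (n : nat) (S : {set {set 'I_n.+1}}) :
    set 'rV[R]_n.+1 :=
  [set x | [/\ forall i, 0 <= x 0 i, \sum_i x 0 i = 1
             & [set i | x 0 i != 0]%SET \in S]].

(* chi is the alternating number of faces of a triangulation of T.  When T is
   Hausdorff, the continuous bijection h is a homeomorphism by compactness. *)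
Definition euler_characteristic (R : realType) (T : topologicalType)
    (chi : int) : Prop :=
  exists (n : nat) (S : {set {set 'I_n.+1}}) (h : 'rV[R]_n.+1 -> T),
    [/\ finset.set0 \notin S,
        forall s t : {set 'I_n.+1}, s \in S -> t \subset s ->
          t != finset.set0 -> t \in S,
        {within realization S, continuous h},
        set_bij (realization S) [set: T] h
      & chi = \sum_(s in S) (-1) ^+ #|s|.-1].

Section Surface.
Variables (R : realType) (M : closed_surface R).

Let mu := sf_vol M.

Definition in_chart (i : sf_idx M) (u : M -> R) : R * R -> R := u \o sf_inv i.

Definition smooth_fun (u : M -> R) : Prop :=
  forall i, smooth_on (sf_chart i @` sf_dom i) (in_chart i u).

(* The value at x of a coordinate-invariant expression in (the metric and) u,
   computed in the chart chosen at x. *)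
Definition at_point (E : (R * R -> 'M[R]_2) -> (R * R -> R) -> R * R -> R)
    (u : M -> R) (x : M) : R :=
  E (sf_metric (sf_at x)) (in_chart (sf_at x) u) (sf_chart (sf_at x) x).

Definition laplace_beltrami : (M -> R) -> M -> R := at_point (@laplacian R).

Definition has_gauss_curvature (K : R) : Prop :=
  forall (i : sf_idx M) z, (sf_chart i @` sf_dom i) z -> gauss_curv (sf_metric i) z = K.

(* |nabla^j u| for j = 0, 1, 2; Sobolev spaces of order at most 2 are used. *)
Definition nabla_norm (j : nat) (u : M -> R) (x : M) : R :=
  match j with
  | 0 => `|u x|
  | 1 => Num.sqrt (at_point (@grad_sqnorm R) u x)
  | _ => Num.sqrt (at_point (@hess_sqnorm R) u x)
  end.

Definition smooth_sobolev_norm (k : nat) (p : R) (phi : M -> R) : \bar R :=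
  (\sum_(j < k.+1) 'N[mu]_(p%:E)[EFin \o nabla_norm j phi])%E.

(* phi_ represents u in the completion of C^oo(M) for the W^{k,p} norm. *)
Definition sobolev_approx (k : nat) (p : R) (u : M -> R)
    (phi_ : nat -> M -> R) : Prop :=
  [/\ forall n, smooth_fun (phi_ n),
      forall e : R, 0 < e -> exists N, forall m n, (N <= m)%N -> (N <= n)%N ->
        (smooth_sobolev_norm k p (phi_ m \- phi_ n)%R < e%:E)%E
    & ('N[mu]_(p%:E)[EFin \o (phi_ n \- u)%R])%E @[n --> \oo] --> 0%E].

(* The W^{k,p} norm, W^{k,p}(M) being the completion of C^oo(M), realized in
   L^p(M).  The set below has at most one element; it is empty, so that the
   norm is +oo, exactly when u is not in W^{k,p}(M). *)
Definition sobolev_norm (k : nat) (p : R) (u : M -> R) : \bar R :=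
  ereal_inf [set N : \bar R |
    measurable_fun [set: borel M] (u : borel M -> R) /\
    exists2 phi_ : nat -> M -> R, sobolev_approx k p u phi_ &
      smooth_sobolev_norm k p (phi_ n) @[n --> \oo] --> N].

Definition in_sobolev (k : nat) (p : R) (u : M -> R) : Prop :=
  (sobolev_norm k p u < +oo)%E.

Definition sobolev_cvg (k : nat) (p : R) (v_ : nat -> M -> R) (v : M -> R) :
    Prop :=
  in_sobolev k p v /\ sobolev_norm k p (v_ n \- v)%R @[n --> \oo] --> 0%E.

Definition C_pA (p A : R) (v : M -> R) : Prop :=
  in_sobolev 2 p v /\ (\int[mu]_x (expR (2 * v x))%:E = A%:E)%E.

(* K_g for g = e^{2u} gbar, where gbar has constant curvature Kbar. *)
Definition conformal_curv (Kbar : R) (u : M -> R) (x : M) : R :=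
  expR (- 2 * u x) * (- laplace_beltrami u x + Kbar).

Definition alpha (Kbar A : R) (f u : M -> R) : R :=
  A^-1 * (\int[mu]_x (f x * expR (2 * u x)) - Kbar).

Definition lambda (Kbar A : R) (f u : M -> R) : R :=
  A^-1 * (Kbar - \int[mu]_x (f x * expR (2 * u x))).

Definition flow_regularity (u : R -> M -> R) : Prop :=
  [/\ {within [set z : R * M | 0 <= z.1],
         continuous (fun z : R * M => u z.1 z.2)},
      forall t : R, 0 <= t -> in_sobolev 1 2 (u t),
      forall s : R, 0 <= s ->
        sobolev_norm 1 2 (u t \- u s)%R @[t --> within `[0, +oo[ (nbhs s)]
          --> 0%E
    & forall i : sf_idx M, smooth_on
        [set z : R * (R * R) | 0 < z.1 /\ (sf_chart i @` sf_dom i) z.2]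
        (fun z : R * (R * R) => u z.1 (sf_inv i z.2))].

Definition global_flow_solution (Kbar A : R) (f u0 : M -> R)
    (u : R -> M -> R) : Prop :=
  [/\ flow_regularity u,
      forall x, u 0 x = u0 x
    & forall (t : R) (x : M), 0 < t ->
        is_derive t 1 (fun s : R => u s x)
          (f x - conformal_curv Kbar (u t) x - alpha Kbar A f (u t))].

End Surface.

(* Main.v *)
(** Write [f = h - c] with [0 <= h <= c] and [y(t) = \int h e^{2u(t)}].  The flow
    preserves the volume [A] and decreases the energy
    [D/2 + K \int u - (\int f e^{2u})/2], where [D = \int |grad u|^2]; comparing with
    times tending to [0], at which [D] is arbitrarily small, and using Jensen's
    inequality for the mean of [u], one gets [D(t) <= y(t)].  The embedding of
    [W^{1,1}] in [L^2] applied to [e^{2u}] gives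
    [\int e^{4u} <= C (A^2 + D \int e^{4u})], so as long as [y] stays below a fixed
    threshold, [\int e^{4u} <= 2 C A^2], and Cauchy-Schwarz makes
    [y <= |h|_2 |e^{2u}|_2] strictly smaller than the threshold: by continuity [y]
    never reaches it.  In the limit [K - \int f e^{2u_oo} >= K + c A - y - o(1) > 0].
    If [f + lambda] were nonnegative, then
    [0 <= \int (f + lambda) e^{2u_oo} <= K] would contradict [K < 0]. *)
Require Import Defs.
From HB Require Import structures.
From mathcomp Require Import all_boot all_order all_algebra.
From mathcomp Require Import all_classical all_reals all_analysis.
From mathcomp Require Import measurable_realfun ring lra.
Set Implicit Arguments.
Unset Strict Implicit.
Unset Printing Implicit Defensive.
Import Order.TTheory GRing.Theory Num.Theory.
Import numFieldNormedType.Exports.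
Local Open Scope classical_set_scope.
Local Open Scope ring_scope.

(** * Calculus in the plane *)

(** The equation holds for positive times only, and neither the energy nor [D] is evaluated at time
    0. Means without derivatives pass to the limit there by uniform convergence; that [D] is small
    at some arbitrarily small times comes from a functional of [u] without derivatives, the
    [entropy], whose time derivative is [- D] up to a vanishing term. At the other end, [u_oo] is
    compared with [u(t)] in [L^2], where nothing is known of the integrability of [e^{2u_oo}].
    Convexity of the exponential gives one-sided estimates: [\int e^{2u_oo} <= A], and a lower bound
    for [- \int f e^{2u_oo}]. These two suffice. The threshold for [y] is the smaller of
    [1 / (8 C)], which absorbs the gradient term of the Sobolev inequality for [2 u], and
    [(K + c A) / 2], which saves half of the margin for the limit. Smallness of [h] in [L^1] becomes
    smallness in [L^2] through [h^2 <= c h]. Differential operators are evaluated in a chart chosen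
    separately at each point, so their invariance under changes of charts has to be proved before
    their continuity and Green's formula. *)

Lemma MVT_between (R : realType) (f df : R -> R) (a b : R) :
  (forall x, `|x - a| <= `|b - a| -> is_derive x (1 : R) f (df x)) ->
  exists2 c, `|c - a| <= `|b - a| & f b - f a = df c * (b - a).
Proof.
move=> fd.
have fc x : `|x - a| <= `|b - a| -> {for x, continuous f}.
  by move=> /fd [+ _] => /derivable1_diffP /differentiable_continuous.
have [ab|ba] := leP a b.
  have abs_le x : a <= x <= b -> `|x - a| <= `|b - a|.
    by move=> /andP[ax xb]; rewrite !ger0_norm ?subr_ge0// lerB.
  have [||c] := @MVT_segment R f df a b ab.
  - by move=> x; rewrite in_itv/= => /andP[/ltW ax /ltW xb]; apply/fd/abs_le/andP.
  - apply: continuous_in_subspaceT => x; rewrite inE/= in_itv/= => xab.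
    exact/fc/abs_le.
  by rewrite in_itv/= => cab E; exists c => //; exact: abs_le.
have abs_le x : b <= x <= a -> `|x - a| <= `|b - a|.
  move=> /andP[ax xb]; rewrite !ler0_norm ?subr_le0 ?lerN2 ?lerB//.
  exact: ltW.
have [||c] := @MVT_segment R f df b a (ltW ba).
- by move=> x; rewrite in_itv/= => /andP[/ltW ax /ltW xb]; apply/fd/abs_le/andP.
- apply: continuous_in_subspaceT => x; rewrite inE/= in_itv/= => xab.
  exact/fc/abs_le.
rewrite in_itv/= => cab E; exists c; first exact: abs_le.
by rewrite -opprB E -mulrN opprB.
Qed.

(** Registered below as a linear map, so that it can serve as the differential assembled from two
    partial derivatives. *)
Definition lin2 (R : realType) (a b : R) (v : R * R) : R := v.1 * a + v.2 * b.

Lemma lin2_is_linear (R : realType) (a b : R) : linear (lin2 a b).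
Proof. by move=> k u v; rewrite /lin2 /= /GRing.scale /=; ring. Qed.

HB.instance Definition _ (R : realType) (a b : R) :=
  GRing.isLinear.Build R (R * R)%type R *:%R (lin2 a b) (@lin2_is_linear R a b).

Lemma lin2_continuous (R : realType) (a b : R) : continuous (lin2 a b).
Proof.
move=> z; apply: cvgD; (apply: cvgM; last exact: cvg_cst).
  exact: cvg_fst.
exact: cvg_snd.
Qed.

Lemma basis_vec0 (R : realType) : basis_vec R ord0 = (1, 0).
Proof. by []. Qed.

Lemma basis_vec1 (R : realType) : basis_vec R ord_max = (0, 1).
Proof. by []. Qed.

(** Differentiability refers to the chosen differential ['d f x]; by uniqueness, any continuous
    linear map that gives a first-order expansion is that differential. *)
Lemma differentiable_littleo (R : numFieldType) (V W : normedModType R)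
    (f : V -> W) (df : {linear V -> W}) (x : V) :
  continuous df -> f \o shift x = cst (f x) + df +o_ 0 id -> differentiable f x.
Proof.
move=> dfc H; have dE := diff_unique dfc H.
by apply/diff_locallyP; rewrite dE; split.
Qed.

Section C1.
Variable R : realType.
Implicit Types (F G : R * R -> R) (z v : R * R).

Lemma is_derive_slice1 F z : derivable F z (basis_vec R ord0) ->
  is_derive z.1 (1 : R) (fun s => F (s, z.2)) (pderiv ord0 F z).
Proof.
rewrite /pderiv basis_vec0 /derivable /derive => dF.
have E : (fun h : R => h^-1 *: (F (h *: ((1, 0) : R * R) + z) - F z)) =
    (fun h : R => h^-1 *: (F (h *: (1 : R) + z.1, z.2) - F (z.1, z.2))).
  by apply/funext => h; case: z {dF} => x y /=; congr (_ *: (F _ - _));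
    congr (_, _) => /=; rewrite [_ *: 0]mulr0 add0r.
by apply: DeriveDef; rewrite /derivable /derive /= -E.
Qed.

Lemma is_derive_slice2 F z : derivable F z (basis_vec R ord_max) ->
  is_derive z.2 (1 : R) (fun s => F (z.1, s)) (pderiv ord_max F z).
Proof.
rewrite /pderiv basis_vec1 /derivable /derive => dF.
have E : (fun h : R => h^-1 *: (F (h *: ((0, 1) : R * R) + z) - F z)) =
    (fun h : R => h^-1 *: (F (z.1, h *: (1 : R) + z.2) - F (z.1, z.2))).
  by apply/funext => h; case: z {dF} => x y /=; congr (_ *: (F _ - _));
    congr (_, _) => /=; rewrite [_ *: 0]mulr0 add0r.
by apply: DeriveDef; rewrite /derivable /derive /= -E.
Qed.

(** The increment is split into a vertical leg at abscissa [z.1] and a horizontal leg at height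
    [z.2 + h.2]. The mean value theorem on each leg gives a partial derivative at a point close to
    [z]. *)
Lemma differentiable_pderiv F z :
  (\forall w \near z, forall a, derivable F w (basis_vec R a)) ->
  (forall a, {for z, continuous (pderiv a F)}) -> differentiable F z.
Proof.
move=> /nbhs_ballP[r /= r0 dF] cF.
pose L : {linear (R * R)%type -> R^o} := lin2 (pderiv ord0 F z) (pderiv ord_max F z).
apply: (@differentiable_littleo R (R * R)%type R F L z).
  exact: lin2_continuous.
apply/eqaddoP => _/posnumP[e].
have e2 : 0 < e%:num / 2 by [].
have /cvgrPdist_lt /(_ _ e2)/nbhs_ballP[d0 /= d00 D0] := cF ord0.
have /cvgrPdist_lt /(_ _ e2)/nbhs_ballP[d1 /= d10 D1] := cF ord_max.
pose d := Num.min r (Num.min d0 d1).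
have d_gt0 : 0 < d by rewrite !lt_min r0 d00 d10.
near=> h.
have hd : `|h| < d by near: h; apply: (@nbhs0_lt R (R * R)%type).
have h1d : `|h.1| <= `|h| by rewrite [`|h|]prod_normE le_max lexx.
have h2d : `|h.2| <= `|h| by rewrite [`|h|]prod_normE le_max lexx orbT.
have inb x y e0 : d <= e0 -> `|x - z.1| <= `|h.1| -> `|y - z.2| <= `|h.2| ->
    ball z e0 (x, y).
  move=> de0 xh yh; split; rewrite /ball/= distrC.
    exact: (le_lt_trans xh (le_lt_trans h1d (lt_le_trans hd de0))).
  exact: (le_lt_trans yh (le_lt_trans h2d (lt_le_trans hd de0))).
have dr : d <= r by rewrite ge_min lexx.
have dd0 : d <= d0 by rewrite /d minC -minA ge_min lexx.
have dd1 : d <= d1 by rewrite /d minA minC ge_min lexx.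
have [|c1 c1h E1] := @MVT_between R (fun s => F (s, z.2 + h.2))
   (fun s => pderiv ord0 F (s, z.2 + h.2)) z.1 (z.1 + h.1).
  move=> x; rewrite (addrC z.1) addrK => xh.
  apply: (@is_derive_slice1 F (x, z.2 + h.2)); apply: dF; apply: inb => //.
  by rewrite addrC addKr.
have [|c2 c2h E2] := @MVT_between R (fun s => F (z.1, s))
   (fun s => pderiv ord_max F (z.1, s)) z.2 (z.2 + h.2).
  move=> x; rewrite (addrC z.2) addrK => xh.
  apply: (@is_derive_slice2 F (z.1, x)); apply: dF; apply: inb => //.
  by rewrite subrr normr0.
have {}D0 := D0 (c1, z.2 + h.2).
have {}D1 := D1 (z.1, c2).
rewrite /= in E1 E2; rewrite (addrC z.1) addrK in c1h E1.
rewrite (addrC z.2) addrK in c2h E1 E2.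
have hz : h + z = (h.1 + z.1, h.2 + z.2) by case: (h) (z) => ? ? [].
rewrite [X in `|X|](_ : _ =
    (pderiv ord0 F (c1, h.2 + z.2) - pderiv ord0 F z) * h.1
    + (pderiv ord_max F (z.1, c2) - pderiv ord_max F z) * h.2); last first.
  have zE : z = (z.1, z.2) by case: (z).
  rewrite !fctE /= /L /lin2 hz /= !mulrBl -E1 -E2 -zE; ring.
rewrite addrC in D0.
apply: (le_trans (ler_normD _ _)); rewrite !normrM.
rewrite (splitr e%:num) mulrDl; apply: lerD; apply: ler_pM => //.
  rewrite distrC; apply/ltW/D0/inb => //.
  by rewrite addrK.
rewrite distrC; apply/ltW/D1/inb => //.
by rewrite subrr normr0.
Unshelve. all: by end_near. Qed.

End C1.

Section C1.
Variable R : realType.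
Implicit Types (F G : R * R -> R) (z v : R * R) (h : R -> R).

(** A condition on the germ at [z]: coordinate expressions are meaningful on the image of a chart
    only, so regularity has to be local. *)
Definition c1 F z := (\forall w \near z, differentiable F w) /\
  forall a, {for z, continuous (pderiv a F)}.

Lemma c1_differentiable F z : c1 F z -> differentiable F z.
Proof. by case=> /nbhs_singleton. Qed.

Lemma c1_continuous F z : c1 F z -> {for z, continuous F}.
Proof. by move/c1_differentiable/differentiable_continuous. Qed.

(** [Ck_on] speaks of directional derivatives only; differentiability comes from the continuity of
    the two partial derivatives. *)
Lemma Ck_on_c1 (U : set (R * R)) F z : open U -> Ck_on 1 U F -> U z -> c1 F z.
Proof.
move=> oU [_ FU] Uz.
have cF w : U w -> forall a, {for w, continuous (pderiv a F)}.
  by move=> Uw a; have [_ [/(_ w Uw)]] := FU (basis_vec R a).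
have nU w : U w -> nbhs w U by move=> Uw; exact: open_nbhs_nbhs.
split; last exact: cF.
near=> w; have Uw : U w by near: w; exact: nU.
apply: differentiable_pderiv; last exact: cF.
by apply: filterS (nU _ Uw) => y Uy a; have [/(_ y Uy)] := FU (basis_vec R a).
Unshelve. all: by end_near. Qed.

Lemma pderiv_near_eq F G z a : {near z, F =1 G} ->
  \forall w \near z, pderiv a F w = pderiv a G w.
Proof.
move=> FG; have := near_join FG => /= H.
by apply: filterS H => w H; exact: near_eq_derive.
Qed.

Lemma pderiv_eq_near F G z a : {near z, F =1 G} -> pderiv a F z = pderiv a G z.
Proof. by move=> FG; exact: near_eq_derive. Qed.

Lemma near_eq_differentiable F G z : {near z, F =1 G} ->
  differentiable F z -> differentiable G z.
Proof.
move=> FG dF; have FGz : F z = G z by exact: nbhs_singleton FG.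
apply: (@differentiable_littleo R (R * R)%type R G ('d F z) z).
  exact: diff_continuous.
have /diff_locallyP[_ /eqaddoP H] := dF.
apply/eqaddoP => e e0; have {}H := H _ e0.
have FG0 : \forall h \near (0 : R * R), F (h + z) = G (h + z).
  move: FG; rewrite (near_shift 0)/=; apply: filterS => h.
  by rewrite subr0.
by apply: filterS2 H FG0 => h; rewrite !fctE /= -FGz => + <-.
Qed.

Lemma near_continuous_eq (T : topologicalType) (f g : T -> R) (x : T) :
  {near x, f =1 g} -> {for x, continuous f} -> {for x, continuous g}.
Proof.
move=> fg cf; rewrite /prop_for /continuous_at -(nbhs_singleton fg).
apply: cvg_trans cf; apply: near_eq_cvg.
by apply: filterS fg => y ->.
Qed.

Lemma continuous_add (T : topologicalType) (f g : T -> R) (x : T) :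
  {for x, continuous f} -> {for x, continuous g} ->
  {for x, continuous (fun y => f y + g y)}.
Proof. exact: continuousD. Qed.

Lemma continuous_mul (T : topologicalType) (f g : T -> R) (x : T) :
  {for x, continuous f} -> {for x, continuous g} ->
  {for x, continuous (fun y => f y * g y)}.
Proof. exact: continuousM. Qed.

Lemma c1_near_eq F G z : {near z, F =1 G} -> c1 F z -> c1 G z.
Proof.
move=> FG [dF cF]; split.
  have := near_join FG => /= H.
  by apply: filterS2 H dF => w; exact: near_eq_differentiable.
by move=> a; exact: near_continuous_eq (pderiv_near_eq a FG) (cF a).
Qed.

Lemma pderiv_cst (k : R) z a : pderiv a (fun=> k) z = 0.
Proof. exact: derive_cst. Qed.

Lemma c1_cst (k : R) z : c1 (fun=> k) z.
Proof.
split; first by near=> w; exact: differentiable_cst.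
move=> a; rewrite (_ : pderiv a _ = fun=> 0); first exact: cst_continuous.
by apply/funext => w; rewrite pderiv_cst.
Unshelve. all: by end_near. Qed.

Lemma pderivD F G z a : differentiable F z -> differentiable G z ->
  pderiv a (fun w => F w + G w) z = pderiv a F z + pderiv a G z.
Proof. by move=> dF dG; apply: deriveD; exact: diff_derivable. Qed.

Lemma pderivM F G z a : differentiable F z -> differentiable G z ->
  pderiv a (fun w => F w * G w) z = F z * pderiv a G z + G z * pderiv a F z.
Proof. by move=> dF dG; apply: deriveM; exact: diff_derivable. Qed.

Lemma differentiable_mul F G z : differentiable F z -> differentiable G z ->
  differentiable (fun w => F w * G w) z.
Proof. exact: differentiableM. Qed.

Lemma c1D F G z : c1 F z -> c1 G z -> c1 (fun w => F w + G w) z.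
Proof.
move=> [dF cF] [dG cG]; split.
  by apply: filterS2 dF dG => w; exact: differentiableD.
move=> a; apply: (@near_continuous_eq _ (fun w => pderiv a F w + pderiv a G w)).
  by apply: filterS2 dF dG => w Fw Gw; rewrite pderivD.
exact: continuous_add (cF a) (cG a).
Qed.

Lemma c1M F G z : c1 F z -> c1 G z -> c1 (fun w => F w * G w) z.
Proof.
move=> [dF cF] [dG cG]; split.
  by apply: filterS2 dF dG => w; exact: differentiable_mul.
move=> a; apply: (@near_continuous_eq _
    (fun w => F w * pderiv a G w + G w * pderiv a F w)).
  by apply: filterS2 dF dG => w Fw Gw; rewrite pderivM.
have cFz := differentiable_continuous (nbhs_singleton dF).
have cGz := differentiable_continuous (nbhs_singleton dG).
exact: continuous_add (continuous_mul cFz (cG a)) (continuous_mul cGz (cF a)).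
Qed.

Lemma c1N F z : c1 F z -> c1 (fun w => - F w) z.
Proof.
move=> cF; rewrite (_ : (fun w => _) = (fun w => -1 * F w)).
  by apply: c1M => //; exact: c1_cst.
by apply/funext => w; rewrite mulN1r.
Qed.

Lemma c1B F G z : c1 F z -> c1 G z -> c1 (fun w => F w - G w) z.
Proof. by move=> cF cG; apply: c1D => //; exact: c1N. Qed.

Lemma c1_sum (I : Type) (s : seq I) (F : I -> R * R -> R) z :
  (forall i, c1 (F i) z) -> c1 (fun w => \sum_(i <- s) F i w) z.
Proof.
move=> cF; elim: s => [|i s IH].
  by under eq_fun do rewrite big_nil; exact: c1_cst.
by under eq_fun do rewrite big_cons; exact: c1D.
Qed.

Lemma differentiable_comp1 h F z : derivable h (F z) 1 -> differentiable F z ->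
  differentiable (fun w => h (F w)) z.
Proof.
by move=> /derivable1_diffP dh dF; apply: (@differentiable_comp _ _ _ _ F h).
Qed.

Lemma pderiv_comp1 h F z a : derivable h (F z) 1 -> differentiable F z ->
  pderiv a (fun w => h (F w)) z = derive1 h (F z) * pderiv a F z.
Proof.
move=> dh dF; have /derivable1_diffP dh' := dh.
rewrite /pderiv deriveE; last exact: differentiable_comp1.
rewrite (@diff_comp _ _ _ _ F h)//= deriv1E//.
by rewrite -deriveE// [LHS]mulrC.
Qed.

Lemma c1_comp1 h F z : (\forall y \near F z, derivable h y 1) ->
  {for F z, continuous (derive1 h)} -> c1 F z -> c1 (fun w => h (F w)) z.
Proof.
move=> dh ch [dF cF]; have cFz : {for z, continuous F}.
  by apply: differentiable_continuous; exact: nbhs_singleton dF.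
have dhF : \forall w \near z, derivable h (F w) 1 by exact: cFz dh.
split; first by apply: filterS2 dhF dF => w; exact: differentiable_comp1.
move=> a; apply: (@near_continuous_eq _ (fun w => derive1 h (F w) * pderiv a F w)).
  by apply: filterS2 dhF dF => w ? ?; rewrite pderiv_comp1.
apply: continuous_mul (cF a).
exact: (@continuous_comp _ _ _ F (derive1 h)).
Qed.

Lemma derivable_expR (y : R) : derivable expR y 1.
Proof. by have [] := is_derive_expR y. Qed.

Lemma derive1_expR : derive1 (@expR R) = expR.
Proof. by apply/funext => y; rewrite derive1E; have [] := is_derive_expR y. Qed.

Lemma c1_expR F z : c1 F z -> c1 (fun w => expR (F w)) z.
Proof.
apply: (@c1_comp1 expR); first by near=> y; exact: derivable_expR.
by rewrite derive1_expR; exact: continuous_expR.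
Unshelve. all: by end_near.
Qed.

Lemma pderiv_expR F z a : differentiable F z ->
  pderiv a (fun w => expR (F w)) z = expR (F z) * pderiv a F z.
Proof.
by move=> dF; rewrite pderiv_comp1 ?derive1_expR//; exact: derivable_expR.
Qed.

Lemma is_derive_inv (y : R) : y != 0 ->
  is_derive y 1 (GRing.inv : R -> R) (- y ^- 2).
Proof.
move=> y0; have := @is_deriveV R id y 1 1 y0 (is_derive_id _ _).
by rewrite [_ *: _]mulr1.
Qed.

Lemma near_neq0 (y : R) : y != 0 -> \forall t \near y, t != 0.
Proof. by move=> y0; apply: open_nbhs_nbhs; split => //; exact: open_neq. Qed.

Lemma c1V F z : F z != 0 -> c1 F z -> c1 (fun w => (F w)^-1) z.
Proof.
move=> F0; apply: (@c1_comp1 (GRing.inv : R -> R)).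
  by apply: filterS (near_neq0 F0) => y y0; have [] := is_derive_inv y0.
apply: (@near_continuous_eq _ (fun y : R => - y ^- 2)).
  apply: filterS (near_neq0 F0) => y y0.
  by rewrite derive1E; have [_ ->] := is_derive_inv y0.
apply: cvgN; apply: cvgV; first by rewrite expf_neq0.
exact: exprn_continuous.
Qed.

Lemma c1_sqrt F z : 0 < F z -> c1 F z -> c1 (fun w => Num.sqrt (F w)) z.
Proof.
move=> F0; have nF : \forall y \near F z, 0 < y by exact: lt_nbhsr.
apply: (@c1_comp1 (@Num.sqrt R)).
  apply: filterS nF => y y0.
  by have [] := is_derive1_sqrt y0.
apply: (@near_continuous_eq _ (fun y : R => (2 * Num.sqrt y)^-1)).
  by apply: filterS nF => y y0; rewrite derive1E; have [_ ->] := is_derive1_sqrt y0.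
apply: cvgV; first by rewrite mulf_neq0// gt_eqF// sqrtr_gt0.
by apply: cvgM; [exact: cvg_cst|exact: sqrt_continuous].
Qed.

Lemma differentiable_lin2 (p q : R) z : differentiable (lin2 p q) z.
Proof. exact/linear_differentiable/lin2_continuous. Qed.

Lemma derive_lin2 (p q : R) z v : 'D_v (lin2 p q) z = lin2 p q v.
Proof.
rewrite deriveE; last exact: differentiable_lin2.
by rewrite diff_lin//; exact: lin2_continuous.
Qed.

Lemma fst_lin2 : (fun w : R * R => w.1) = lin2 1 0.
Proof. by apply/funext => w; rewrite /lin2 mulr1 mulr0 addr0. Qed.

Lemma snd_lin2 : (fun w : R * R => w.2) = lin2 0 1.
Proof. by apply/funext => w; rewrite /lin2 mulr1 mulr0 add0r. Qed.

Lemma c1_lin2 (p q : R) z : c1 (lin2 p q) z.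
Proof.
split; first by near=> w; exact: differentiable_lin2.
move=> a; rewrite (_ : pderiv a _ = fun=> lin2 p q (basis_vec R a)).
  exact: cst_continuous.
by apply/funext => w; exact: derive_lin2.
Unshelve. all: by end_near. Qed.

Lemma c1_fst z : c1 (fun w : R * R => w.1) z.
Proof. by rewrite fst_lin2; exact: c1_lin2. Qed.

Lemma c1_snd z : c1 (fun w : R * R => w.2) z.
Proof. by rewrite snd_lin2; exact: c1_lin2. Qed.

Lemma derive_pderiv F z v : differentiable F z ->
  'D_v F z = v.1 * pderiv ord0 F z + v.2 * pderiv ord_max F z.
Proof.
move=> dF; rewrite /pderiv !deriveE//.
have {1}-> : v = v.1 *: basis_vec R ord0 + v.2 *: basis_vec R ord_max.
  case: v => x y; rewrite basis_vec0 basis_vec1; congr (_, _) => /=.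
    by rewrite [_ *: 1]mulr1 [_ *: 0]mulr0 addr0.
  by rewrite [_ *: 1]mulr1 [_ *: 0]mulr0 add0r.
by rewrite linearD !linearZ.
Qed.

Section Chain.
Variables (F : R * R -> R) (p q : R * R -> R).
Let tau w := (p w, q w).

Lemma differentiable_tau z : differentiable p z -> differentiable q z ->
  differentiable tau z.
Proof. exact: differentiable_pair. Qed.

Lemma pderiv_chain z a : differentiable F (tau z) ->
    differentiable p z -> differentiable q z ->
  pderiv a (F \o tau) z = pderiv a p z * pderiv ord0 F (tau z)
    + pderiv a q z * pderiv ord_max F (tau z).
Proof.
move=> dF dp dq; have dt := differentiable_tau dp dq.
rewrite {1}/pderiv deriveE; last exact: differentiable_comp.
rewrite diff_comp// diff_pair//= -deriveE//.
by rewrite (derive_pderiv _ dF) /= -!deriveE.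
Qed.

Lemma c1_chain z : c1 F (tau z) -> c1 p z -> c1 q z -> c1 (F \o tau) z.
Proof.
move=> [dF cF] [dp cp] [dq cq].
have ct : {for z, continuous tau}.
  apply: differentiable_continuous; apply: differentiable_tau.
    exact: nbhs_singleton dp.
  exact: nbhs_singleton dq.
have dFt : \forall w \near z, differentiable F (tau w) by exact: ct dF.
split.
  near=> w; apply: differentiable_comp; last by near: w.
  by apply: differentiable_pair; near: w.
move=> a; apply: (@near_continuous_eq _ (fun w =>
    pderiv a p w * pderiv ord0 F (tau w)
    + pderiv a q w * pderiv ord_max F (tau w))).
  by near=> w; rewrite pderiv_chain//; near: w.
apply: continuous_add; apply: continuous_mul => //.
  exact: (@continuous_comp _ _ _ tau (pderiv ord0 F)).
exact: (@continuous_comp _ _ _ tau (pderiv ord_max F)).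
Unshelve. all: by end_near. Qed.

End Chain.

Lemma Ck_on_pderiv n (U : set (R * R)) F a : Ck_on n.+1 U F ->
  Ck_on n U (pderiv a F).
Proof. by case=> _ /(_ (basis_vec R a))[]. Qed.

Lemma smooth_on_c1 (U : set (R * R)) F z :
  open U -> smooth_on U F -> U z -> c1 F z.
Proof. by move=> oU /(_ 1%N); exact: Ck_on_c1. Qed.

End C1.

(** * Compactly supported functions on the line *)

Section Line.
Variable R : realType.
Local Notation mu := (@lebesgue_measure R).

Lemma integral_segment_derive (f df : R -> R) (a b : R) : a < b ->
  (forall x : R, is_derive x 1 f (df x)) -> continuous df ->
  (\int[mu]_(x in `[a, b]) (df x)%:E = (f b - f a)%:E)%E.
Proof.
move=> ab fd cdf.
have cf : continuous f.
  move=> x; have [+ _] := fd x.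
  by move=> /derivable1_diffP /differentiable_continuous.
rewrite EFinB; apply: continuous_FTC2 => //.
- exact: continuous_subspaceT.
- split; first by move=> x _; have [] := fd x.
    by apply: cvg_at_right_filter; exact: cf.
  by apply: cvg_at_left_filter; exact: cf.
- by move=> x _; rewrite derive1E; have [] := fd x.
Qed.

Variables (f df : R -> R) (r : R).
Hypothesis fd : forall x : R, is_derive x 1 f (df x).
Hypothesis cdf : continuous df.
Hypothesis f0 : forall x, r <= `|x| -> f x = 0.

Let cf : continuous f.
Proof.
move=> x; have [+ _] := fd x.
by move=> /derivable1_diffP /differentiable_continuous.
Qed.

Lemma derive_vanish x : r < `|x| -> df x = 0.
Proof.
move=> rx; have [_ <-] := fd x.
rewrite (@near_eq_derive _ _ _ f (cst 0)) ?derive_cst//.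
have : \forall y \near x, r < `|y|.
  by have := @norm_continuous R R^o x; move/cvgr_gt; apply.
by apply: filterS => y ry; rewrite f0//; exact: ltW.
Qed.

Lemma abs_le_integral_derive x : (`|f x|%:E <= \int[mu]_y `|df y|%:E)%E.
Proof.
have m_df : measurable_fun setT (fun y : measurableTypeR R => (`|df y|%:E : \bar R)).
  apply/measurable_EFinP; apply: measurableT_comp => //.
  exact: continuous_measurable_fun.
(* [- b] lies to the left of [x] and beyond the support, so [f x] is the integral of [df] over
   [[- b, x]]. *)
pose b := Num.max `|r| `|x| + 1.
have xb : `|x| < b.
  by apply: (@le_lt_trans _ _ (Num.max `|r| `|x|)); rewrite ?ltrDl// le_max lexx orbT.
have rb : r < b.
  apply: (le_lt_trans (ler_norm r)); apply: (@le_lt_trans _ _ (Num.max `|r| `|x|)).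
    by rewrite le_max lexx.
  by rewrite ltrDl.
have fb : f (- b) = 0 by rewrite f0// normrN (le_trans (ltW rb))// ler_norm.
have bx : - b < x by move: xb; rewrite ltr_norml => /andP[].
have -> : f x = f x - f (- b) by rewrite fb subr0.
have E := integral_segment_derive bx fd cdf.
have -> : `|f x - f (- b)|%:E = (`|(f x - f (- b))%:E|)%E by [].
rewrite -E; apply: (le_trans (le_abse_integral _ _ _)) => //.
  apply/measurable_EFinP; apply: measurable_funTS; exact: continuous_measurable_fun.
by apply: ge0_subset_integral.
Qed.

Lemma integral_derive_vanish : (\int[mu]_x (df x)%:E = 0)%E.
Proof.
pose b := `|r| + 1.
have rb : r < b by rewrite (le_lt_trans (ler_norm r))// ltrDl.
have b0 : - b < b by rewrite gtrN// ltr_wpDl.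
have := integral_segment_derive b0 fd cdf.
rewrite !f0 ?normrN ?(le_trans (ltW rb)) ?ler_norm// subr0 => E0.
apply: etrans E0; rewrite [RHS]integral_mkcond; apply: eq_integral => x _.
rewrite patchE; case: ifPn => //; rewrite notin_setE/= in_itv/= => xb.
rewrite derive_vanish// ltNge; apply/negP => xr; apply: xb.
by rewrite -ler_norml (le_trans xr)// ltW.
Qed.

End Line.

(** * Compactly supported functions on the plane *)

Section Plane.
Variable R : realType.
Local Notation mu := (@lebesgue_measure R).
Local Notation RR := (measurableTypeR R * measurableTypeR R)%type.
Implicit Types (F G : R * R -> R).

(** The product sigma-algebra is generated by rectangles rather than by open sets; an open set is
    the countable union of the rational open rectangles contained in it. *)
Lemma open_measurable2 (A : set RR) : open (A : set (R * R)) -> measurable A.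
Proof.
move=> oA.
pose Q (q : (rat * rat) * (rat * rat)) : set RR :=
  `]ratr q.1.1, ratr q.1.2[%classic `*` `]ratr q.2.1, ratr q.2.2[%classic.
have -> : A = \bigcup_q (if `[< Q q `<=` A >] then Q q else set0).
  apply/seteqP; split=> [z Az|z [q _]]; last by case: asboolP => // + Qz; exact.
  have /nbhs_ballP[e /= e0 eA] : nbhs z A by exact: open_nbhs_nbhs.
  have lt1 : z.1 - e < z.1 by rewrite ltrBlDr ltrDl.
  have lt2 : z.1 < z.1 + e by rewrite ltrDl.
  have lt3 : z.2 - e < z.2 by rewrite ltrBlDr ltrDl.
  have lt4 : z.2 < z.2 + e by rewrite ltrDl.
  have [p1] := rat_in_itvoo lt1; rewrite in_itv/= => /andP[a1 b1].
  have [p2] := rat_in_itvoo lt2; rewrite in_itv/= => /andP[a2 b2].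
  have [p3] := rat_in_itvoo lt3; rewrite in_itv/= => /andP[a3 b3].
  have [p4] := rat_in_itvoo lt4; rewrite in_itv/= => /andP[a4 b4].
  exists ((p1, p2), (p3, p4)) => //.
  case: asboolP => [_|H].
    by split; rewrite /= in_itv/= ?b1 ?a2 ?b3 ?a4.
  exfalso; apply: H => -[x y] [/=]; rewrite !in_itv/= => /andP[x1 x2] /andP[y1 y2].
  apply: eA; split; rewrite /ball/=.
    by rewrite distrC ltr_distl (lt_trans a1)// (lt_trans x2).
  by rewrite distrC ltr_distl (lt_trans a3)// (lt_trans y2).
apply: countable_bigcupT_measurable => // q; case: ifP => // _.
by apply: measurableX; exact: measurable_itv.
Qed.

Lemma continuous_measurable2 (D : set RR) F : open (D : set (R * R)) ->
  (forall z, D z -> {for z, continuous F}) -> measurable_fun D (F : RR -> R).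
Proof.
move=> oD cF.
apply: (measurability _ (RGenOpens.measurableE R)) => _ [_ [a [b ->] <-]].
apply: open_measurable2; rewrite openE => z [Dz Fz].
apply: filterI; first exact: open_nbhs_nbhs.
apply: (cF z Dz); apply: open_nbhs_nbhs; split => //; exact: interval_open.
Qed.

Definition vanish (r : R) F := forall z : R * R, r <= `|z| -> F z = 0.

(** The closed ball of the norm of [R * R], which is the sup norm, in the form of a product of
    intervals suited to measure and compactness. *)
Definition box (r : R) : set RR := `[- r, r]%classic `*` `[- r, r]%classic.

Lemma boxP r (z : R * R) : box r z <-> `|z| <= r.
Proof.
rewrite prod_normE ge_max !ler_norml; split => [[]|/andP[z1 z2]].
  by rewrite /= !in_itv/= => -> ->.
by split; rewrite /= in_itv/=.
Qed.

Lemma box_compact r : compact (box r : set (R * R)).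
Proof. by apply: compact_setX; exact: segment_compact. Qed.

Lemma box_measurable r : measurable (box r).
Proof. by apply: measurableX; exact: measurable_itv. Qed.

Lemma box_finite r : (@lebesgue2 R (box r) < +oo)%E.
Proof.
rewrite /lebesgue2 product_measure1E//; [|exact: measurable_itv..].
have m : (mu [set` `[(- r)%R, r]%R] < +oo)%E.
  by rewrite lebesgue_measure_itv/=; case: ifPn => _; rewrite ?ltry.
apply: lte_mul_pinfty => //.
by rewrite ge0_fin_numE.

Qed.

Lemma vanish_restrict r F : vanish r F -> F \_ (box r) = F.
Proof.
move=> vF; apply/funext => z; rewrite patchE; case: ifPn => //.
rewrite notin_setE => nz; rewrite vF// leNgt; apply/negP => /ltW zr.
by apply: nz; exact/boxP.
Qed.

Lemma bounded_box_integrable r F : measurable_fun setT (F : RR -> R) ->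
  vanish r F -> (exists k : R, forall z, `|F z| <= k) ->
  (@lebesgue2 R).-integrable setT (EFin \o (F : RR -> R)).
Proof.
move=> mF vF [k Fk].
have -> : EFin \o (F : RR -> R) = (EFin \o (F : RR -> R)) \_ (box r).
  rewrite -[in LHS](vanish_restrict vF); apply/funext => z.
  by rewrite /= !patchE; case: ifP.
apply/(integrable_mkcond _ (box_measurable r)).
apply: (measurable_bounded_integrable (box_measurable r) (box_finite r)).
  exact: measurable_funTS mF.
- exists k; split; first exact: num_real.
  by move=> y ky z _ /=; rewrite (le_trans (Fk z))// ltW.
Qed.

Lemma vanish_bounded r F : continuous F -> vanish r F ->
  exists k : R, forall z, `|F z| <= k.
Proof.
move=> cF vF; have /compact_bounded[k [_ kF]] : compact (F @` box r).
  by apply: continuous_compact; [exact: continuous_subspaceT|exact: box_compact].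
exists (`|k| + 1) => z; have [zr|rz] := leP `|z| r; last first.
  by rewrite vF ?normr0// ltW.
apply: (kF (`|k| + 1)); first by rewrite (le_lt_trans (ler_norm k))// ltrDl.
by exists z => //; exact/boxP.
Qed.

Lemma continuous_vanish_integrable r F : continuous F -> vanish r F ->
  (@lebesgue2 R).-integrable setT (EFin \o (F : RR -> R)).
Proof.
move=> cF vF; apply: bounded_box_integrable vF (vanish_bounded cF vF).
exact: continuous_measurable2 openT (fun z _ => cF z).
Qed.

Lemma pair_norm_ge1 (z : R * R) : `|z.1| <= `|z|.
Proof. by rewrite [leRHS]prod_normE le_max lexx. Qed.

Lemma pair_norm_ge2 (z : R * R) : `|z.2| <= `|z|.
Proof. by rewrite [leRHS]prod_normE le_max lexx orbT. Qed.

(** The derivative vanishes where [F] does in a whole neighbourhood, that is for norms strictly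
    above [r]; the enlarged radius brings the large inequality of [vanish] back. *)
Lemma vanish_pderiv r F a : vanish r F -> vanish (r + 1) (pderiv a F).
Proof.
move=> vF z rz; rewrite -[RHS](pderiv_cst 0 z a); apply: pderiv_eq_near.
have rz' : r < `|z| by apply: lt_le_trans rz; rewrite ltrDl.
have : \forall y \near z, r < `|y|.
  exact: cvgr_gt (@norm_continuous R (R * R)%type z) _ rz'.
by apply: filterS => y /ltW; exact: vF.
Qed.

Section Slices.
Variables (F : R * R -> R) (r : R).
Hypothesis cF : forall z, c1 F z.
Hypothesis vF : vanish r F.

Let dF (z : R * R) a : derivable F z (basis_vec R a).
Proof. exact: diff_derivable (c1_differentiable (cF z)). Qed.

Let continuous_pair1 (y : R) : continuous (fun x : R => (x, y)).
Proof. move=> x; exact: (cvg_pair (f := id) (g := cst y) cvg_id (cvg_cst y)). Qed.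

Let continuous_pair2 (x : R) : continuous (fun y : R => (x, y)).
Proof. move=> y; exact: (cvg_pair (f := cst x) (g := id) (cvg_cst x) cvg_id). Qed.

Let slice1 (y : R) : [/\ forall x : R, is_derive x 1 (fun s => F (s, y)) (pderiv ord0 F (x, y)),
  continuous (fun x => pderiv ord0 F (x, y)) &
  forall x, r <= `|x| -> F (x, y) = 0].
Proof.
split=> x; first exact: is_derive_slice1 (@dF (x, y) ord0).
  by apply: (@continuous_comp _ _ _ (fun x : R => (x, y)));
    [exact: continuous_pair1|exact: (cF _).2].
by move=> rx; apply: vF; apply: le_trans rx _; exact: (pair_norm_ge1 (x, y)).
Qed.

Let slice2 (x : R) : [/\ forall y : R, is_derive y 1 (fun s => F (x, s)) (pderiv ord_max F (x, y)),
  continuous (fun y => pderiv ord_max F (x, y)) &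
  forall y, r <= `|y| -> F (x, y) = 0].
Proof.
split=> y; first exact: is_derive_slice2 (@dF (x, y) ord_max).
  by apply: (@continuous_comp _ _ _ (fun y : R => (x, y)));
    [exact: continuous_pair2|exact: (cF _).2].
by move=> rx; apply: vF; apply: le_trans rx _; exact: (pair_norm_ge2 (x, y)).
Qed.

Let cpF a : continuous (pderiv a F).
Proof. by move=> z; exact: (cF z).2. Qed.

(** Fubini, integrating in the direction of the derivative first: on each line the inner integral is
    that of the derivative of a compactly supported function. *)
Lemma integral_pderiv a : (\int[@lebesgue2 R]_z (pderiv a F z)%:E = 0)%E.
Proof.
have iF : (@lebesgue2 R).-integrable setT (EFin \o (pderiv a F : RR -> R)).
  exact: continuous_vanish_integrable (@cpF a) (vanish_pderiv a vF).
have : (a == ord0) || (a == ord_max) by case: a {iF} => -[|[|]].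
move=> /orP[]/eqP aE; rewrite aE in iF *.
  rewrite -(integral21_prod_meas1 iF) /= /fubini_G integral0_eq// => y _.
  by have [d c v] := slice1 y; exact: integral_derive_vanish d c v.
rewrite -(integral12_prod_meas1 iF) /= /fubini_F integral0_eq// => x _.
by have [d c v] := slice2 x; exact: integral_derive_vanish d c v.
Qed.

(** The embedding of [W^{1,1}] in [L^2] in the plane. One factor [|F (x, y)|] is bounded by the
    integral of the first partial derivative along the horizontal line, a function of [y] alone, the
    other by that of the second along the vertical line, a function of [x] alone. The integral of
    the product of these bounds factors. *)
Lemma gagliardo :
  (\int[@lebesgue2 R]_z ((F z) ^+ 2)%:E <=
   (\int[@lebesgue2 R]_z `|pderiv ord0 F z|%:E) *
   (\int[@lebesgue2 R]_z `|pderiv ord_max F z|%:E))%E.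
Proof.
have mabs a : measurable_fun setT (fun z : RR => (`|pderiv a F z|%:E : \bar R)).
  apply/measurable_EFinP; apply: measurableT_comp => //.
  exact: continuous_measurable2 openT (fun z _ => @cpF a z).
have abs0 a (z : RR) : (0 <= `|pderiv a F z|%:E)%E by rewrite lee_fin.
rewrite (fubini_tonelli2 _ (mabs ord0))// (fubini_tonelli1 _ (mabs ord_max))//.
set G := fubini_G _ _; set H := fubini_F _ _.
have G0 y : (0 <= G y)%E by exact: integral_ge0.
have H0 x : (0 <= H x)%E by exact: integral_ge0.
have mG : measurable_fun setT G by exact: measurable_fun_fubini_tonelli_G.
have mH : measurable_fun setT H by exact: measurable_fun_fubini_tonelli_F.
have mGH : measurable_fun setT (fun z : RR => (H z.1 * G z.2)%E).
  apply: emeasurable_funM.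
    exact: (measurableT_comp mH measurable_fst).
  exact: (measurableT_comp mG measurable_snd).
apply: (@le_trans _ _ (\int[@lebesgue2 R]_z (H z.1 * G z.2)%E)%E).
  apply: ge0_le_integral => //.
  - by move=> z _; rewrite lee_fin sqr_ge0.
  - apply/measurable_EFinP; apply: measurable_funX.
    by apply: continuous_measurable2 openT _ => z _; exact: c1_continuous.
  move=> z _; rewrite -real_normK ?num_real// expr2 EFinM; case: z => x y.
  apply: lee_pmul => //.
    by have [d c v] := slice2 x; exact: (abs_le_integral_derive d c v).
  by have [d c v] := slice1 y; exact: (abs_le_integral_derive d c v).
have GH0 (z : RR) : (0 <= H z.1 * G z.2)%E by apply: mule_ge0; [exact: H0|exact: G0].
have -> : (\int[@lebesgue2 R]_z (H z.1 * G z.2) =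
    \int[mu]_x (H x * \int[mu]_y G y))%E.
  apply: etrans (fubini_tonelli1 _ mGH GH0) _.
  apply: eq_integral => x _.
  exact: (@ge0_integralZl _ _ _ mu _ measurableT G mG (H x) (fun y _ => G0 y) (H0 x)).
rewrite muleC.
rewrite (@ge0_integralZr _ _ _ mu _ measurableT H mH _ (fun x _ => H0 x)).
  exact: lexx.
by apply: integral_ge0 => y _; exact: G0.
Qed.

End Slices.
End Plane.

(** * Integration against a measure with a density in a parametrization *)

Section Density.
Local Open Scope ereal_scope.
Context d1 d2 (X : measurableType d1) (Y : measurableType d2) (R : realType).
Variables (mu : {measure set X -> \bar R}) (nu : {measure set Y -> \bar R}).
Variables (D : set X) (E : set Y) (psi : Y -> X) (rho : Y -> R).
Hypotheses (mD : measurable D) (mE : measurable E).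
Hypotheses (mpsi : measurable_fun E psi) (mrho : measurable_fun E rho).
Hypothesis rho0 : forall y, (0 <= rho y)%R.
Hypothesis muE : forall B : set X, measurable B ->
  mu (B `&` D) = \int[nu]_(y in E `&` psi @^-1` B) (rho y)%:E.

Import HBNNSimple.

Let density_indic (B : set X) : measurable B ->
  \int[mu]_(x in D) (\1_B x)%:E = \int[nu]_(y in E) ((\1_B (psi y))%:E * (rho y)%:E).
Proof.
move=> mB; rewrite integral_indic// muE// integral_mkcondr.
apply: eq_integral => y _; rewrite patchE indicE.
have -> : (y \in psi @^-1` B) = (psi y \in B) by apply/idP/idP; rewrite !inE.
by case: (psi y \in B); rewrite ?mul1e ?mul0e.
Qed.

Let mcomp (g : X -> \bar R) : measurable_fun setT g ->
  measurable_fun E (fun y => g (psi y) * (rho y)%:E).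
Proof.
move=> mg; apply: emeasurable_funM; last exact/measurable_EFinP.
exact: (@measurable_comp _ _ _ _ _ _ setT g).
Qed.

Let density_nnsfun (h : {nnsfun X >-> R}) :
  \int[mu]_(x in D) (h x)%:E = \int[nu]_(y in E) ((h (psi y))%:E * (rho y)%:E).
Proof.
have hE x : (h x)%:E = \sum_(k \in range h) (k%:E * (\1_(h @^-1` [set k]) x)%:E).
  by rewrite fsumEFin //= fimfunE.
have m1 k : measurable_fun setT (fun x => k%:E * (\1_(h @^-1` [set k]) x)%:E).
  by apply/measurable_funeM/measurable_EFinP.
under eq_integral do rewrite hE.
rewrite ge0_integral_fsum//; last 2 first.
  - by move=> k; exact: measurable_funTS.
  - by move=> k x _; exact: nnfun_muleindic_ge0.
under [RHS]eq_integral => y _ do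
  (rewrite hE ge0_mule_fsuml; last by move=> k; exact: nnfun_muleindic_ge0).
rewrite ge0_integral_fsum//; last 2 first.
  - by move=> k; exact: (mcomp (m1 k)).
  - by move=> k y _; rewrite mule_ge0 ?lee_fin//; exact: nnfun_muleindic_ge0.
apply: eq_fsbigr => k; rewrite inE => -[x0 _ <-{k}].
rewrite ge0_integralZl//; last 2 first.
  - exact/measurable_EFinP/measurable_funTS.
  - by rewrite lee_fin.
rewrite density_indic//.
under [RHS]eq_integral do rewrite -muleA.
rewrite ge0_integralZl//.
- apply: (mcomp (g := EFin \o \1_(h @^-1` [set h x0]))).
  exact/measurable_EFinP.
- by move=> y _; rewrite mule_ge0 ?lee_fin.
- by rewrite lee_fin.
Qed.

(** The hypothesis [muE] is the case of indicator functions; linearity gives simple functions and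
    monotone convergence the rest. This is how the volume, which the surface specifies on sets
    within a chart, comes to integrate functions. *)
Lemma ge0_integral_density (w : X -> \bar R) : measurable_fun setT w ->
  (forall x, 0 <= w x) ->
  \int[mu]_(x in D) w x = \int[nu]_(y in E) (w (psi y) * (rho y)%:E).
Proof.
move=> mw w0; pose h := nnsfun_approx measurableT mw.
transitivity (limn (fun n => \int[mu]_(x in D) (h n x)%:E)).
  rewrite -monotone_convergence//.
  - by apply: eq_integral => x _; apply/esym/cvg_lim => //; exact: cvg_nnsfun_approx.
  - by move=> n; exact/measurable_EFinP/measurable_funTS.
  - by move=> n x _; rewrite lee_fin.
  - by move=> x _ m n mn; rewrite lee_fin; exact/lefP/nd_nnsfun_approx.
under eq_fun do rewrite density_nnsfun.
rewrite -monotone_convergence//.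
- apply: eq_integral => y _; apply/cvg_lim => //.
  under eq_fun do rewrite muleC.
  rewrite muleC; apply: cvgeZl => //; exact: cvg_nnsfun_approx.
- by move=> n; apply: (mcomp (g := EFin \o h n)); exact/measurable_EFinP.
- by move=> n y _; rewrite mule_ge0 ?lee_fin.
- move=> y _ m n mn; rewrite lee_wpmul2r ?lee_fin//.
  exact/lefP/nd_nnsfun_approx.
Qed.

Lemma integral_density (w : X -> R) : measurable_fun setT w ->
  \int[mu]_(x in D) (w x)%:E = \int[nu]_(y in E) (w (psi y) * rho y)%:E.
Proof.
move=> mw; have mEw : measurable_fun setT (EFin \o w) by exact/measurable_EFinP.
rewrite integralE [RHS]integralE; congr (_ - _).
  rewrite (ge0_integral_density (measurable_funepos mEw))//.
  apply: eq_integral => y _; rewrite !funeposE EFinM.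
  by rewrite maxe_pMl ?mul0e// lee_fin.
rewrite (ge0_integral_density (measurable_funeneg mEw))//.
apply: eq_integral => y _; rewrite !funenegE EFinM -mulNe.
by rewrite maxe_pMl ?mul0e// lee_fin.
Qed.

End Density.

(** * Positive definite matrices of size 2 *)

Section Matrix2.
Variable R : realType.
Implicit Type g : 'M[R]_2.

Lemma mx2_eq (A B : 'M[R]_2) : A ord0 ord0 = B ord0 ord0 ->
  A ord0 ord_max = B ord0 ord_max -> A ord_max ord0 = B ord_max ord0 ->
  A ord_max ord_max = B ord_max ord_max -> A = B.
Proof.
move=> h00 h01 h10 h11; apply/matrixP => i j.
have H (k : 'I_2) : k = ord0 \/ k = ord_max.
  by case: k => -[|[|//]] ?; [left|right]; apply/val_inj.
by case: (H i) => ->; case: (H j) => ->.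
Qed.

Lemma sum2 (V : nmodType) (F : 'I_2 -> V) :
  \sum_(i < 2) F i = F ord0 + F ord_max.
Proof. by rewrite big_ord_recl big_ord1; congr (_ + F _); exact/val_inj. Qed.

Lemma det2 g : \det g =
  g ord0 ord0 * g ord_max ord_max - g ord0 ord_max * g ord_max ord0.
Proof.
rewrite (expand_det_row _ ord0) sum2 /cofactor !det_mx11 !mxE /=.
rewrite expr0 expr1 mul1r mulN1r mulrN.
by congr (_ * _ - _ * _); congr (g _ _); apply/val_inj.
Qed.

Definition posdef g := g^T = g /\
  forall v : 'rV[R]_2, v != 0 -> 0 < (v *m g *m v^T) 0 0.

Variable g : 'M[R]_2.
Hypothesis gpd : posdef g.
Let p := g ord0 ord0.
Let q := g ord0 ord_max.
Let r := g ord_max ord_max.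

Lemma posdef_sym i j : g i j = g j i.
Proof. by case: gpd => sg _; rewrite -{1}sg mxE. Qed.

Let form (x y : R) : (x != 0) || (y != 0) ->
  0 < p * x ^+ 2 + q * x * y *+ 2 + r * y ^+ 2.
Proof.
move=> xy; pose v : 'rV[R]_2 := \row_j (if j == ord0 then x else y).
have [_ /(_ v)] := gpd; rewrite !mxE !sum2 !mxE !sum2 !mxE /=.
rewrite (posdef_sym ord_max ord0) -/p -/q -/r => H.
rewrite [ltRHS](_ : _ = (x * p + y * q) * x + (x * q + y * r) * y); last by ring.
apply: H; apply/negP => /eqP /rowP v0; move: xy.
have := v0 ord0; have := v0 ord_max; rewrite !mxE /= => -> ->.
by rewrite eqxx.
Qed.

Lemma posdef_g00 : 0 < p.
Proof. by have := @form 1 0; rewrite oner_eq0 => /(_ isT); rewrite expr1n; nra. Qed.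

Lemma posdef_g11 : 0 < r.
Proof. by have := @form 0 1; rewrite oner_eq0 orbT => /(_ isT); rewrite expr1n; nra. Qed.

Lemma det2_sym : \det g = p * r - q ^+ 2.
Proof. by rewrite det2 (posdef_sym ord_max ord0) -expr2. Qed.

Lemma posdef_det : 0 < \det g.
Proof.
have p0 := posdef_g00.
(* At the vector [(- q, p)] the quadratic form takes the value [p * \det g]. *)
have := @form (- q) p; rewrite (gt_eqF p0) orbT => /(_ isT).
rewrite [ltRHS](_ : _ = p * \det g); last by rewrite det2_sym; ring.
by rewrite pmulr_rgt0.
Qed.

Lemma posdef_unit : g \in unitmx.
Proof. by rewrite unitmxE unitfE gt_eqF// posdef_det. Qed.

Lemma invmx2 : [/\ invmx g ord0 ord0 = r / \det g,
  invmx g ord0 ord_max = - q / \det g, invmx g ord_max ord0 = - q / \det g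
  & invmx g ord_max ord_max = p / \det g].
Proof.
have d0 : \det g != 0 by rewrite gt_eqF// posdef_det.
pose A : 'M[R]_2 := \matrix_(i, j) (if i == ord0 then
  (if j == ord0 then r / \det g else - q / \det g) else
  (if j == ord0 then - q / \det g else p / \det g)).
have gA : g *m A = 1%:M.
  apply: mx2_eq; rewrite !mxE sum2 !mxE /= ?(posdef_sym ord_max ord0) -/p -/q -/r;
    move: d0; rewrite det2_sym => d0; by field.
have -> : invmx g = A.
  by rewrite -[LHS]mulmx1 -gA mulmxA mulVmx ?mul1mx// posdef_unit.
by rewrite !mxE.
Qed.

End Matrix2.

Section Gradient.
Variable R : realType.
Implicit Types (F G : R * R -> R) (z : R * R) (g : R * R -> 'M[R]_2).

Definition drow F z : 'rV[R]_2 := \row_a pderiv a F z.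

(** The inner product of the gradients of [F] and [G], that is the dual metric on their
    differentials; as a matrix product, it turns a change of chart into matrix algebra. *)
Definition gip g F G z : R := (drow F z *m invmx (g z) *m (drow G z)^T) 0 0.

Lemma gipE g F G z : posdef (g z) -> gip g F G z =
  (g z ord_max ord_max * pderiv ord0 F z * pderiv ord0 G z
   - g z ord0 ord_max * (pderiv ord0 F z * pderiv ord_max G z
       + pderiv ord_max F z * pderiv ord0 G z)
   + g z ord0 ord0 * pderiv ord_max F z * pderiv ord_max G z) / \det (g z).
Proof.
move=> gp; have [a00 a01 a10 a11] := invmx2 gp.
rewrite /gip !mxE !sum2 !mxE !sum2 !mxE a00 a01 a10 a11.
have d0 : \det (g z) != 0 by rewrite gt_eqF// posdef_det.
move: (pderiv ord0 F z) (pderiv ord_max F z) (pderiv ord0 G z) (pderiv ord_max G z).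
move: (g z ord0 ord0) (g z ord0 ord_max) (g z ord_max ord_max) (\det _) d0.
by move=> p q r d d0 ? ? ? ?; field.
Qed.

(** Inverting the transformation rule of the metric gives [J *m invmx gi *m J^T = invmx gj]. *)
Lemma gip_trans (J gi gj : 'M[R]_2) (x y : 'rV[R]_2) :
  J \in unitmx -> gi \in unitmx -> gj \in unitmx -> gi = J^T *m gj *m J ->
  (x *m J) *m invmx gi *m (y *m J)^T = x *m invmx gj *m y^T.
Proof.
move=> uJ ui uj E.
have H : J *m invmx gi *m J^T = invmx gj.
  have uJT : J^T \in unitmx by rewrite unitmx_tr.
  have K : J^T *m (gj *m (J *m invmx gi *m J^T)) = J^T.
    by rewrite !mulmxA -E mulmxV// mul1mx.
  have {}K : gj *m (J *m invmx gi *m J^T) = 1%:M.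
    by rewrite -[LHS](mulKmx uJT) K mulVmx.
  by rewrite -[LHS]mul1mx -(mulVmx uj) -(mulmxA (invmx gj)) K mulmx1.
by rewrite trmx_mul -H !mulmxA.
Qed.

End Gradient.

Section PosdefForm.
Variable R : realType.
Variables (g : 'M[R]_2).
Hypothesis gpd : posdef g.

Definition qf (x y : 'rV[R]_2) : R := (x *m invmx g *m y^T) 0 0.

Lemma qfDl x x' y : qf (x + x') y = qf x y + qf x' y.
Proof. by rewrite /qf !mulmxDl mxE. Qed.

Lemma qfDr x y y' : qf x (y + y') = qf x y + qf x y'.
Proof. by rewrite /qf linearD mulmxDr mxE. Qed.

Lemma qfZl a x y : qf (a *: x) y = a * qf x y.
Proof. by rewrite /qf -!scalemxAl mxE. Qed.

Lemma qfZr a x y : qf x (a *: y) = a * qf x y.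
Proof. by rewrite /qf linearZ -scalemxAr mxE. Qed.

Lemma qfC x y : qf x y = qf y x.
Proof.
have sg : (invmx g)^T = invmx g by rewrite trmx_inv; case: gpd => ->.
rewrite /qf (_ : y *m _ *m _ = (x *m invmx g *m y^T)^T) ?mxE//.
by rewrite !trmx_mul trmxK sg mulmxA.
Qed.

Lemma qf_ge0 x : 0 <= qf x x.
Proof.
have [a00 a01 a10 a11] := invmx2 gpd.
rewrite /qf !mxE !sum2 !mxE !sum2 ?mxE a00 a01 a10 a11.
have d0 := posdef_det gpd; have r0 := posdef_g11 gpd; have := det2_sym gpd.
move: (\det g) (g ord0 ord0) (g ord0 ord_max) (g ord_max ord_max) d0 r0
  => d p q r d0 r0 dE.
move: (x ord0 ord0) (x ord0 ord_max) => a b.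
(* Completion of the square in the adjugate form [r a^2 - 2 q a b + p b^2], with [d = p r - q^2]. *)
rewrite [leRHS](_ : _ = (r * d)^-1 * ((r * a - q * b) ^+ 2 + d * b ^+ 2)).
  apply: mulr_ge0; first by rewrite invr_ge0 ltW// mulr_gt0.
  by apply: addr_ge0; [exact: sqr_ge0|exact: mulr_ge0 (ltW d0) (sqr_ge0 _)].
have -> : p = (d + q ^+ 2) / r by rewrite dE; field; rewrite gt_eqF.
by field; rewrite !gt_eqF.
Qed.

Lemma qf_young x y : qf (x + y) (x + y) <= 2 * qf x x + 2 * qf y y.
Proof.
have := qf_ge0 (x + (-1) *: y).
rewrite !(qfDl, qfDr, qfZl, qfZr) (qfC y x); nra.
Qed.

End PosdefForm.

(** * Charts, gradients and means *)

Lemma derivable_fst (R : realType) (F : R * R -> R * R) z v :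
  derivable F z v -> derivable (fun w => (F w).1) z v /\
    'D_v (fun w => (F w).1) z = ('D_v F z).1.
Proof.
move=> dF; have {dF} : h^-1 *: ((F \o shift z) (h *: v) - F z) @[h --> 0^']
    --> 'D_v F z by exact: dF.
move: ('D_v F z) => l dF.
have H : h^-1 *: (((fun w => (F w).1) \o shift z) (h *: v) - (F z).1) @[h --> 0^']
    --> l.1.
  rewrite (_ : (fun h : R => _) =
      fst \o (fun h : R => h^-1 *: ((F \o shift z) (h *: v) - F z)))//.
  exact: (cvg_comp _ _ dF (@cvg_fst _ _ (nbhs l.1) (nbhs l.2) _)).
by split; [apply/cvg_ex; exists l.1|exact/cvg_lim].
Qed.

Lemma derivable_snd (R : realType) (F : R * R -> R * R) z v :
  derivable F z v -> derivable (fun w => (F w).2) z v /\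
    'D_v (fun w => (F w).2) z = ('D_v F z).2.
Proof.
move=> dF; have {dF} : h^-1 *: ((F \o shift z) (h *: v) - F z) @[h --> 0^']
    --> 'D_v F z by exact: dF.
move: ('D_v F z) => l dF.
have H : h^-1 *: (((fun w => (F w).2) \o shift z) (h *: v) - (F z).2) @[h --> 0^']
    --> l.2.
  rewrite (_ : (fun h : R => _) =
      snd \o (fun h : R => h^-1 *: ((F \o shift z) (h *: v) - F z)))//.
  exact: (cvg_comp _ _ dF (@cvg_snd _ _ (nbhs l.1) (nbhs l.2) _)).
by split; [apply/cvg_ex; exists l.2|exact/cvg_lim].
Qed.

Section Surface.
Variables (R : realType) (M : closed_surface R).
Implicit Types (i j : sf_idx M) (x : M) (z w : R * R) (u a b : M -> R).

Definition img i : set (R * R) := sf_chart i @` sf_dom i.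
Definition tau i j := sf_chart j \o sf_inv i.
Definition ov i j : set (R * R) := sf_chart i @` (sf_dom i `&` sf_dom j).

Lemma img_near i z : img i z -> nbhs z (img i).
Proof. by move=> iz; apply: open_nbhs_nbhs; split => //; exact: sf_img_open. Qed.

Lemma inv_dom i z : img i z -> sf_dom i (sf_inv i z).
Proof. by move=> [x ix <-]; rewrite sf_chartK. Qed.

Lemma chart_inv i z : img i z -> sf_chart i (sf_inv i z) = z.
Proof. by move=> [x ix <-]; rewrite sf_chartK. Qed.

Lemma img_chart i x : sf_dom i x -> img i (sf_chart i x).
Proof. by move=> ix; exists x. Qed.

Lemma ovP i j z : ov i j z <-> img i z /\ sf_dom j (sf_inv i z).
Proof.
split=> [[x [ix jx] <-]|[iz jz]].
  by split; [exact: img_chart|rewrite sf_chartK].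
by exists (sf_inv i z); rewrite ?chart_inv//; split=> //; exact: inv_dom.
Qed.

Lemma ov_near i j z : ov i j z -> nbhs z (ov i j).
Proof.
move=> /ovP[iz jz]; have ci := sf_inv_cont iz.
have nj : nbhs z (sf_inv i @^-1` (sf_dom j)).
  by apply: ci; apply: open_nbhs_nbhs; split=> //; exact: sf_dom_open.
by apply: filterS2 (img_near iz) nj => w iw jw; exact/ovP.
Qed.

Lemma ov_open i j : open (ov i j).
Proof. by rewrite openE => z; exact: ov_near. Qed.

Lemma ov_chart i j x : sf_dom i x -> sf_dom j x -> ov i j (sf_chart i x).
Proof. by move=> ix jx; exists x. Qed.

Lemma tau_img i j z : ov i j z -> img j (tau i j z).
Proof. by move=> /ovP[_ jz]; exact: img_chart. Qed.

Lemma in_chart_tau i j u z : ov i j z ->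
  in_chart i u z = in_chart j u (tau i j z).
Proof. by move=> /ovP[iz jz]; rewrite /in_chart /tau /= sf_chartK. Qed.

Let tau_Ck i j z : ov i j z -> {for z, continuous (tau i j)} /\
  forall v, [/\ forall w, ov i j w -> derivable (tau i j) w v &
     forall w, ov i j w -> {for w, continuous (fun y => 'D_v (tau i j) y)}].
Proof.
move=> oz; have [ct Dt] := @sf_trans_smooth R M i j 1%N; split; first exact: ct.
by move=> v; have [dt [cdt _]] := Dt v.
Qed.

Lemma tau_c1 i j z : ov i j z ->
  c1 (fun w => (tau i j w).1) z /\ c1 (fun w => (tau i j w).2) z.
Proof.
move=> oz; split; apply: (@Ck_on_c1 R (ov i j) _ z (@ov_open i j) _ oz).
  split=> [w ow|v].
    apply: (@continuous_comp _ _ _ (tau i j) fst); first exact: (tau_Ck ow).1.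
    exact: cvg_fst.
  have [d c] := (tau_Ck oz).2 v; split=> [w ow|].
    exact: (derivable_fst (d w ow)).1.
  split=> // w ow; apply: (@near_continuous_eq _ _ (fun y => ('D_v (tau i j) y).1)).
    apply: filterS (ov_near ow) => y oy.
    by have [_ ->] := derivable_fst (d y oy).
  apply: (@continuous_comp _ _ _ (fun y => 'D_v (tau i j) y) fst); first exact: c.
  exact: cvg_fst.
split=> [w ow|v].
  apply: (@continuous_comp _ _ _ (tau i j) snd); first exact: (tau_Ck ow).1.
  exact: cvg_snd.
have [d c] := (tau_Ck oz).2 v; split=> [w ow|].
  exact: (derivable_snd (d w ow)).1.
split=> // w ow; apply: (@near_continuous_eq _ _ (fun y => ('D_v (tau i j) y).2)).
  apply: filterS (ov_near ow) => y oy.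
  by have [_ ->] := derivable_snd (d y oy).
apply: (@continuous_comp _ _ _ (fun y => 'D_v (tau i j) y) snd); first exact: c.
exact: cvg_snd.
Qed.

Definition C1M u := forall i z, img i z -> c1 (in_chart i u) z.

(** The chain rule: row vectors of partial derivatives are multiplied by the Jacobian on the right,
    as [gip_trans] expects. *)
Lemma drow_tau i j u z : ov i j z -> c1 (in_chart j u) (tau i j z) ->
  drow (in_chart i u) z = drow (in_chart j u) (tau i j z) *m Defs.jacobian (tau i j) z.
Proof.
move=> oz cu; have [t1 t2] := tau_c1 oz.
apply/rowP => b; rewrite !mxE sum2 !mxE /Defs.coord /=.
have [d _] := (tau_Ck oz).2 (basis_vec R b).
have [_ E1] := derivable_fst (d z oz); have [_ E2] := derivable_snd (d z oz).
rewrite -E1 -E2 mulrC [X in _ + X]mulrC.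
rewrite (@pderiv_eq_near _ _ (in_chart j u \o
  (fun w => ((tau i j w).1, (tau i j w).2)))); last first.
  apply: filterS (ov_near oz) => w ow.
  by rewrite (in_chart_tau _ ow) /=; congr (in_chart j u _); case: (tau i j w).
rewrite pderiv_chain -?surjective_pairing//.
- exact: c1_differentiable cu.
- exact: c1_differentiable t1.
- exact: c1_differentiable t2.
Qed.

Lemma metric_posdef i z : img i z -> posdef (sf_metric i z).
Proof. by move=> iz; split; [exact: sf_metric_sym|exact: sf_metric_pos]. Qed.

Lemma gip_tau i j a b z : ov i j z -> c1 (in_chart j a) (tau i j z) ->
    c1 (in_chart j b) (tau i j z) ->
  gip (sf_metric i) (in_chart i a) (in_chart i b) z =
  gip (sf_metric j) (in_chart j a) (in_chart j b) (tau i j z).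
Proof.
move=> oz ca cb; rewrite /gip (drow_tau oz ca) (drow_tau oz cb).
congr (fun_of_matrix _ _ _); apply: gip_trans.
- by rewrite unitmxE unitfE gt_eqF// sf_oriented.
- by apply: posdef_unit; apply: metric_posdef; case/ovP: oz.
- by apply: posdef_unit; apply: metric_posdef; exact: tau_img.
- exact: sf_metric_trans.
Qed.

Definition gradip a b x : R :=
  gip (sf_metric (sf_at x)) (in_chart (sf_at x) a) (in_chart (sf_at x) b)
    (sf_chart (sf_at x) x).

(** The chart [sf_at x] in the definition of [gradip] may jump from point to point. Being free to
    use one chart on a whole neighbourhood is what makes continuity and integration possible. *)
Lemma gradip_chart i a b x : C1M a -> C1M b -> sf_dom i x ->
  gradip a b x = gip (sf_metric i) (in_chart i a) (in_chart i b) (sf_chart i x).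
Proof.
move=> ca cb ix; have ax := sf_atP x.
rewrite /gradip (@gip_tau (sf_at x) i); first by rewrite /tau /= sf_chartK.
- exact: ov_chart.
- by apply: ca; apply: tau_img; exact: ov_chart.
- by apply: cb; apply: tau_img; exact: ov_chart.
Qed.

Lemma metric_c1 i z k l : img i z -> c1 (fun w => sf_metric i w k l) z.
Proof. by apply: smooth_on_c1; [exact: sf_img_open|exact: sf_metric_smooth]. Qed.

Lemma dom_near i x : sf_dom i x -> nbhs x (sf_dom i).
Proof. by move=> ix; apply: open_nbhs_nbhs; split => //; exact: sf_dom_open. Qed.

Lemma continuous_chart i (F : R * R -> R) u x : sf_dom i x ->
  (forall y, sf_dom i y -> u y = F (sf_chart i y)) ->
  {for sf_chart i x, continuous F} -> {for x, continuous u}.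
Proof.
move=> ix uF cF; apply: (@near_continuous_eq _ _ (F \o sf_chart i)).
  by apply: filterS (dom_near ix) => y iy; rewrite uF.
by apply: continuous_comp => //; exact: sf_chart_cont.
Qed.

Lemma det_metric_c1 i z : img i z -> c1 (fun w => \det (sf_metric i w)) z.
Proof.
move=> iz; under eq_fun do rewrite det2.
by apply: c1B; apply: c1M; exact: metric_c1.
Qed.

Lemma gip_continuous i F G z : img i z -> c1 F z -> c1 G z ->
  {for z, continuous (gip (sf_metric i) F G)}.
Proof.
move=> iz cF cG.
apply: (@near_continuous_eq _ _ (fun z =>
  (sf_metric i z ord_max ord_max * pderiv ord0 F z * pderiv ord0 G z
   + - (sf_metric i z ord0 ord_max * (pderiv ord0 F z * pderiv ord_max G z
       + pderiv ord_max F z * pderiv ord0 G z))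
   + sf_metric i z ord0 ord0 * pderiv ord_max F z * pderiv ord_max G z)
   * (\det (sf_metric i z))^-1)).
  apply: filterS (img_near iz) => w iw; rewrite gipE//; exact: metric_posdef.
have cm k l := c1_continuous (metric_c1 k l iz).
have [_ F'] := cF; have [_ G'] := cG.
apply: continuous_mul.
  apply: continuous_add; [apply: continuous_add|].
  - by apply: continuous_mul => //; exact: continuous_mul.
  - apply: continuousN; apply: continuous_mul => //.
    by apply: continuous_add; exact: continuous_mul.
  - by apply: continuous_mul => //; exact: continuous_mul.
apply: continuousV; last exact: c1_continuous (det_metric_c1 iz).
by rewrite gt_eqF// posdef_det//; exact: metric_posdef.
Qed.

Lemma gradip_continuous a b : C1M a -> C1M b -> continuous (gradip a b).
Proof.
move=> ca cb x; have ix := sf_atP x.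
apply: (continuous_chart ix (F := gip (sf_metric (sf_at x)) (in_chart (sf_at x) a)
   (in_chart (sf_at x) b))).
  by move=> y iy; exact: gradip_chart.
by apply: gip_continuous; [exact: img_chart|exact/ca/img_chart|exact/cb/img_chart].
Qed.

Lemma C1M_continuous a : C1M a -> continuous a.
Proof.
move=> ca x; have ix := sf_atP x.
apply: (continuous_chart ix (F := in_chart (sf_at x) a)).
  by move=> y iy; rewrite /in_chart /= sf_chartK.
by apply: c1_continuous; exact/ca/img_chart.
Qed.

Lemma C1M_cst (k : R) : C1M (fun=> k).
Proof. by move=> i z _; exact: c1_cst. Qed.

Lemma C1M_mul a b : C1M a -> C1M b -> C1M (fun x => a x * b x).
Proof. by move=> ca cb i z iz; apply: c1M; [exact: ca|exact: cb]. Qed.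

Lemma C1M_expR a : C1M a -> C1M (fun x => expR (a x)).
Proof. by move=> ca i z iz; apply: c1_expR; exact: ca. Qed.

Lemma C1M_inv a : C1M a -> (forall x, a x != 0) -> C1M (fun x => (a x)^-1).
Proof. by move=> ca a0 i z iz; apply: c1V; [exact: a0|exact: ca]. Qed.

Lemma C1M_sum (I : Type) (s : seq I) (F : I -> M -> R) :
  (forall k, C1M (F k)) -> C1M (fun x => \sum_(k <- s) F k x).
Proof. by move=> cF i z iz; apply: c1_sum => k; exact: cF. Qed.

End Surface.

Section Mean.
Variables (R : realType) (M : closed_surface R).
Hypothesis volM : sf_vol M [set: borel M] = 1%E.
Local Notation mu := (sf_vol M).
Implicit Types (u v w : M -> R) (i : sf_idx M) (x : M).

Lemma open_borel (A : set M) : open A -> measurable (A : set (borel M)).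
Proof. by move=> oA; exact: sub_sigma_algebra. Qed.

Lemma continuous_borel u : continuous u ->
  measurable_fun [set: borel M] (u : borel M -> R).
Proof.
move=> /continuousP cu.
apply: (measurability _ (RGenOpens.measurableE R)) => _ [_ [a [b ->] <-]].
by rewrite setTI; apply: open_borel; apply: cu; exact: interval_open.
Qed.

Lemma continuous_bounded u : continuous u -> exists k : R, 0 < k /\ forall x, `|u x| <= k.
Proof.
move=> cu; have /compact_bounded[k [_ kF]] : compact (u @` [set: M]).
  by apply: continuous_compact; [exact: continuous_subspaceT|exact: sf_compact].
exists (`|k| + 1); split; first by rewrite ltr_wpDl.
move=> x; apply: (kF (`|k| + 1)); last by exists x.
by rewrite (le_lt_trans (ler_norm k))// ltrDl.
Qed.

Lemma measurable_bounded_meanable u k :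
    measurable_fun [set: borel M] (u : borel M -> R) -> (forall x, `|u x| <= k) ->
  mu.-integrable setT (EFin \o u).
Proof.
move=> mU uk; apply: measurable_bounded_integrable => //.
  by rewrite volM ltry.
exists k; split; first exact: num_real.
by move=> y ky z _ /=; rewrite (le_trans (uk z))// ltW.
Qed.

Lemma continuous_meanable u : continuous u -> mu.-integrable setT (EFin \o u).
Proof.
move=> cu; have [k [_ uk]] := continuous_bounded cu.
exact: measurable_bounded_meanable (continuous_borel cu) uk.
Qed.

(** An average, as the volume is 1. It is used for continuous functions, which are bounded by
    compactness, so that the real-valued integral is the genuine one. *)
Definition mean u : R := \int[mu]_x u x.

Lemma integral_mean u : continuous u -> (\int[mu]_x (u x)%:E = (mean u)%:E)%E.
Proof.
move=> cu; rewrite /mean /Rintegral fineK//.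
exact: integrable_fin_num (continuous_meanable cu).
Qed.

Lemma eq_mean u v : (forall x, u x = v x) -> mean u = mean v.
Proof. by move=> /funext ->. Qed.

Lemma meanD u v : continuous u -> continuous v ->
  mean (fun x => u x + v x) = mean u + mean v.
Proof.
by move=> cu cv; apply: RintegralD => //; exact: continuous_meanable.
Qed.

Lemma meanB u v : continuous u -> continuous v ->
  mean (fun x => u x - v x) = mean u - mean v.
Proof.
by move=> cu cv; apply: RintegralB => //; exact: continuous_meanable.
Qed.

Lemma meanZ k u : continuous u -> mean (fun x => k * u x) = k * mean u.
Proof. by move=> cu; apply: RintegralZl => //; exact: continuous_meanable. Qed.

Lemma mean_cst k : mean (fun=> k) = k.
Proof. by rewrite /mean Rintegral_cst// [X in fine X]volM mulr1. Qed.

Lemma mean_ge0 u : (forall x, 0 <= u x) -> 0 <= mean u.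
Proof. by move=> u0; exact: Rintegral_ge0. Qed.

Lemma mean_le u v : continuous u -> continuous v -> (forall x, u x <= v x) ->
  mean u <= mean v.
Proof.
by move=> cu cv uv; apply: le_Rintegral => //; exact: continuous_meanable.
Qed.

Lemma mean_abs u : continuous u -> `|mean u| <= mean (fun x => `|u x|).
Proof. by move=> cu; apply: le_normr_Rintegral => //; exact: continuous_meanable. Qed.

Lemma mean_bound u k : continuous u -> (forall x, `|u x| <= k) -> `|mean u| <= k.
Proof.
move=> cu uk; apply: le_trans (mean_abs cu) _.
rewrite -[leRHS]mean_cst; apply: mean_le => //; last exact: cst_continuous.
by move=> x; apply: continuous_comp; [exact: cu|exact: norm_continuous].
Qed.

Lemma mean_sum (I : Type) (s : seq I) (F : I -> M -> R) :
  (forall k, continuous (F k)) ->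
  mean (fun x => \sum_(k <- s) F k x) = \sum_(k <- s) mean (F k).
Proof.
move=> cF; elim: s => [|k s IH].
  by under eq_mean do rewrite big_nil; rewrite big_nil mean_cst.
under eq_mean do rewrite big_cons; rewrite big_cons meanD ?IH//.
elim: s {IH} => [|j s IH]; first by under eq_fun do rewrite big_nil; exact: cst_continuous.
by under eq_fun do rewrite big_cons; move=> x; apply: continuous_add; [exact: cF|exact: IH].
Qed.

Definition dens i (z : R * R) : R := Num.sqrt (\det (sf_metric i z)).

Lemma det_metric_gt0 i z : img i z -> 0 < \det (sf_metric i z).
Proof. by move=> iz; exact: posdef_det (metric_posdef iz). Qed.

Lemma dens_gt0 i z : img i z -> 0 < dens i z.
Proof. by move=> iz; rewrite sqrtr_gt0 det_metric_gt0. Qed.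

Lemma dens_ge0 i z : 0 <= dens i z. Proof. exact: sqrtr_ge0. Qed.

Lemma dens_c1 i z : img i z -> c1 (dens i) z.
Proof.
by move=> iz; apply: c1_sqrt; [exact: det_metric_gt0|exact: det_metric_c1].
Qed.

Local Notation RR := (measurableTypeR R * measurableTypeR R)%type.

Lemma inv_borel i :
  measurable_fun (img i : set RR) (sf_inv i : RR -> borel M).
Proof.
apply: (@measurability _ _ RR (borel M) (img i) (sf_inv i) (@open M) erefl) => _ [A oA <-].
apply: open_measurable2; rewrite openE => z [iz Az].
apply: filterI; first exact: img_near.
by apply: (sf_inv_cont iz); apply: open_nbhs_nbhs; split.
Qed.

Lemma chart_integral i u : measurable_fun [set: borel M] (u : borel M -> R) ->
  (\int[mu]_(x in sf_dom i) (u x)%:E =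
   \int[@lebesgue2 R]_(z in (img i : set RR)) (u (sf_inv i z) * dens i z)%:E)%E.
Proof.
move=> mU; apply: (@integral_density _ _ (borel M) RR R mu (@lebesgue2 R)
  (sf_dom i) (img i) (sf_inv i) (dens i) _ _ _ _ _ _ u mU).
- apply: open_borel; exact: sf_dom_open.
- apply: open_measurable2; exact: sf_img_open.
- exact: inv_borel.
- apply: continuous_measurable2; first exact: sf_img_open.
  by move=> z iz; exact: c1_continuous (dens_c1 iz).
- exact: dens_ge0.
- move=> B mB; rewrite (@sf_volE R M i); last 2 first.
  + apply: measurableI => //; apply: open_borel; exact: sf_dom_open.
  + by move=> x [].
  congr integral; apply/seteqP; split => z.
    move=> [x [Bx ix] <-]; split; first exact: img_chart.
    by rewrite /preimage/= sf_chartK.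
  move=> [iz Bz]; exists (sf_inv i z); last exact: chart_inv.
  by split => //; exact: inv_dom.
Qed.

End Mean.

(** * Green's formula *)

Section Divergence.
Variable R : realType.
Implicit Types (F : R * R -> R) (z : R * R).

Lemma pderivV F z a : differentiable F z -> F z != 0 ->
  pderiv a (fun w => (F w)^-1) z = - (F z ^- 2 * pderiv a F z).
Proof.
move=> dF F0; have [di iE] := is_derive_inv F0.
by rewrite (@pderiv_comp1 _ GRing.inv)// derive1E iE mulNr.
Qed.

Lemma pderiv_sqrt F z a : differentiable F z -> 0 < F z ->
  pderiv a (fun w => Num.sqrt (F w)) z = (2 * Num.sqrt (F z))^-1 * pderiv a F z.
Proof.
move=> dF F0; have [di iE] := is_derive1_sqrt F0.
by rewrite (@pderiv_comp1 _ Num.sqrt)// derive1E iE.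
Qed.

Lemma pderivN F z a : differentiable F z ->
  pderiv a (fun w => - F w) z = - pderiv a F z.
Proof. by move=> dF; apply: deriveN; exact: diff_derivable. Qed.

Variables (g : R * R -> 'M[R]_2) (F : R * R -> R) (z : R * R).
Hypothesis gpd : \forall w \near z, posdef (g w).
Hypothesis gc1 : forall k l, c1 (fun w => g w k l) z.
Hypothesis Fc1 : forall a, c1 (pderiv a F) z.

(** [flux0] and [flux1] are the components of [sqrt (det g) g^{-1} dF], the gradient times the
    Riemannian density; the inverse metric is written as the adjugate over the determinant, which
    leaves a single inverse square root. *)
Definition flux0 w := (Num.sqrt (\det (g w)))^-1 *
  (g w ord_max ord_max * pderiv ord0 F w - g w ord0 ord_max * pderiv ord_max F w).

Definition flux1 w := (Num.sqrt (\det (g w)))^-1 *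
  (g w ord0 ord0 * pderiv ord_max F w - g w ord0 ord_max * pderiv ord0 F w).

Let det_c1 : c1 (fun w => \det (g w)) z.
Proof.
by under eq_fun do rewrite det2; apply: c1B; apply: c1M; exact: gc1.
Qed.

Let det_gt0 : 0 < \det (g z).
Proof. exact/posdef_det/(nbhs_singleton gpd). Qed.

Let sqrt_det_c1 : c1 (fun w => Num.sqrt (\det (g w))) z.
Proof. exact: c1_sqrt. Qed.

Let sqrt_gt0 : 0 < Num.sqrt (\det (g z)).
Proof. by rewrite sqrtr_gt0. Qed.

Let inv_sqrt_c1 : c1 (fun w => (Num.sqrt (\det (g w)))^-1) z.
Proof. by apply: c1V => //; rewrite gt_eqF. Qed.

Lemma flux0_c1 : c1 flux0 z.
Proof.
exact: c1M inv_sqrt_c1 (c1B (c1M (gc1 _ _) (Fc1 _)) (c1M (gc1 _ _) (Fc1 _))).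
Qed.

Lemma flux1_c1 : c1 flux1 z.
Proof.
exact: c1M inv_sqrt_c1 (c1B (c1M (gc1 _ _) (Fc1 _)) (c1M (gc1 _ _) (Fc1 _))).
Qed.

Lemma gip_flux G : gip g G F z * Num.sqrt (\det (g z)) =
  pderiv ord0 G z * flux0 z + pderiv ord_max G z * flux1 z.
Proof.
rewrite gipE; last exact: nbhs_singleton gpd.
rewrite /flux0 /flux1.
have : Num.sqrt (\det (g z)) ^+ 2 = \det (g z) by rewrite sqr_sqrtr// ltW.
have := sqrt_gt0.
move: (pderiv ord0 F z) (pderiv ord_max F z) (pderiv ord0 G z) (pderiv ord_max G z).
move: (g z ord0 ord0) (g z ord0 ord_max) (g z ord_max ord_max) (Num.sqrt _).
move=> p q r s f0 f1 e0 e1 s0 <-; field.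
by rewrite gt_eqF.
Qed.

(** The divergence form of the Laplacian. Both sides are expanded in the partial derivatives of the
    metric and of [F] and compared as rational functions; the two mixed second derivatives of [F]
    are kept apart and match as they stand. *)
Lemma divergence_flux : pderiv ord0 flux0 z + pderiv ord_max flux1 z =
  laplacian g F z * Num.sqrt (\det (g z)).
Proof.
have dg k l := c1_differentiable (gc1 k l).
have dF a := c1_differentiable (Fc1 a).
have ddet := c1_differentiable det_c1.
have ds := c1_differentiable sqrt_det_c1.
have di := c1_differentiable inv_sqrt_c1.
have s_neq0 : Num.sqrt (\det (g z)) != 0 by rewrite gt_eqF.
have gz := nbhs_singleton gpd.
have sym10 a : pderiv a (fun w => g w ord_max ord0) z =
    pderiv a (fun w => g w ord0 ord_max) z.
  by apply: pderiv_eq_near; apply: filterS gpd => w gw; exact: posdef_sym.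
have detE a : pderiv a (fun w => \det (g w)) z =
    g z ord_max ord_max * pderiv a (fun w => g w ord0 ord0) z
    + g z ord0 ord0 * pderiv a (fun w => g w ord_max ord_max) z
    - 2 * g z ord0 ord_max * pderiv a (fun w => g w ord0 ord_max) z.
  under eq_fun do rewrite det2.
  rewrite pderivD; [|exact: differentiable_mul|].
    rewrite pderivN; last exact: differentiable_mul.
    by rewrite !pderivM// sym10 (posdef_sym gz ord_max ord0); ring.
  by apply: differentiableN; exact: differentiable_mul.
have dB (a b c d : 'I_2) (k l : 'I_2) : differentiable
    (fun w => g w a b * pderiv k F w - g w c d * pderiv l F w) z.
  by apply: differentiableB; exact: differentiable_mul.
have pB e (a b c d : 'I_2) (k l : 'I_2) : pderiv e
    (fun w => g w a b * pderiv k F w - g w c d * pderiv l F w) z =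
    g z a b * pderiv e (pderiv k F) z + pderiv k F z * pderiv e (fun w => g w a b) z
    - (g z c d * pderiv e (pderiv l F) z + pderiv l F z * pderiv e (fun w => g w c d) z).
  rewrite pderivD; [|exact: differentiable_mul|].
    by rewrite pderivN ?pderivM//; exact: differentiable_mul.
  by apply: differentiableN; exact: differentiable_mul.
rewrite /flux0 /flux1 !(pderivM _ di) ?pderivV ?pderiv_sqrt// !detE !pB.
have [a00 a01 a10 a11] := invmx2 gz.
rewrite /laplacian /mxtrace !sum2 !mxE !sum2 !mxE !sum2 /christoffel !sum2.
rewrite a00 a01 a10 a11 !sym10.
have dE := det2_sym gz; have p_gt0 := posdef_g00 gz.
have sE : Num.sqrt (\det (g z)) ^+ 2 = \det (g z) by rewrite sqr_sqrtr// ltW.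
move: (Num.sqrt (\det (g z))) s_neq0 sE => s s0 sE.
move: (\det (g z)) sE dE p_gt0 => d <-.
move: (g z ord0 ord0) (g z ord0 ord_max) (g z ord_max ord_max) => p q r.
move: (pderiv ord0 (fun w => g w ord0 ord0) z) (pderiv ord0 (fun w => g w ord0 ord_max) z)
  (pderiv ord0 (fun w => g w ord_max ord_max) z) => p0 q0 r0.
move: (pderiv ord_max (fun w => g w ord0 ord0) z) (pderiv ord_max (fun w => g w ord0 ord_max) z)
  (pderiv ord_max (fun w => g w ord_max ord_max) z) => p1 q1 r1.
move: (pderiv ord0 (pderiv ord0 F) z) (pderiv ord0 (pderiv ord_max F) z)
  (pderiv ord_max (pderiv ord0 F) z) (pderiv ord_max (pderiv ord_max F) z).
move: (pderiv ord0 F z) (pderiv ord_max F z) => f0 f1 f00 f01 f10 f11.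
move=> dE p_gt0.
(* Here [s ^+ 2] is the determinant; eliminating [r] leaves independent variables, over which the
   identity is one of fractions. *)
have -> : r = (s ^+ 2 + q ^+ 2) / p by rewrite dE; field; rewrite gt_eqF.
by field; rewrite s0 gt_eqF.
Qed.

End Divergence.

(** * Bump functions of class C^1 *)

Section Bump.
Variable R : realType.

(** Squaring makes the positive part continuously differentiable; test functions are differentiated
    only once below. *)
Definition pos2 (t : R) : R := Num.max 0 t ^+ 2.

Lemma max0_l (t : R) : t <= 0 -> Num.max 0 t = 0.
Proof. by move=> t0; exact: max_l t0. Qed.

Lemma max0_r (t : R) : 0 <= t -> Num.max 0 t = t.
Proof. by move=> t0; exact: max_r t0. Qed.

Lemma continuous_max0 : continuous (fun t : R => Num.max 0 t).
Proof. by move=> t; apply: continuous_max; [exact: cst_continuous|exact: cvg_id]. Qed.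

Lemma is_derive_pos2 (t : R) : is_derive t 1 pos2 (2 * Num.max 0 t).
Proof.
have [t0|t0|->] := ltgtP t 0.
- rewrite mulr0.
  apply: (@near_eq_is_derive _ _ _ (fun=> 0)).
    by near=> s; rewrite /pos2 (max0_l _) ?expr0n//; apply/ltW; near: s; exact: lt_nbhsl.
- apply: (@near_eq_is_derive _ _ _ (fun s : R => s ^+ 2)).
    by near=> s; rewrite /pos2 (max0_r _)//; apply/ltW; near: s; exact: lt_nbhsr.
  apply: DeriveDef; first exact: exprn_derivable.
  by rewrite exp_derive /= expr1 [_ *: 1]mulr1.
(* At the corner the slope function [Num.max 0 s] is continuous and vanishes at 0. *)
- rewrite ?maxxx mulr0; apply/is_derive1_caratheodory.
  exists (fun s => Num.max 0 s); split; [|exact: continuous_max0|exact: maxxx].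
  move=> s; rewrite /pos2 maxxx expr0n subr0 subr0 expr2.
  by have [s0|s0] := leP 0 s; rewrite ?mul0r.
Unshelve. all: by end_near. Qed.

Lemma pos2_ge0 t : 0 <= pos2 t. Proof. exact: sqr_ge0. Qed.

Lemma pos2_gt0 t : (0 < pos2 t) = (0 < t).
Proof.
rewrite /pos2; by have [t0|t0] := leP t 0; rewrite ?expr0n ?ltxx// exprn_gt0.
Qed.

Lemma c1_pos2 F z : c1 F z -> c1 (fun w => pos2 (F w)) z.
Proof.
apply: (@c1_comp1 _ pos2).
  by near=> y; have [] := is_derive_pos2 y.
rewrite (_ : derive1 pos2 = fun t => 2 * Num.max 0 t).
  by apply: continuous_mul; [exact: cst_continuous|exact: continuous_max0].
by apply/funext => t; rewrite derive1E; have [] := is_derive_pos2 t.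
Unshelve. all: by end_near. Qed.

Definition bump2 (z0 : R * R) (r : R) (z : R * R) : R :=
  pos2 (r ^+ 2 - ((z.1 - z0.1) ^+ 2 + (z.2 - z0.2) ^+ 2)).

Lemma bump2_c1 z0 r z : c1 (bump2 z0 r) z.
Proof.
apply: c1_pos2; apply: c1B; first exact: c1_cst.
have c1sub1 : c1 (fun w : R * R => w.1 - z0.1) z by apply: c1B; [exact: c1_fst|exact: c1_cst].
have c1sub2 : c1 (fun w : R * R => w.2 - z0.2) z by apply: c1B; [exact: c1_snd|exact: c1_cst].
by apply: c1D; under eq_fun do rewrite expr2; exact: c1M.
Qed.

Lemma bump2_supp z0 (r : R) z : 0 < r -> bump2 z0 r z != 0 -> `|z - z0| <= r.
Proof.
move=> r0; rewrite neq_lt ltNge pos2_ge0 /= pos2_gt0 subr_gt0 => H.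
have key (a b : R) : a ^+ 2 + b ^+ 2 < r ^+ 2 -> `|a| <= r.
  by move=> ab; rewrite ler_norml; apply/andP; split; nra.
rewrite [leLHS]prod_normE ge_max; apply/andP; split; first exact: key H.
by rewrite addrC in H; exact: key H.
Qed.

Lemma bump2_gt0 z0 (r : R) : 0 < r -> 0 < bump2 z0 r z0.
Proof. by move=> r0; rewrite pos2_gt0 !subrr expr0n addr0 subr0 exprn_gt0. Qed.

End Bump.

(** * Functions supported in one chart *)

Section Local.
Variables (R : realType) (M : closed_surface R).
Hypothesis volM : sf_vol M [set: borel M] = 1%E.
Implicit Types (u v a b psi : M -> R) (i j : sf_idx M) (x : M) (z w : R * R).
Local Notation mu := (sf_vol M).
Local Notation RR := (measurableTypeR R * measurableTypeR R)%type.

Definition supp_in i z0 (r : R) psi :=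
  forall x, psi x != 0 -> sf_dom i x /\ `|sf_chart i x - z0| <= r.

Definition ball_in i z0 (r : R) := forall z, `|z - z0| <= r -> img i z.

(** The support lies in the image of a closed ball under the inverse chart. This image is compact,
    hence closed in a Hausdorff space, so [psi] vanishes near every point outside the chart:
    extension by zero creates no singularity at the boundary of the domain. *)
Lemma supp_near i z0 r psi x : ball_in i z0 r -> supp_in i z0 r psi ->
  ~ sf_dom i x -> \forall y \near x, psi y = 0.
Proof.
move=> bi si nx.
pose K : set (R * R) := [set z | `|z - z0| <= r].
have cK : compact K.
  have -> : K = (`[z0.1 - r, z0.1 + r]%classic `*` `[z0.2 - r, z0.2 + r]%classic).
    apply/seteqP; split => z; rewrite /K /= prod_normE ge_max /= !ler_distl.
      by move=> /andP[? ?]; split; rewrite /= in_itv.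
    by move=> [/=]; rewrite !in_itv/= => -> ->.
  by apply: compact_setX; exact: segment_compact.
have cI : closed (sf_inv i @` K).
  apply: compact_closed; first exact: sf_hausdorff.
  apply: continuous_compact => //; apply: continuous_in_subspaceT => z.
  by rewrite inE => Kz; apply: sf_inv_cont; exact: bi.
have : nbhs x (~` (sf_inv i @` K)).
  apply: open_nbhs_nbhs; split; first exact: closed_openC.
  by move=> [z Kz zx]; apply: nx; rewrite -zx; apply: inv_dom; exact: bi.
apply: filterS => y nK; apply: contrapT => /eqP y0; apply: nK.
by have [iy yz] := si _ y0; exists (sf_chart i y) => //; exact: sf_chartK.
Qed.

Lemma supp_continuous i z0 r psi : ball_in i z0 r -> supp_in i z0 r psi ->
  (forall x, sf_dom i x -> {for x, continuous psi}) -> continuous psi.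
Proof.
move=> bi si cpsi x; have [ix|nx] := pselect (sf_dom i x); first exact: cpsi.
apply: (@near_continuous_eq _ _ (fun=> 0)); last exact: cst_continuous.
by apply: filterS (supp_near bi si nx).
Qed.

Definition chart_bump i z0 (r : R) x : R :=
  if pselect (sf_dom i x) then bump2 z0 r (sf_chart i x) else 0.

Lemma bump_dom i z0 r x : sf_dom i x -> chart_bump i z0 r x = bump2 z0 r (sf_chart i x).
Proof. by rewrite /chart_bump; case: pselect. Qed.

Lemma bump_ge0 i z0 r x : 0 <= chart_bump i z0 r x.
Proof. by rewrite /chart_bump; case: (pselect _) => ix; [exact: pos2_ge0|exact: lexx]. Qed.

Lemma bump_supp i z0 (r : R) : 0 < r -> supp_in i z0 r (chart_bump i z0 r).
Proof.
move=> r0 x; rewrite /chart_bump; case: (pselect _) => [ix|nx] x0.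
  by split => //; exact: bump2_supp x0.
by rewrite eqxx in x0.
Qed.

Lemma bump_C1M i z0 (r : R) : 0 < r -> ball_in i z0 r -> C1M (chart_bump i z0 r).
Proof.
move=> r0 bi j z jz; have [ix|nx] := pselect (sf_dom i (sf_inv j z)).
  have oz : ov j i z by apply/ovP.
  have [t1 t2] := tau_c1 oz.
  apply: (@c1_near_eq _ (bump2 z0 r \o (fun w => ((tau j i w).1, (tau j i w).2)))).
    apply: filterS (ov_near oz) => w ow.
    rewrite /in_chart /= bump_dom; last by case/ovP: ow.
    by congr bump2; rewrite -surjective_pairing.
  exact: c1_chain (bump2_c1 _ _ _) t1 t2.
apply: (@c1_near_eq _ (fun=> 0)); last exact: c1_cst.
have := supp_near bi (bump_supp (i := i) (z0 := z0) r0) nx.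
move=> H.
have {}H : \forall w \near z, chart_bump i z0 r (sf_inv j w) = 0 by exact: (sf_inv_cont jz H).
by apply: filterS H => w Hw; exact: esym Hw.
Qed.

Lemma supp_mul i z0 r psi u : supp_in i z0 r psi ->
  supp_in i z0 r (fun x => psi x * u x).
Proof. by move=> si x; rewrite mulf_eq0 negb_or => /andP[/si]. Qed.

Lemma gradip_near0 psi b x : (\forall y \near x, psi y = 0) -> gradip psi b x = 0.
Proof.
move=> p0; have ix := sf_atP x; have iz := img_chart ix.
have E : sf_inv (sf_at x) (sf_chart (sf_at x) x) = x by rewrite sf_chartK.
rewrite /gradip gipE; last exact: metric_posdef.
have D k : pderiv k (in_chart (sf_at x) psi) (sf_chart (sf_at x) x) = 0.
  rewrite (@pderiv_eq_near _ _ (fun=> 0)) ?pderiv_cst//.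
  have := sf_inv_cont iz; rewrite /prop_for /continuous_at E => cs.
  have H : \forall w \near sf_chart (sf_at x) x, psi (sf_inv (sf_at x) w) = 0 by exact: (cs _ p0).
  by apply: filterS H => w Hw; exact: Hw.
by rewrite !D !(mulr0, mul0r, addr0, subr0).
Qed.

Section Extension.
Variables (i : sf_idx M) (z0 : R * R) (r : R).
Hypothesis bi : ball_in i z0 r.

Definition ext (F : R * R -> R) : R * R -> R := F \_ (img i).

Lemma ext_img F z : img i z -> ext F z = F z.
Proof. by move=> iz; rewrite /ext patchE mem_set. Qed.

Variable F : R * R -> R.
Hypothesis Fc1 : forall z, img i z -> c1 F z.
Hypothesis F0 : forall z, img i z -> r < `|z - z0| -> F z = 0.

Let ext0 z : r < `|z - z0| -> ext F z = 0.
Proof.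
by move=> rz; rewrite /ext patchE; case: ifPn => //; rewrite inE => iz; exact: F0.
Qed.

Lemma ext_near0 z : r < `|z - z0| -> \forall w \near z, ext F w = 0.
Proof.
move=> rz; have : \forall w \near z, r < `|w - z0|.
  have cn : {for z, continuous (fun w => `|w - z0|)}.
    apply: (@continuous_comp _ _ _ (fun w : R * R => w - z0)).
      by apply: cvgB; [exact: cvg_id|exact: cvg_cst].
    exact: norm_continuous.
  exact: cvgr_gt cn _ rz.
by apply: filterS => w; exact: ext0.
Qed.

Lemma ext_c1 z : c1 (ext F) z.
Proof.
have [zr|rz] := leP `|z - z0| r.
  have iz := bi zr; apply: c1_near_eq (Fc1 iz).
  by apply: filterS (img_near iz) => w iw; rewrite ext_img.
apply: (@c1_near_eq _ (fun=> 0)); last exact: c1_cst.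
by apply: filterS (ext_near0 rz).
Qed.

Lemma ext_vanish : vanish (`|z0| + r + 1) (ext F).
Proof.
move=> z zr; apply: ext0; have := ler_distD 0 z z0.
rewrite subr0 sub0r normrN => H.
have : `|z| <= `|z - z0| + `|z0| by rewrite -{1}(subrK z0 z) ler_normD.
by lra.
Qed.

Lemma pderiv_ext (k : 'I_2) z : img i z -> pderiv k (ext F) z = pderiv k F z.
Proof.
move=> iz; apply: pderiv_eq_near; apply: filterS (img_near iz) => w iw.
by rewrite ext_img.
Qed.

Lemma pderiv_ext0 (k : 'I_2) z : ~ img i z -> pderiv k (ext F) z = 0.
Proof.
move=> niz; have [zr|rz] := leP `|z - z0| r; first by case: niz; exact: bi.
rewrite (@pderiv_eq_near _ _ (fun=> 0)) ?pderiv_cst//.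
by apply: filterS (ext_near0 rz).
Qed.

Lemma integral_pderiv_img (k : 'I_2) :
  (\int[@lebesgue2 R]_(z in (img i : set RR)) (pderiv k F z)%:E = 0)%E.
Proof.
rewrite -[RHS](integral_pderiv ext_c1 ext_vanish k) integral_mkcond.
apply: eq_integral => z _; rewrite patchE; case: ifPn => [|/negP].
  by rewrite inE => iz; rewrite pderiv_ext.
by rewrite inE => niz; rewrite pderiv_ext0.
Qed.

Lemma integrable_pderiv_img (k : 'I_2) :
  (@lebesgue2 R).-integrable (img i : set RR) (EFin \o (pderiv k F : RR -> R)).
Proof.
apply/integrable_mkcond; first by apply: open_measurable2; exact: sf_img_open.
have -> : (EFin \o (pderiv k F : RR -> R)) \_ (img i : set RR) =
    EFin \o (pderiv k (ext F) : RR -> R).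
  apply/funext => z; rewrite patchE /=; case: ifPn => [|/negP].
    by rewrite inE => iz; rewrite pderiv_ext.
  by rewrite inE => niz; rewrite pderiv_ext0.
apply: (@continuous_vanish_integrable _ (`|z0| + r + 1 + 1)).
  by move=> z; exact: (ext_c1 z).2.
exact: vanish_pderiv ext_vanish.
Qed.

End Extension.

End Local.

Lemma continuous_opp (R : realType) (T : topologicalType) (f : T -> R) (x : T) :
  {for x, continuous f} -> {for x, continuous (fun y => - f y)}.
Proof. exact: continuousN. Qed.

Lemma continuous_sub (R : realType) (T : topologicalType) (f g : T -> R) (x : T) :
  {for x, continuous f} -> {for x, continuous g} ->
  {for x, continuous (fun y => f y - g y)}.
Proof. by move=> cf cg; apply: continuous_add cf (continuous_opp cg). Qed.

Section LocalGreen.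
Variables (R : realType) (M : closed_surface R).
Hypothesis volM : sf_vol M [set: borel M] = 1%E.
Implicit Types (u v a b psi : M -> R) (i j : sf_idx M) (x : M) (z w : R * R).
Local Notation mu := (sf_vol M).
Local Notation RR := (measurableTypeR R * measurableTypeR R)%type.

Lemma nbhs_closed_ball z0 (P : set (R * R)) : nbhs z0 P ->
  exists2 r : R, 0 < r & forall z, `|z - z0| <= r -> P z.
Proof.
move=> /nbhs_ballP[e /= e0 eP]; exists (e / 2); first by rewrite divr_gt0.
move=> z ze; apply: eP; have ee : e / 2 < e by lra.
split; rewrite /ball/= distrC; apply: le_lt_trans ee; apply: le_trans ze.
  exact: (pair_norm_ge1 (z - z0)).
exact: (pair_norm_ge2 (z - z0)).
Qed.

Lemma ball_in_exists i z0 : img i z0 -> exists2 r : R, 0 < r & ball_in i z0 r.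
Proof. by move=> iz; exact: nbhs_closed_ball (img_near iz). Qed.

Definition C2M b := forall i z, img i z ->
  c1 (in_chart i b) z /\ forall k, c1 (pderiv k (in_chart i b)) z.

Lemma C2M_C1M b : C2M b -> C1M b.
Proof. by move=> cb i z iz; exact: (cb i z iz).1. Qed.

Lemma smooth_C2M b : smooth_fun b -> C2M b.
Proof.
move=> sb i z iz; have oi := @sf_img_open R M i; split.
  exact: smooth_on_c1 oi (sb i) iz.
by move=> k; exact: Ck_on_c1 oi (Ck_on_pderiv k (sb i 2%N)) iz.
Qed.

(** The Laplacian read in one fixed chart, whereas the chart of [laplace_beltrami] depends on the
    point. *)
Definition lapc i b x := laplacian (sf_metric i) (in_chart i b) (sf_chart i x).

Let pd i z : img i z -> \forall w \near z, posdef (sf_metric i w).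
Proof. by move=> iz; apply: filterS (img_near iz) => w; exact: metric_posdef. Qed.

Local Notation V0 i b := (flux0 (sf_metric i) (in_chart i b)).
Local Notation V1 i b := (flux1 (sf_metric i) (in_chart i b)).

Section B.
Variable b : M -> R.
Hypothesis cb : C2M b.

Let V0c1 i z : img i z -> c1 (V0 i b) z.
Proof.
move=> iz; apply: flux0_c1 (pd iz) _ _; first by move=> k l; exact: metric_c1.
exact: (cb iz).2.
Qed.

Let V1c1 i z : img i z -> c1 (V1 i b) z.
Proof.
move=> iz; apply: flux1_c1 (pd iz) _ _; first by move=> k l; exact: metric_c1.
exact: (cb iz).2.
Qed.

Let divV i z : img i z -> pderiv ord0 (V0 i b) z + pderiv ord_max (V1 i b) z =
  laplacian (sf_metric i) (in_chart i b) z * dens i z.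
Proof.
move=> iz; apply: divergence_flux (pd iz) _ _; first by move=> k l; exact: metric_c1.
exact: (cb iz).2.
Qed.

(** Read off the divergence form: the fluxes are C^1 and the density is positive. *)
Lemma lapc_continuous i x : sf_dom i x -> {for x, continuous (lapc i b)}.
Proof.
move=> ix; apply: (continuous_chart ix
  (F := laplacian (sf_metric i) (in_chart i b)) (fun y _ => erefl _)).
apply: (@near_continuous_eq _ _ (fun z => (pderiv ord0 (V0 i b) z +
  pderiv ord_max (V1 i b) z) * (dens i z)^-1)).
  apply: filterS (img_near (img_chart ix)) => z iz.
  by rewrite divV// mulfK// gt_eqF// dens_gt0.
have iz := img_chart ix.
apply: continuous_mul.
  by apply: continuous_add; [exact: (V0c1 iz).2|exact: (V1c1 iz).2].
apply: continuousV; last exact: c1_continuous (dens_c1 iz).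
by rewrite gt_eqF// dens_gt0.
Qed.

Section Psi.
Variables (i : sf_idx M) (z0 : R * R) (r : R) (psi : M -> R).
Hypothesis bi : ball_in i z0 r.
Hypothesis si : supp_in i z0 r psi.
Hypothesis cpsi : C1M psi.

Lemma psi_lapc_continuous : continuous (fun x => psi x * lapc i b x).
Proof.
apply: (supp_continuous bi); first exact: supp_mul.
by move=> x ix; apply: continuous_mul; [exact: C1M_continuous|exact: lapc_continuous].
Qed.

Let Psi z := in_chart i psi z.

Let Psi0 z : img i z -> r < `|z - z0| -> Psi z = 0.
Proof.
move=> iz rz; apply/eqP; apply: contraT => p0.
by have [_] := si p0; rewrite chart_inv// leNgt rz.
Qed.

(** In the chart the integrand times the density is the divergence of [psi] times the flux of [b], a
    field supported in a closed ball inside the image of the chart. *)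
Lemma local_green : mean (fun x => psi x * lapc i b x + gradip psi b x) = 0.
Proof.
pose w (x : M) : R := psi x * lapc i b x + gradip psi b x; rewrite -/w.
have cw : continuous w.
  move=> x; apply: (@continuous_add R M _ _ x); first exact: psi_lapc_continuous.
  exact: gradip_continuous cpsi (C2M_C1M cb) _.
have P0c1 z : img i z -> c1 (fun y => Psi y * V0 i b y) z.
  by move=> iz; apply: c1M (V0c1 iz); exact: cpsi.
have P1c1 z : img i z -> c1 (fun y => Psi y * V1 i b y) z.
  by move=> iz; apply: c1M (V1c1 iz); exact: cpsi.
have P00 z : img i z -> r < `|z - z0| -> Psi z * V0 i b z = 0.
  by move=> iz rz; rewrite Psi0// mul0r.
have P10 z : img i z -> r < `|z - z0| -> Psi z * V1 i b z = 0.
  by move=> iz rz; rewrite Psi0// mul0r.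
suff : (\int[mu]_x (w x)%:E = 0)%E by rewrite /mean /Rintegral => ->.
have -> : (\int[mu]_x (w x)%:E = \int[mu]_(x in sf_dom i) (w x)%:E)%E.
  rewrite [RHS]integral_mkcond; apply: eq_integral => x _.
  rewrite patchE; case: ifPn => // /negP; rewrite inE => nx.
  have p0 := supp_near bi si nx.
  by rewrite /w gradip_near0// (nbhs_singleton p0) mul0r addr0.
rewrite (chart_integral i (continuous_borel cw)).
have E z : img i z -> w (sf_inv i z) * dens i z =
    pderiv ord0 (fun y => Psi y * V0 i b y) z +
    pderiv ord_max (fun y => Psi y * V1 i b y) z.
  move=> iz; have dP : differentiable Psi z by exact: c1_differentiable (cpsi iz).
  have d0 := c1_differentiable (V0c1 iz); have d1 := c1_differentiable (V1c1 iz).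
  rewrite (pderivM _ dP d0) (pderivM _ dP d1).
  rewrite /w (gradip_chart cpsi (C2M_C1M cb) (inv_dom iz)) /lapc chart_inv//.
  have := divV iz; have := @gip_flux R (sf_metric i) (in_chart i b) z (pd iz) Psi.
  rewrite -/(dens i z) -/Psi => G D.
  rewrite mulrDl -mulrA -D G -[psi (sf_inv i z)]/(Psi z).
  move: (Psi z) (pderiv ord0 Psi z) (pderiv ord_max Psi z) (V0 i b z) (V1 i b z)
    (pderiv ord0 (V0 i b) z) (pderiv ord_max (V1 i b) z).
  by move=> *; ring.
transitivity (\int[@lebesgue2 R]_(z in (img i : set RR))
    ((pderiv ord0 (fun y => Psi y * V0 i b y) z)%:E +
     (pderiv ord_max (fun y => Psi y * V1 i b y) z)%:E))%E.
  by apply: eq_integral => z; rewrite inE => iz; rewrite E.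
have mimg : measurable (img i : set RR) by apply: open_measurable2; exact: sf_img_open.
have i0 := integrable_pderiv_img bi P0c1 P00 ord0.
have i1 := integrable_pderiv_img bi P1c1 P10 ord_max.
have e0 := integral_pderiv_img bi P0c1 P00 ord0.
have e1 := integral_pderiv_img bi P1c1 P10 ord_max.
apply: etrans (integralD mimg i0 i1) _.
apply: etrans (congr2 _ e0 e1) _; exact: (adde0 0%E).
Qed.

End Psi.
End B.

(** The volume charges open sets: in a chart, [u] times the density exceeds half its value at [x] on
    a small square of positive Lebesgue measure. *)
Lemma mean_gt0 u x : continuous u -> (forall y, 0 <= u y) -> 0 < u x -> 0 < mean u.
Proof.
move=> cu u0 ux; have ix := sf_atP x; set i := sf_at x in ix.
have iz := img_chart ix.
pose F z := u (sf_inv i z) * dens i z.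
have E : sf_inv i (sf_chart i x) = x by rewrite sf_chartK.
have cF : {for sf_chart i x, continuous F}.
  apply: continuous_mul; last exact: c1_continuous (dens_c1 iz).
  by apply: continuous_comp; [exact: sf_inv_cont|exact: cu].
have F0 : 0 < F (sf_chart i x) by rewrite /F E mulr_gt0// dens_gt0.
pose c := F (sf_chart i x) / 2.
have c0 : 0 < c by rewrite divr_gt0.
have cFc : c < F (sf_chart i x) by rewrite /c; move: F0; lra.
have nF : nbhs (sf_chart i x) (img i `&` [set t | c < F t]).
  by apply: filterI (img_near iz) _; exact: (@cvgr_gt R _ _ _ F _ cF _ cFc).
have [r r0 rP] := nbhs_closed_ball nF.
pose z0 := sf_chart i x.
pose B : set RR := `[z0.1 - r, z0.1 + r]%classic `*` `[z0.2 - r, z0.2 + r]%classic.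
have BP z : B z -> `|z - z0| <= r.
  move=> [/=]; rewrite !in_itv/= => h1 h2.
  by rewrite [leLHS]prod_normE ge_max !ler_distl h1 h2.
have mB : measurable B by apply: measurableX; exact: measurable_itv.
have lB : (@lebesgue2 R B = ((2 * r) * (2 * r))%:E)%E.
  rewrite /lebesgue2 product_measure1E; [|exact: measurable_itv..].
  have itvE t : lebesgue_measure `[t - r, t + r]%classic = (2 * r)%:E :> \bar R.
    rewrite lebesgue_measure_itv/= lte_fin ifT; last by lra.
    by rewrite -EFinB; congr EFin; ring.
  by rewrite EFinM; congr (_ * _)%E; exact: itvE.
have mi : measurable (sf_dom i : set (borel M)) by apply: open_borel; exact: sf_dom_open.
have mui : measurable_fun [set: borel M] (EFin \o (u : borel M -> R)).
  by apply/measurable_EFinP; exact: continuous_borel.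
have H1 : (\int[mu]_(y in sf_dom i) (u y)%:E <= (mean u)%:E)%E.
  rewrite -integral_mean//; apply: ge0_subset_integral => //.
  by move=> y _; rewrite lee_fin.
have H2 : (c%:E * @lebesgue2 R B <= \int[mu]_(y in sf_dom i) (u y)%:E)%E.
  rewrite (chart_integral i (continuous_borel cu)).
  have mimg : measurable (img i : set RR) by apply: open_measurable2; exact: sf_img_open.
  have mF : measurable_fun (img i : set RR) (fun z : RR => (F z)%:E : \bar R).
    apply/measurable_EFinP; apply: continuous_measurable2; first exact: sf_img_open.
    move=> z jz; apply: continuous_mul; last exact: c1_continuous (dens_c1 jz).
    by apply: continuous_comp; [exact: sf_inv_cont|exact: cu].
  have Fge0 z : img i z -> (0 <= (F z)%:E)%E.
    by move=> _; rewrite lee_fin mulr_ge0// dens_ge0.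
  have Bi : B `<=` img i by move=> z /BP /rP[].
  have H3 := ge0_subset_integral (@lebesgue2 R) mB mimg mF Fge0 Bi.
  apply: (le_trans _ H3).
  rewrite -integral_cst//; apply: ge0_le_integral => //.
  - by move=> z _; rewrite lee_fin ltW.
  - exact: measurable_funS mimg Bi mF.
  - by move=> z /BP /rP[_ /ltW]; rewrite lee_fin.
have := le_trans H2 H1; rewrite lB -EFinM lee_fin; apply: lt_le_trans.
have r2 : 0 < 2 * r by apply: mulr_gt0.
exact: mulr_gt0 c0 (mulr_gt0 r2 r2).
Qed.

(* Tested against the same bump, the weak formulation [local_green] has the same
   value in both charts: the invariance of the Laplacian needs no second
   derivatives of the transition maps. *)
Let lapc_le b i j x : C2M b -> sf_dom i x -> sf_dom j x -> lapc i b x <= lapc j b x.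
Proof.
move=> cb ix jx; rewrite leNgt; apply/negP => ij.
pose z0 := sf_chart i x.
have iz := img_chart ix.
have oz : ov i j z0 by exact: ov_chart.
have E : sf_inv i z0 = x by rewrite /z0 sf_chartK.
have [rj rj0 bj] := ball_in_exists (img_chart jx).
pose D y := lapc i b y - lapc j b y.
have cD y : sf_dom i y -> sf_dom j y -> {for y, continuous D}.
  move=> iy jy; apply: continuous_add; first exact: lapc_continuous.
  by apply: continuousN; exact: lapc_continuous.
have nD : \forall z \near z0, 0 < D (sf_inv i z).
  have cDi : {for z0, continuous (D \o sf_inv i)}.
    apply: continuous_comp; first exact: sf_inv_cont.
    by rewrite E; exact: cD.
  by apply: cvgr_gt cDi _ _; rewrite /= E subr_gt0.
have nj : \forall z \near z0, `|sf_chart j (sf_inv i z) - sf_chart j x| < rj.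
  have ct : {for z0, continuous (fun z => `|sf_chart j (sf_inv i z) - sf_chart j x|)}.
    apply: (@continuous_comp _ _ _ (fun z => sf_chart j (sf_inv i z) - sf_chart j x)).
      apply: cvgB; last exact: cvg_cst.
      apply: (@continuous_comp _ _ _ (sf_inv i) (sf_chart j)); first exact: sf_inv_cont.
      by rewrite E; exact: sf_chart_cont.
    exact: norm_continuous.
  by apply: cvgr_lt ct _ _; rewrite E subrr normr0.
(* The radius keeps the bump within the overlap, within the region where the two Laplacians differ
   with a strict sign, and, seen in chart [j], within a closed ball contained in the image of that
   chart. *)
have [r r0 rP] := nbhs_closed_ball (filterI (ov_near oz) (filterI nD nj)).
have bi : ball_in i z0 r by move=> z /rP[/ovP[]].
pose psi := chart_bump i z0 r.
have si : supp_in i z0 r psi by exact: bump_supp.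
have cpsi : C1M psi by exact: bump_C1M.
have sj : supp_in j (sf_chart j x) rj psi.
  move=> y /si[iy /rP[/ovP[_ jy] [_ /ltW cy]]].
  by rewrite sf_chartK in jy cy.

have Gi := local_green cb bi si cpsi.
have Gj := local_green cb bj sj cpsi.
have cg : continuous (gradip psi b) by exact: gradip_continuous cpsi (C2M_C1M cb).
have ci := psi_lapc_continuous cb bi si cpsi.
have cj := psi_lapc_continuous cb bj sj cpsi.
rewrite meanD// in Gi; rewrite meanD// in Gj.
have : 0 < mean (fun y => psi y * lapc i b y - psi y * lapc j b y).
  apply: (@mean_gt0 _ x).
  - by move=> y; exact: continuous_sub (ci y) (cj y).
  - move=> y; rewrite -mulrBr; have [->|py] := eqVneq (psi y) 0; first by rewrite mul0r.
    apply: mulr_ge0; first exact: bump_ge0.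
    by have [iy /rP[_ [/ltW]]] := si _ py; rewrite /D sf_chartK.
  - rewrite -mulrBr mulr_gt0//; last by rewrite subr_gt0.
    by rewrite /psi bump_dom//; exact: bump2_gt0.
rewrite (meanB volM ci cj) (addIr _ (etrans Gi (esym Gj))) subrr ltxx.
by [].
Qed.

Lemma lapc_ov b i j x : C2M b -> sf_dom i x -> sf_dom j x -> lapc i b x = lapc j b x.
Proof. by move=> cb ix jx; apply/eqP; rewrite eq_le !lapc_le. Qed.

Lemma laplace_beltrami_chart b i x : C2M b -> sf_dom i x ->
  laplace_beltrami b x = lapc i b x.
Proof. by move=> cb ix; exact: lapc_ov (sf_atP x) ix. Qed.

Lemma laplace_beltrami_continuous b : C2M b -> continuous (laplace_beltrami b).
Proof.
move=> cb x; have ix := sf_atP x.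
apply: (@near_continuous_eq _ _ (lapc (sf_at x) b)); last exact: lapc_continuous.
by apply: filterS (dom_near ix) => y iy; rewrite (laplace_beltrami_chart cb iy).
Qed.

End LocalGreen.

Section Green.
Variables (R : realType) (M : closed_surface R).
Hypothesis volM : sf_vol M [set: borel M] = 1%E.
Implicit Types (u v a b psi : M -> R) (i j : sf_idx M) (x : M) (z w : R * R).
Local Notation mu := (sf_vol M).
Local Notation RR := (measurableTypeR R * measurableTypeR R)%type.

Lemma gradip_qf a b x : gradip a b x = qf (sf_metric (sf_at x) (sf_chart (sf_at x) x))
  (drow (in_chart (sf_at x) a) (sf_chart (sf_at x) x))
  (drow (in_chart (sf_at x) b) (sf_chart (sf_at x) x)).
Proof. by []. Qed.

Let pdx x : posdef (sf_metric (sf_at x) (sf_chart (sf_at x) x)).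
Proof. exact: metric_posdef (img_chart (sf_atP x)). Qed.

Let dx a x : C1M a -> differentiable (in_chart (sf_at x) a) (sf_chart (sf_at x) x).
Proof. by move=> ca; exact: c1_differentiable (ca _ _ (img_chart (sf_atP x))). Qed.

Let valx a x : in_chart (sf_at x) a (sf_chart (sf_at x) x) = a x.
Proof. by rewrite /in_chart /= (sf_chartK (sf_atP x)). Qed.

Lemma gradipC a b x : gradip a b x = gradip b a x.
Proof. by rewrite !gradip_qf qfC. Qed.

Lemma gradip_ge0 a x : 0 <= gradip a a x.
Proof. by rewrite gradip_qf qf_ge0. Qed.

Lemma gradipD a b u x : C1M a -> C1M b ->
  gradip (fun y => a y + b y) u x = gradip a u x + gradip b u x.
Proof.
move=> ca cb; rewrite !gradip_qf -qfDl; congr qf.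
by apply/rowP => k; rewrite !mxE; exact: pderivD (dx x ca) (dx x cb).
Qed.

Lemma drowM a b x : C1M a -> C1M b ->
  drow (in_chart (sf_at x) (fun y => a y * b y)) (sf_chart (sf_at x) x) =
  a x *: drow (in_chart (sf_at x) b) (sf_chart (sf_at x) x) +
  b x *: drow (in_chart (sf_at x) a) (sf_chart (sf_at x) x).
Proof.
move=> ca cb; apply/rowP => k; rewrite !mxE -(valx a) -(valx b).
exact: pderivM (dx x ca) (dx x cb).
Qed.

Lemma drow_expR a x : C1M a ->
  drow (in_chart (sf_at x) (fun y => expR (a y))) (sf_chart (sf_at x) x) =
  expR (a x) *: drow (in_chart (sf_at x) a) (sf_chart (sf_at x) x).
Proof.
move=> ca; apply/rowP => k; rewrite !mxE -(valx a).
exact: pderiv_expR (dx x ca).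
Qed.

Lemma gradip_cst (k : R) b x : gradip (fun=> k) b x = 0.
Proof.
rewrite gradip_qf (_ : drow (in_chart _ (fun=> k)) _ = 0 *: 0).
  by rewrite qfZl mul0r.
by apply/rowP => l; rewrite !mxE mul0r; exact: pderiv_cst.
Qed.

Lemma gradipM_le a b x : C1M a -> C1M b ->
  gradip (fun y => a y * b y) (fun y => a y * b y) x <=
  2 * (a x ^+ 2 * gradip b b x) + 2 * (b x ^+ 2 * gradip a a x).
Proof.
move=> ca cb; rewrite gradip_qf drowM// !gradip_qf.
apply: le_trans (qf_young (pdx x) _ _) _.
by rewrite !(qfZl, qfZr) !expr2 !mulrA.
Qed.

Lemma gradip_expR a x : C1M a ->
  gradip (fun y => expR (a y)) (fun y => expR (a y)) x = expR (a x) ^+ 2 * gradip a a x.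
Proof.
move=> ca; rewrite gradip_qf drow_expR// gradip_qf qfZl qfZr.
by rewrite expr2 mulrA.
Qed.

Lemma gradipZ (k : R) a x : C1M a ->
  gradip (fun y => k * a y) (fun y => k * a y) x = k ^+ 2 * gradip a a x.
Proof.
move=> ca; rewrite gradip_qf (drowM x (C1M_cst k) ca) gradip_qf.
rewrite (_ : drow (in_chart _ (fun=> k)) _ = 0); last first.
  by apply/rowP => l; rewrite !mxE; exact: pderiv_cst.
by rewrite scaler0 addr0 qfZl qfZr expr2 mulrA.
Qed.

(** Each bump is positive at its centre, and compactness extracts finitely many with positivity sets
    covering the surface. They are not normalised: [green] divides by their sum, [sobolev_exp] uses
    the sum of their squares. *)
Lemma bump_cover : exists rad : M -> R,
  (forall x, 0 < rad x /\ ball_in (sf_at x) (sf_chart (sf_at x) x) (rad x)) /\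
  exists s : seq M, forall y, exists2 x, x \in s &
    0 < chart_bump (sf_at x) (sf_chart (sf_at x) x) (rad x) y.
Proof.
have /choice[rad radP] : forall x, exists r : R,
    0 < r /\ ball_in (sf_at x) (sf_chart (sf_at x) x) r.
  move=> x; have [r r0 rb] := ball_in_exists (img_chart (sf_atP x)).
  by exists r.
exists rad; split=> //.
pose b x := chart_bump (sf_at x) (sf_chart (sf_at x) x) (rad x).
have cb x : continuous (b x).
  by apply: C1M_continuous; apply: bump_C1M; case: (radP x).
have := @sf_compact R M; rewrite compact_cover => /(_ M setT (fun x => [set y | 0 < b x y])).
case.
- move=> x _; rewrite openE => y by0.
  exact: (@cvgr_gt R _ _ _ (b x) _ (cb x y) _ by0).
- move=> y _; exists y => //=; rewrite /b bump_dom; last exact: sf_atP.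
  by apply: bump2_gt0; case: (radP y).
- move=> D _ DT; exists (finmap.enum_fset D) => y.
  by have [x xD xy] := DT y I; exists x.
Qed.

(** With [S] the positive sum of the bumps, [a] is the sum of the functions [c x * (a / S)]. Each of
    them is supported in one chart, where [local_green] applies, and both sides are additive. *)
Lemma green a b : C1M a -> C2M b ->
  mean (fun x => a x * laplace_beltrami b x) = - mean (gradip a b).
Proof.
move=> ca cb; have cb1 := C2M_C1M cb.
have [rad [radP [s sP]]] := bump_cover.
pose c x := chart_bump (sf_at x) (sf_chart (sf_at x) x) (rad x).
have cc x : C1M (c x) by apply: bump_C1M; case: (radP x).
have c0 x y : 0 <= c x y by exact: bump_ge0.
pose S (y : M) : R := \sum_(x <- s) c x y.
have cS : C1M S by exact: C1M_sum.
have S0 y : S y != 0.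
  rewrite gt_eqF//; have [x xs xy] := sP y.
  by rewrite /S (big_rem x)//=; apply: ltr_wpDr => //; exact: sumr_ge0.
pose d (y : M) : R := a y * (S y)^-1.
have cd : C1M d by apply: C1M_mul ca _; exact: C1M_inv.
have cL := laplace_beltrami_continuous volM cb.
pose G (u : M -> R) (y : M) : R := u y * laplace_beltrami b y + gradip u b y.
have cG u : C1M u -> continuous (G u).
  move=> cu y; have cuy : {for y, continuous u} by exact: C1M_continuous.
  have cgy : {for y, continuous (gradip u b)} by exact: gradip_continuous.
  exact: continuous_add (continuous_mul cuy (cL y)) cgy.
have Gx x : mean (G (fun y => c x y * d y)) = 0.
  have [r0 rb] := radP x.
  have sx : supp_in (sf_at x) (sf_chart (sf_at x) x) (rad x) (fun y => c x y * d y).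
    exact: supp_mul (bump_supp (i := sf_at x) (z0 := sf_chart (sf_at x) x) r0).
  rewrite -[RHS](local_green cb rb sx (C1M_mul (cc x) cd)).
  apply: eq_mean => y; rewrite /G.
  have [->|ny] := eqVneq (c x y * d y) 0; first by rewrite !mul0r.
  by have [iy _] := sx _ ny; rewrite (laplace_beltrami_chart volM cb iy).
have Gs (t : seq M) : mean (G (fun y => (\sum_(x <- t) c x y) * d y)) = 0.
  elim: t => [|x t IH].
    rewrite -[RHS](mean_cst volM 0); apply: eq_mean => y; rewrite /G big_nil.
    under [X in gradip X]eq_fun do rewrite big_nil mul0r.
    by rewrite gradip_cst !mul0r addr0.
  have ct : C1M (fun y => (\sum_(x <- t) c x y) * d y).
    by apply: C1M_mul cd; exact: C1M_sum.
  have cx : C1M (fun y => c x y * d y) by exact: C1M_mul (cc x) cd.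
  have E : (fun y => (\sum_(k <- x :: t) c k y) * d y) =
      (fun y => c x y * d y + (\sum_(k <- t) c k y) * d y).
    by apply/funext => y; rewrite big_cons mulrDl.
  rewrite E; have -> : G (fun y => c x y * d y + (\sum_(k <- t) c k y) * d y) =
      (fun y => G (fun y => c x y * d y) y + G (fun y => (\sum_(k <- t) c k y) * d y) y).
    by apply/funext => y; rewrite /G (gradipD b y cx ct) mulrDl addrACA.
  by apply: etrans (meanD volM (cG _ cx) (cG _ ct)) _; rewrite Gx IH addr0.
have := Gs s; rewrite (_ : (fun y => _ * d y) = a); last first.
  by apply/funext => y; rewrite -/(S y) /d mulrCA mulfV ?mulr1.
have cal : continuous (fun y => a y * laplace_beltrami b y).
  move=> y; have cay : {for y, continuous a} by exact: C1M_continuous.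
  exact: continuous_mul cay (cL y).
by rewrite /G (meanD volM cal (gradip_continuous ca cb1)) => /eqP; rewrite addr_eq0 => /eqP.
Qed.

End Green.

(** * The Sobolev inequality *)

Section Sobolev.
Variables (R : realType) (M : closed_surface R).
Hypothesis volM : sf_vol M [set: borel M] = 1%E.
Implicit Types (u v a b psi : M -> R) (i j : sf_idx M) (x : M) (z w : R * R).
Local Notation mu := (sf_vol M).
Local Notation RR := (measurableTypeR R * measurableTypeR R)%type.

Lemma continuous_sqrt (T : topologicalType) (f : T -> R) (x : T) :
  {for x, continuous f} -> {for x, continuous (fun y => Num.sqrt (f y))}.
Proof. by move=> cf; apply: (continuous_comp cf); exact: sqrt_continuous. Qed.

Definition gradn psi x := Num.sqrt (gradip psi psi x).

Lemma gradn_continuous psi : C1M psi -> continuous (gradn psi).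
Proof.
move=> cp x; apply: (@continuous_sqrt _ (gradip psi psi)); exact: gradip_continuous.
Qed.

Lemma gradn_ge0 psi x : 0 <= gradn psi x. Proof. exact: sqrtr_ge0. Qed.

(** Cauchy-Schwarz for the coordinate vector [k], whose squared length is [g z k k]; the defect
    times the determinant is a perfect square. *)
Lemma pderiv_le_gip (g : R * R -> 'M[R]_2) F z (k : 'I_2) : posdef (g z) ->
  `|pderiv k F z| <= Num.sqrt (g z k k) * Num.sqrt (gip g F F z).
Proof.
move=> gz; have p0 := posdef_g00 gz; have r0 := posdef_g11 gz.
have d0 := posdef_det gz; have dE := det2_sym gz.
have kE : k = ord0 \/ k = ord_max.
  by case: k => -[|[|//]] ?; [left|right]; exact/val_inj.
have H : pderiv k F z ^+ 2 <= g z k k * gip g F F z.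
  rewrite gipE// mulrA ler_pdivlMr//; move: d0 dE.
  case: kE => ->; move: (pderiv ord0 F z) (pderiv ord_max F z) (\det (g z)) p0 r0;
    move: (g z ord0 ord0) (g z ord0 ord_max) (g z ord_max ord_max) => p q r a b d p0 r0 d0 dE.
    rewrite -subr_ge0 [leRHS](_ : _ = (q * a - p * b) ^+ 2) ?sqr_ge0//.
    by rewrite dE; ring.
  rewrite -subr_ge0 [leRHS](_ : _ = (q * b - r * a) ^+ 2) ?sqr_ge0//.
  by rewrite dE; ring.
rewrite -sqrtrM; last by case: kE => ->; exact: ltW.
by rewrite -sqrtr_sqr ler_wsqrtr.
Qed.

Lemma closed_ball_bounded i z0 r F : ball_in i z0 r ->
  (forall z, img i z -> {for z, continuous F}) ->
  exists2 k : R, 0 < k & forall z, `|z - z0| <= r -> F z <= k.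
Proof.
move=> bi cF.
pose K : set (R * R) := `[z0.1 - r, z0.1 + r]%classic `*` `[z0.2 - r, z0.2 + r]%classic.
have KP z : K z <-> `|z - z0| <= r.
  rewrite /K prod_normE ge_max /= !ler_distl; split.
    by move=> [/=]; rewrite !in_itv/= => -> ->.
  by move=> /andP[? ?]; split; rewrite /= in_itv.
have cK : compact K by apply: compact_setX; exact: segment_compact.
have /compact_bounded[k [_ kF]] : compact (F @` K).
  apply: continuous_compact => //; apply: continuous_in_subspaceT => z.
  by rewrite inE => /KP zr; apply: cF; exact: bi.
exists (`|k| + 1); first by rewrite ltr_wpDl.
move=> z /KP Kz; apply: le_trans (ler_norm _) _; apply: (kF (`|k| + 1)).
  by rewrite (le_lt_trans (ler_norm k))// ltrDl.
by exists z.
Qed.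

(** [gagliardo] for the coordinate expression of [psi]. On the closed ball, [K0] bounds the density,
    and [K1], [K2] compare the partial derivatives with the length of the gradient times the
    density. *)
Lemma local_sobolev i z0 r : ball_in i z0 r -> exists2 C : R, 0 < C &
  forall psi, C1M psi -> supp_in i z0 r psi ->
  mean (fun x => psi x ^+ 2) <= C * mean (gradn psi) ^+ 2.
Proof.
move=> bi; have [K0 K0_gt0 K0P] := closed_ball_bounded bi
  (fun z iz => c1_continuous (dens_c1 iz)).
have cF k z : img i z -> {for z, continuous
    (fun w => Num.sqrt (sf_metric i w k k) * (dens i w)^-1)}.
  move=> iz; apply: continuous_mul.
    by apply: continuous_sqrt; exact: c1_continuous (metric_c1 k k iz).
  apply: continuousV; last exact: c1_continuous (dens_c1 iz).
  by rewrite gt_eqF// dens_gt0.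
have [K1 K1_gt0 K1P] := closed_ball_bounded bi (cF ord0).
have [K2 K2_gt0 K2P] := closed_ball_bounded bi (cF ord_max).
exists (K0 * (K1 * K2)); first exact: mulr_gt0 K0_gt0 (mulr_gt0 K1_gt0 K2_gt0).
move=> psi cpsi si.
have cpsi0 := C1M_continuous cpsi.
pose Psi : R * R -> R := in_chart i psi.
have Pc1 z : img i z -> c1 Psi z by exact: cpsi.
have P0 z : img i z -> r < `|z - z0| -> Psi z = 0.
  move=> iz rz; apply/eqP; apply: contraT => p0.
  by have [_] := si _ p0; rewrite chart_inv// leNgt rz.
have mi : measurable (sf_dom i : set (borel M)) by apply: open_borel; exact: sf_dom_open.
have mimg : measurable (img i : set RR) by apply: open_measurable2; exact: sf_img_open.
have cgn : continuous (gradn psi) by exact: gradn_continuous.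
have gb (k : 'I_2) (Kk : R) : 0 < Kk ->
    (forall z, `|z - z0| <= r -> Num.sqrt (sf_metric i z k k) * (dens i z)^-1 <= Kk) ->
    (\int[@lebesgue2 R]_z `|pderiv k (ext i Psi) z|%:E <= (Kk * mean (gradn psi))%:E)%E.
  move=> Kk0 KkP.
  have H1 : (\int[mu]_(x in sf_dom i) (gradn psi x)%:E <= (mean (gradn psi))%:E)%E.
    rewrite -(integral_mean volM cgn); apply: ge0_subset_integral => //.
      by apply/measurable_EFinP; exact: continuous_borel.
    by move=> y _; rewrite lee_fin gradn_ge0.
  have H2 : (\int[@lebesgue2 R]_z `|pderiv k (ext i Psi) z|%:E <=
      Kk%:E * \int[mu]_(x in sf_dom i) (gradn psi x)%:E)%E.
    rewrite (chart_integral i (continuous_borel cgn)).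
    have mG : measurable_fun (img i : set RR)
        (fun z : RR => (gradn psi (sf_inv i z) * dens i z)%:E : \bar R).
      apply/measurable_EFinP; apply: continuous_measurable2; first exact: sf_img_open.
      move=> z iz; apply: continuous_mul; last exact: c1_continuous (dens_c1 iz).
      by apply: continuous_comp; [exact: sf_inv_cont|exact: cgn].
    have G0 z : img i z -> (0 <= (gradn psi (sf_inv i z) * dens i z)%:E)%E.
      by move=> _; rewrite lee_fin mulr_ge0 ?gradn_ge0 ?dens_ge0.
    have KkE : (0 <= Kk%:E)%E by rewrite lee_fin ltW.
    rewrite -(@ge0_integralZl _ _ _ (@lebesgue2 R) _ mimg _ mG Kk%:E G0 KkE).
    have mD : measurable_fun setT (fun z : RR => `|pderiv k (ext i Psi) z|%:E : \bar R).
      apply/measurable_EFinP; apply: measurableT_comp => //.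
      apply: continuous_measurable2; first exact: openT.
      by move=> z _; exact: (ext_c1 bi Pc1 P0 z).2.
    have -> : (\int[@lebesgue2 R]_z `|pderiv k (ext i Psi) z|%:E =
        \int[@lebesgue2 R]_(z in (img i : set RR)) `|pderiv k (ext i Psi) z|%:E)%E.
      rewrite [RHS]integral_mkcond; apply: eq_integral => z _.
      rewrite patchE; case: ifPn => // /negP; rewrite inE => niz.
      by rewrite (pderiv_ext0 bi P0)// normr0.
    apply: ge0_le_integral.
    - exact: mimg.
    - by move=> z _; rewrite lee_fin normr_ge0.
    - exact: measurable_funTS mD.
    - exact: measurable_funeM mG.
    move=> z iz; rewrite -EFinM lee_fin (pderiv_ext Psi k iz).
    have [zr|rz] := leP `|z - z0| r; last first.
      by rewrite -(pderiv_ext Psi k iz) (@pderiv_eq_near _ _ (fun=> 0)) ?pderiv_cst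
        ?normr0 ?mulr_ge0 ?gradn_ge0 ?dens_ge0 ?(ltW Kk0)//; apply: filterS (ext_near0 P0 rz).
    apply: le_trans (pderiv_le_gip Psi k (metric_posdef iz)) _.
    have -> : gradn psi (sf_inv i z) = Num.sqrt (gip (sf_metric i) Psi Psi z).
      by rewrite /gradn (gradip_chart cpsi cpsi (inv_dom iz)) chart_inv.
    rewrite mulrCA mulrC ler_wpM2l ?sqrtr_ge0//.
    by rewrite -ler_pdivrMr ?dens_gt0//; exact: KkP.
  apply: le_trans H2 _; rewrite EFinM lee_wpmul2l// lee_fin ltW//.
have H0 : ((mean (fun x => psi x ^+ 2))%:E <=
    K0%:E * \int[@lebesgue2 R]_z ((ext i Psi z) ^+ 2)%:E)%E.
  have cp2 : continuous (fun x => psi x ^+ 2).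
    by move=> x; under eq_fun do rewrite expr2; exact: continuous_mul (cpsi0 x) (cpsi0 x).
  rewrite -(integral_mean volM cp2).
  have -> : (\int[mu]_x (psi x ^+ 2)%:E = \int[mu]_(x in sf_dom i) (psi x ^+ 2)%:E)%E.
    rewrite [RHS]integral_mkcond; apply: eq_integral => x _.
    rewrite patchE; case: ifPn => // /negP; rewrite inE => nx.
    by rewrite (nbhs_singleton (supp_near bi si nx)) expr0n.
  rewrite (chart_integral i (continuous_borel cp2)).
  have me : measurable_fun setT (fun z : RR => ((ext i Psi z) ^+ 2)%:E : \bar R).
    apply/measurable_EFinP; apply: measurable_funX.
    apply: continuous_measurable2; first exact: openT.
    by move=> z _; exact: c1_continuous (ext_c1 bi Pc1 P0 z).
  have e0 (z : RR) : (0 <= ((ext i Psi z) ^+ 2)%:E)%E by rewrite lee_fin sqr_ge0.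
  have -> : (\int[@lebesgue2 R]_z ((ext i Psi z) ^+ 2)%:E =
      \int[@lebesgue2 R]_(z in (img i : set RR)) ((ext i Psi z) ^+ 2)%:E)%E.
    rewrite [RHS]integral_mkcond; apply: eq_integral => z _.
    rewrite patchE; case: ifPn => //= niz.
    by rewrite /ext patchE (negbTE niz) expr0n.
  have K0E : (0 <= K0%:E)%E by rewrite lee_fin ltW.
  rewrite -(@ge0_integralZl _ _ _ (@lebesgue2 R) _ mimg _ (measurable_funTS me) K0%:E
    (fun z _ => e0 z) K0E).
  apply: ge0_le_integral.
  - exact: mimg.
  - by move=> z _; rewrite lee_fin mulr_ge0 ?sqr_ge0 ?dens_ge0.
  - apply/measurable_EFinP; apply: continuous_measurable2; first exact: sf_img_open.
    move=> z iz; apply: continuous_mul; last exact: c1_continuous (dens_c1 iz).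
    apply: (@continuous_comp _ _ _ (sf_inv i) (fun x => psi x ^+ 2)); last exact: cp2.
    exact: sf_inv_cont.
  - exact: measurable_funeM (measurable_funTS me).
  move=> z iz; rewrite -EFinM lee_fin (ext_img _ iz).
  rewrite -[psi (sf_inv i z)]/(Psi z).
  have [zr|rz] := leP `|z - z0| r; last by rewrite P0// expr0n mulr0 mul0r.
  by rewrite mulrC ler_wpM2r ?sqr_ge0//; exact: K0P.
have G := gagliardo (ext_c1 bi Pc1 P0) (ext_vanish P0).
rewrite -lee_fin; apply: (le_trans H0).
have -> : K0 * (K1 * K2) * mean (gradn psi) ^+ 2 =
  K0 * ((K1 * mean (gradn psi)) * (K2 * mean (gradn psi))) by ring.
rewrite EFinM lee_wpmul2l//; first by rewrite lee_fin ltW.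
apply: (le_trans G); rewrite EFinM; apply: lee_pmul.
- by apply: integral_ge0 => z _; rewrite lee_fin normr_ge0.
- by apply: integral_ge0 => z _; rewrite lee_fin normr_ge0.
- exact: gb.
- exact: gb.
Qed.

End Sobolev.

Section SobolevExp.
Variables (R : realType) (M : closed_surface R).
Hypothesis volM : sf_vol M [set: borel M] = 1%E.
Implicit Types (u v a b w : M -> R) (x : M).

Lemma cont_mul u v : continuous u -> continuous v -> continuous (fun x => u x * v x).
Proof. by move=> cu cv x; exact: continuous_mul (cu x) (cv x). Qed.

Lemma cont_add u v : continuous u -> continuous v -> continuous (fun x => u x + v x).
Proof. by move=> cu cv x; exact: continuous_add (cu x) (cv x). Qed.

Lemma cont_sub u v : continuous u -> continuous v -> continuous (fun x => u x - v x).
Proof. by move=> cu cv x; exact: continuous_sub (cu x) (cv x). Qed.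

Lemma cont_scale (k : R) u : continuous u -> continuous (fun x => k * u x).
Proof. by move=> cu x; exact: continuous_mul (@cst_continuous _ _ k x) (cu x). Qed.

Lemma cont_sqr u : continuous u -> continuous (fun x => u x ^+ 2).
Proof. by move=> cu; under eq_fun do rewrite expr2; exact: cont_mul. Qed.

Lemma cont_expR u : continuous u -> continuous (fun x => expR (u x)).
Proof. by move=> cu x; apply: (continuous_comp (cu x)); exact: continuous_expR. Qed.

Lemma mean_cauchy_schwarz u v : continuous u -> continuous v ->
  0 < mean (fun x => u x ^+ 2) ->
  mean (fun x => u x * v x) ^+ 2 <= mean (fun x => u x ^+ 2) * mean (fun x => v x ^+ 2).
Proof.
move=> cu cv; set U := mean (fun x => u x ^+ 2); set V := mean (fun x => v x ^+ 2).
(* The minimiser in [t] of the mean of [(t u - v)^2]. *)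
set X := mean _ => U0; pose t := X / U.
have H : 0 <= t ^+ 2 * U - 2 * t * X + V.
  have cu2 := cont_sqr cu; have cv2 := cont_sqr cv; have cuv := cont_mul cu cv.
  have c1 : continuous (fun x => t ^+ 2 * u x ^+ 2) by exact: cont_scale.
  have c2 : continuous (fun x => 2 * t * (u x * v x)) by exact: cont_scale.
  rewrite -[t ^+ 2 * U](meanZ volM (t ^+ 2) cu2) -[2 * t * X](meanZ volM (2 * t) cuv).
  rewrite -(meanB volM c1 c2) -(meanD volM (cont_sub c1 c2) cv2).
  apply: mean_ge0 => x; rewrite [leRHS](_ : _ = (t * u x - v x) ^+ 2) ?sqr_ge0//; ring.
have : 0 <= U * (t ^+ 2 * U - 2 * t * X + V) by exact: mulr_ge0 (ltW U0) H.
have -> : U * (t ^+ 2 * U - 2 * t * X + V) = U * V - X ^+ 2.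
  by rewrite /t; field; rewrite gt_eqF.
by rewrite subr_ge0.
Qed.

(** [local_sobolev] is applied to each bump times [e^u]. As the gradient of [e^u] is [e^u] times
    that of [u], Cauchy-Schwarz bounds the squared mean of its length by the mean of [e^{2u}] times
    the Dirichlet integral. *)
Lemma sobolev_exp : exists2 C : R, 0 < C & forall u, C1M u ->
  mean (fun x => expR (u x) ^+ 2) <= C * (mean (fun x => expR (u x)) ^+ 2 +
    mean (fun x => expR (u x) ^+ 2) * mean (gradip u u)).
Proof.
have [rad [radP [s sP]]] := bump_cover M.
pose b x : M -> R := chart_bump (sf_at x) (sf_chart (sf_at x) x) (rad x).
have cb x : C1M (b x) by apply: bump_C1M; case: (radP x).
have b0 x y : 0 <= b x y by exact: bump_ge0.
pose Q u := mean (fun x => expR (u x)) ^+ 2 +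
    mean (fun x => expR (u x) ^+ 2) * mean (gradip u u).
have Q0 u : 0 <= Q u.
  apply: addr_ge0; first exact: sqr_ge0.
  by apply: mulr_ge0; apply: mean_ge0 => x; [exact: sqr_ge0|exact: gradip_ge0].
have loc x : exists2 C : R, 0 < C & forall u, C1M u ->
    mean (fun y => (b x y * expR (u y)) ^+ 2) <= C * Q u.
  have [r0 rb] := radP x; have [C C0 CP] := local_sobolev volM rb.
  have [k1 [k10 k1P]] := continuous_bounded (C1M_continuous (cb x)).
  have [k2 [k20 k2P]] := continuous_bounded (gradip_continuous (cb x) (cb x)).
  (* Here [k1] bounds the bump and [k2] its squared gradient, and the factors 2 are those of
     [gradipM_le]. The further factor 2 in the constant below comes from
     [(p + q)^2 <= 2 p^2 + 2 q^2]. *)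
  pose B := 2 * k1 ^+ 2 + 2 * k2.
  have B0 : 0 < B by rewrite /B addr_gt0// mulr_gt0// exprn_gt0.
  exists (C * (B * 2)); first by rewrite !mulr_gt0.
  move=> u cu; pose w y := expR (u y).
  have cw : C1M w by exact: C1M_expR.
  have cbw : C1M (fun y => b x y * w y) by exact: C1M_mul (cb x) cw.
  have sbw : supp_in (sf_at x) (sf_chart (sf_at x) x) (rad x) (fun y => b x y * w y).
    exact: supp_mul (bump_supp (i := sf_at x) (z0 := sf_chart (sf_at x) x) r0).
  apply: le_trans (CP _ cbw sbw) _; rewrite -mulrA ler_wpM2l ?(ltW C0)//.
  have cw' : continuous w by exact: C1M_continuous.
  have cn : continuous (gradn u) by exact: gradn_continuous.
  have cwn := cont_mul cw' cn.
  have pw y : gradn (fun y => b x y * w y) y <= Num.sqrt B * (w y + w y * gradn u y).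
    have wy : 0 < w y by exact: expR_gt0.
    have ny : 0 <= gradn u y by exact: gradn_ge0.
    have E : 0 <= w y + w y * gradn u y by exact: addr_ge0 (ltW wy) (mulr_ge0 (ltW wy) ny).
    rewrite -[X in _ <= _ * X](ger0_norm E) -sqrtr_sqr -sqrtrM ?(ltW B0)//.
    rewrite [leLHS]/gradn; apply: ler_wsqrtr; apply: le_trans (gradipM_le y (cb x) cw) _.
    rewrite (gradip_expR y cu) -/(w y).
    have nE : gradn u y ^+ 2 = gradip u u y by rewrite sqr_sqrtr// gradip_ge0.
    rewrite -nE /B.
    have h1 : b x y ^+ 2 <= k1 ^+ 2.
      have bk : b x y <= k1 by apply: le_trans (ler_norm _) (k1P y).
      by have := b0 x y; nra.
    have h2 : gradip (b x) (b x) y <= k2 by apply: le_trans (ler_norm _) (k2P y).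
    have h3 : 0 <= b x y ^+ 2 by exact: sqr_ge0.
    have h4 := gradip_ge0 (b x) y.
    move: (b x y ^+ 2) (gradip (b x) (b x) y) (gradn u y) (w y) wy ny h1 h2 h3 h4 k20 {nE E}.
    move=> t g n e e0 n0 h1 h2 h3 h4 k20.
    have e2 : 0 < e ^+ 2 by rewrite exprn_gt0.
    have -> : 2 * (t * (e ^+ 2 * n ^+ 2)) + 2 * (e ^+ 2 * g) =
        e ^+ 2 * (2 * t * n ^+ 2 + 2 * g) by ring.
    have -> : (2 * k1 ^+ 2 + 2 * k2) * (e + e * n) ^+ 2 =
      e ^+ 2 * ((2 * k1 ^+ 2 + 2 * k2) * (1 + n) ^+ 2) by ring.
    rewrite ler_pM2l//.
    have n2 : 0 <= n ^+ 2 by exact: sqr_ge0.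
    have m1 : 0 <= (k1 ^+ 2 - t) * n ^+ 2 by rewrite mulr_ge0// subr_ge0.
    have m2 : 0 <= k1 ^+ 2 * n by rewrite mulr_ge0// sqr_ge0.
    have m3 : 0 <= k2 * n by rewrite mulr_ge0// ltW.
    have m4 : 0 <= k2 * n ^+ 2 by rewrite mulr_ge0// ltW.
    have m5 : 0 <= k1 ^+ 2 by exact: sqr_ge0.
    have -> : (2 * k1 ^+ 2 + 2 * k2) * (1 + n) ^+ 2 = 2 * k1 ^+ 2 + 4 * (k1 ^+ 2 * n) +
       2 * (k1 ^+ 2 * n ^+ 2) + 2 * k2 + 4 * (k2 * n) + 2 * (k2 * n ^+ 2) by ring.
    have -> : 2 * t * n ^+ 2 = 2 * (k1 ^+ 2 * n ^+ 2) - 2 * ((k1 ^+ 2 - t) * n ^+ 2) by ring.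
    by lra.
  have W0 : 0 < mean (fun y => w y ^+ 2).
    apply: (mean_gt0 volM (x := x)); first exact: cont_sqr.
      by move=> y; exact: sqr_ge0.
    by rewrite exprn_gt0// expR_gt0.
  have m0 : mean (gradn (fun y => b x y * w y)) <=
      Num.sqrt B * (mean w + mean (fun y => w y * gradn u y)).
    rewrite -(meanD volM cw' cwn) -(meanZ volM _ (cont_add cw' cwn)).
    apply: (mean_le volM _ _ pw); first exact: gradn_continuous.
    exact: cont_scale (cont_add cw' cwn).
  have cs := mean_cauchy_schwarz cw' cn W0.
  have nE : mean (fun y => gradn u y ^+ 2) = mean (gradip u u).
    by apply: eq_mean => y; rewrite sqr_sqrtr// gradip_ge0.
  rewrite nE in cs.
  have g0 : 0 <= mean (gradn (fun y => b x y * w y)).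
    by apply: mean_ge0 => y; exact: gradn_ge0.
  have H2 : mean (gradn (fun y => b x y * w y)) ^+ 2 <=
      (Num.sqrt B * (mean w + mean (fun y => w y * gradn u y))) ^+ 2.
    by rewrite ler_pXn2r// nnegrE (le_trans g0).
  apply: (le_trans H2); rewrite exprMn sqr_sqrtr ?(ltW B0)// -mulrA.
  rewrite ler_wpM2l ?(ltW B0)// /Q -/w.
  move: cs; move: (mean w) (mean (fun y => w y * gradn u y))
    (mean (fun y => w y ^+ 2) * mean (gradip u u)) => p q r qr.
  by have := sqr_ge0 (p - q); nra.
(* A positive continuous function on a compact space, hence bounded below by some [t > 0]: the sum
   of the localised bounds controls [t] times the mean of [e^{2u}]. *)
pose T y := \sum_(x <- s) b x y ^+ 2.
have cT : continuous T.
  rewrite /T; elim: (s) => [|x t IH].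
    by under eq_fun do rewrite big_nil; exact: cst_continuous.
  under eq_fun do rewrite big_cons; apply: cont_add IH; apply: cont_sqr.
  exact: C1M_continuous.
have T0 y : 0 < T y.
  have [x xs xy] := sP y.
  rewrite /T (big_rem x)//=; apply: ltr_wpDr; last exact: exprn_gt0.
  by apply: sumr_ge0 => *; exact: sqr_ge0.
have [t t0 tP] : exists2 t : R, 0 < t & forall y, t <= T y.
  have cTV : continuous (fun y => (T y)^-1).
    by move=> y; apply: continuousV; [rewrite gt_eqF|exact: cT].
  have [k [k0 kP]] := continuous_bounded cTV.
  exists k^-1; first by rewrite invr_gt0.
  move=> y; rewrite -[leRHS]invrK lef_pV2 ?posrE ?invr_gt0//.
  exact: le_trans (ler_norm _) (kP y).
have [C C0 CP] : exists2 C : R, 0 < C & forall u, C1M u ->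
    \sum_(x <- s) mean (fun y => (b x y * expR (u y)) ^+ 2) <= C * Q u.
  elim: (s) => [|x l [C C0 CP]].
    by exists 1 => // u cu; rewrite big_nil mul1r.
  have [C1 C10 C1P] := loc x; exists (C1 + C); first exact: addr_gt0.
  by move=> u cu; rewrite big_cons mulrDl lerD ?C1P ?CP.
exists (t^-1 * C); first by rewrite mulr_gt0// invr_gt0.
move=> u cu; rewrite -/(Q u) -mulrA ler_pdivlMl//.
apply: le_trans (CP u cu).
have cw : continuous (fun y => expR (u y)) by exact/cont_expR/C1M_continuous.
have cbw x : continuous (fun y => (b x y * expR (u y)) ^+ 2).
  by apply: cont_sqr; apply: cont_mul cw; exact: C1M_continuous.
rewrite -(mean_sum volM _ cbw) -(meanZ volM _ (cont_sqr cw)).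
apply: (mean_le volM).
- exact: cont_scale (cont_sqr cw).
- elim: (s) => [|x l IH]; first by under eq_fun do rewrite big_nil; exact: cst_continuous.
  by under eq_fun do rewrite big_cons; apply: cont_add IH; exact: cbw.
- move=> y; under eq_bigr do rewrite exprMn; rewrite -mulr_suml.
  by rewrite ler_wpM2r ?sqr_ge0//; exact: tP.
Qed.

End SobolevExp.

(** * Regularity of the flow *)

Section Slice.
Variable R : realType.
Implicit Types (G : R * (R * R) -> R) (t : R) (z v : R * R).

Lemma derive_slice_quotient G t z v :
  (fun h : R => h^-1 *: (((fun y => G (t, y)) \o shift z) (h *: v) - G (t, z))) =
  (fun h : R => h^-1 *: ((G \o shift (t, z)) (h *: ((0, v) : R * (R * R))) - G (t, z))).
Proof.
apply/funext => h /=; congr (_ *: (G _ - _)).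
by congr (_, _) => /=; rewrite [_ *: 0]mulr0 add0r.
Qed.

Lemma derive_slice G t v :
  (fun z => 'D_v (fun y => G (t, y)) z) = (fun z => 'D_((0, v) : R * (R * R)) G (t, z)).
Proof. by apply/funext => z; rewrite /derive derive_slice_quotient. Qed.

Lemma continuous_slice G t z : {for (t, z), continuous G} ->
  {for z, continuous (fun y => G (t, y))}.
Proof.
move=> cG; apply: (@continuous_comp _ _ _ (fun y : R * R => (t, y)) G) => //.
exact: (cvg_pair (f := cst t) (g := id) (cvg_cst t) cvg_id).
Qed.

(** The derivative of a slice in the direction [v] is the joint derivative in the direction
    [(0, v)], so the induction stays within jointly regular functions. *)
Lemma Ck_on_slice n (U : set (R * (R * R))) G t : Ck_on n U G ->
  Ck_on n [set z | U (t, z)] (fun z => G (t, z)).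
Proof.
elim: n G => [|n IH] G [cG dG]; split=> //.
- by move=> z Uz; apply: (@continuous_slice G t z); exact: (cG (t, z) Uz).
- by move=> z Uz; apply: (@continuous_slice G t z); exact: (cG (t, z) Uz).
move=> v; have [dv cv] := dG (0, v); split=> [z Uz|].
  by rewrite /derivable derive_slice_quotient; exact: dv.
by rewrite derive_slice; exact: (IH _ cv).
Qed.

End Slice.

Lemma eq_continuous_at (R : realType) (T : topologicalType) (f g : T -> R) (x : T) :
  (forall y, f y = g y) -> {for x, continuous f} -> {for x, continuous g}.
Proof. by move=> /funext ->. Qed.

Section JointLaplacian.
Variables (R : realType) (M : closed_surface R).
Hypothesis volM : sf_vol M [set: borel M] = 1%E.
Implicit Types (i : sf_idx M) (x : M) (z : R * R).
Variable u : R -> M -> R.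
Hypothesis su : forall i : sf_idx M, smooth_on
  [set z : R * (R * R) | 0 < z.1 /\ (sf_chart i @` sf_dom i) z.2]
  (fun z : R * (R * R) => u z.1 (sf_inv i z.2)).

Let U i : set (R * (R * R)) := [set z | 0 < z.1 /\ img i z.2].
Let G i (z : R * (R * R)) := u z.1 (sf_inv i z.2).

Lemma flow_C2M t : 0 < t -> C2M (u t).
Proof.
move=> t0 i z iz.
have H n : Ck_on n (img i) (in_chart i (u t)).
  have := Ck_on_slice t (su i n).
  by rewrite (_ : [set z | _] = img i)//; apply/seteqP; split=> [y [] //|y iy]; split.
have oi : open (img i) := @sf_img_open R M i.
split; first exact: Ck_on_c1 (H 1%N) iz.
by move=> k; exact: Ck_on_c1 (Ck_on_pderiv k (H 2%N)) iz.
Qed.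

Let pd1 i k t : pderiv k (in_chart i (u t)) =
  (fun z => 'D_((0, basis_vec R k) : R * (R * R)) (G i) (t, z)).
Proof. exact: (derive_slice (G i) t (basis_vec R k)). Qed.

Let pd2 i k l t : pderiv k (pderiv l (in_chart i (u t))) =
  (fun z => 'D_((0, basis_vec R k) : R * (R * R))
     (fun y => 'D_((0, basis_vec R l) : R * (R * R)) (G i) y) (t, z)).
Proof.
by rewrite pd1; exact: (derive_slice (fun y => 'D_((0, basis_vec R l) : R * (R * R)) (G i) y)).
Qed.

Let cG1 i k (y : R * (R * R)) : U i y ->
  {for y, continuous (fun y => pderiv k (in_chart i (u y.1)) y.2)}.
Proof.
move=> Uy; have [_ /(_ (0, basis_vec R k))[_ [cD _]]] := su i 1%N.
rewrite (_ : (fun y => _) = (fun y => 'D_((0, basis_vec R k) : R * (R * R)) (G i) y)).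
  exact: cD.
by apply/funext => -[t z]; rewrite pd1.
Qed.

Let cG2 i k l (y : R * (R * R)) : U i y ->
  {for y, continuous (fun y => pderiv k (pderiv l (in_chart i (u y.1))) y.2)}.
Proof.
move=> Uy; have [_ /(_ (0, basis_vec R l))[_ [_ /(_ (0, basis_vec R k))[_ [cD _]]]]] := su i 2%N.
rewrite (_ : (fun y => _) = (fun y => 'D_((0, basis_vec R k) : R * (R * R))
    (fun y => 'D_((0, basis_vec R l) : R * (R * R)) (G i) y) y)).
  exact: cD.
by apply/funext => -[t z]; rewrite pd2.
Qed.

Let cst2 i F (y : R * (R * R)) : U i y -> {for y.2, continuous F} ->
  {for y, continuous (fun y => F y.2 : R)}.
Proof.
by move=> Uy cF; apply: (@continuous_comp _ _ _ snd F); [exact: cvg_snd|exact: cF].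
Qed.

Let ord2 (k : 'I_2) : k = ord0 \/ k = ord_max.
Proof. by case: k => -[|[|//]] ?; [left|right]; exact/val_inj. Qed.

Lemma invmx_continuous i z k l : img i z ->
  {for z, continuous (fun y => invmx (sf_metric i y) k l)}.
Proof.
move=> iz.
have cm a b := c1_continuous (metric_c1 a b iz).
have cd : {for z, continuous (fun y => (\det (sf_metric i y))^-1)}.
  apply: continuousV; last exact: c1_continuous (det_metric_c1 iz).
  by rewrite gt_eqF// det_metric_gt0.
have inv y : img i y -> _ := fun iy => invmx2 (metric_posdef iy).
have cN := continuous_mul (continuous_opp (cm ord0 ord_max)) cd.
case: (ord2 k) => ->; case: (ord2 l) => ->.
- apply: near_continuous_eq (continuous_mul (cm ord_max ord_max) cd).
  by apply: filterS (img_near iz) => y /inv[-> _ _ _].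
- apply: near_continuous_eq cN.
  by apply: filterS (img_near iz) => y /inv[_ -> _ _].
- apply: near_continuous_eq cN.
  by apply: filterS (img_near iz) => y /inv[_ _ -> _].
- apply: near_continuous_eq (continuous_mul (cm ord0 ord0) cd).
  by apply: filterS (img_near iz) => y /inv[_ _ _ ->].
Qed.

Lemma christoffel_continuous i z c a b : img i z ->
  {for z, continuous (christoffel (sf_metric i) c a b)}.
Proof.
move=> iz.
have cp k l m : {for z, continuous (pderiv k (fun w => sf_metric i w l m))}.
  by have [_] := metric_c1 l m iz; apply.
have ct d : {for z, continuous (fun z => invmx (sf_metric i z) c d *
    (pderiv a (fun w => sf_metric i w d b) z + pderiv b (fun w => sf_metric i w d a) z
     - pderiv d (fun w => sf_metric i w a b) z))}.
  apply: continuous_mul; first exact: invmx_continuous.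
  exact: continuous_sub (continuous_add (cp _ _ _) (cp _ _ _)) (cp _ _ _).
rewrite (_ : christoffel _ _ _ _ = (fun z => 2^-1 * ((fun z => invmx (sf_metric i z) c ord0 *
    (pderiv a (fun w => sf_metric i w ord0 b) z + pderiv b (fun w => sf_metric i w ord0 a) z
     - pderiv ord0 (fun w => sf_metric i w a b) z)) z +
    (fun z => invmx (sf_metric i z) c ord_max *
    (pderiv a (fun w => sf_metric i w ord_max b) z + pderiv b (fun w => sf_metric i w ord_max a) z
     - pderiv ord_max (fun w => sf_metric i w a b) z)) z))).
  exact: continuous_mul (@cst_continuous _ _ _ z) (continuous_add (ct ord0) (ct ord_max)).
by apply/funext => y; rewrite /christoffel sum2.
Qed.

Let chess i a b (y : R * (R * R)) : U i y ->
  {for y, continuous (fun y => hessian (sf_metric i) (in_chart i (u y.1)) y.2 a b)}.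
Proof.
move=> Uy; have [_ iy] := Uy.
have cc c : {for y, continuous (fun y => christoffel (sf_metric i) c a b y.2 *
    pderiv c (in_chart i (u y.1)) y.2)}.
  exact: continuous_mul (cst2 Uy (@christoffel_continuous i y.2 c a b iy)) (@cG1 i c y Uy).
apply: eq_continuous_at (continuous_sub (@cG2 i a b y Uy) (continuous_add (cc ord0) (cc ord_max))).
by move=> w; rewrite mxE sum2.
Qed.

Lemma joint_laplacian_chart i (y : R * (R * R)) : 0 < y.1 -> img i y.2 ->
  {for y, continuous (fun y => laplacian (sf_metric i) (in_chart i (u y.1)) y.2)}.
Proof.
move=> y0 iy; have Uy : U i y by split.
have ci a b : {for y, continuous (fun y => invmx (sf_metric i y.2) a b *
    hessian (sf_metric i) (in_chart i (u y.1)) y.2 b a)}.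
  exact: continuous_mul (cst2 Uy (@invmx_continuous i y.2 a b iy)) (@chess i b a y Uy).
apply: eq_continuous_at (continuous_add (continuous_add (ci ord0 ord0) (ci ord0 ord_max))
  (continuous_add (ci ord_max ord0) (ci ord_max ord_max))).
by move=> w; rewrite /laplacian /mxtrace sum2 [X in _ = X + _]mxE [X in _ = _ + X]mxE !sum2.
Qed.

(** Regularity in space at each time would not be enough: differentiating means in time requires
    convergence uniform in space, which compactness extracts from joint continuity. *)
Lemma joint_laplacian t x : 0 < t ->
  {for (t, x), continuous (fun y : R * M => laplace_beltrami (u y.1) y.2)}.
Proof.
move=> t0; have ix := sf_atP x; set i := sf_at x in ix.
apply: (@near_continuous_eq _ _ (fun y : R * M =>
   laplacian (sf_metric i) (in_chart i (u y.1)) (sf_chart i y.2))).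
  exists ([set s : R | 0 < s], sf_dom i).
    split; last exact: dom_near.
    exact: lt_nbhsr.
  move=> [s y] [/= s0 iy].
  by rewrite (laplace_beltrami_chart volM (flow_C2M s0) iy).
apply: (@continuous_comp _ _ _ (fun y : R * M => (y.1, sf_chart i y.2))
   (fun y => laplacian (sf_metric i) (in_chart i (u y.1)) y.2)).
  have c2 : {for (t, x), continuous (fun y : R * M => sf_chart i y.2)}.
    have cs : {for (t, x), continuous (snd : R * M -> M)} by exact: cvg_snd.
    exact: (continuous_comp cs (sf_chart_cont ix)).
  have c1 : {for (t, x), continuous (fst : R * M -> R)} by exact: cvg_fst.
  exact: (cvg_pair (f := fst) (g := fun y : R * M => sf_chart i y.2) c1 c2).
by apply: joint_laplacian_chart => //=; exact: img_chart.
Qed.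

End JointLaplacian.

(** * Uniform convergence over the surface and time derivatives of means *)

Section Uniform.
Variables (R : realType) (M : closed_surface R).
Hypothesis volM : sf_vol M [set: borel M] = 1%E.
Implicit Types (x y : M).

Section Filter.
Context (I : Type) (F : set_system I) {FF : Filter F}.
Implicit Types (w v : I -> M -> R) (f g : M -> R).

(** The filter is arbitrary so as to cover times tending to [t], times tending to 0 from the right,
    and increments of difference quotients. *)
Definition ucvg w (f : M -> R) :=
  forall e : R, 0 < e -> \forall t \near F, forall x, `|w t x - f x| <= e.

Lemma ucvg_cst (f : M -> R) : ucvg (fun=> f) f.
Proof. by move=> e e0; apply: filterE => t x; rewrite subrr normr0 ltW. Qed.

Lemma ucvg_num (a : I -> R) (a0 : R) : a t @[t --> F] --> a0 ->
  ucvg (fun t _ => a t) (fun=> a0).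
Proof.
move=> /cvgrPdist_le ca e e0; apply: filterS (ca e e0) => t ta x.
by rewrite distrC.
Qed.

Lemma ucvgD w v f g : ucvg w f -> ucvg v g ->
  ucvg (fun t x => w t x + v t x) (fun x => f x + g x).
Proof.
move=> cw cv e e0; have e2 : 0 < e / 2 by rewrite divr_gt0.
apply: filterS2 (cw _ e2) (cv _ e2) => t wt vt x.
rewrite (splitr e) (_ : _ - _ = (w t x - f x) + (v t x - g x)); last by ring.
by apply: le_trans (ler_normD _ _) _; exact: lerD.
Qed.

Lemma ucvgM w v f g : continuous f -> continuous g -> ucvg w f -> ucvg v g ->
  ucvg (fun t x => w t x * v t x) (fun x => f x * g x).
Proof.
move=> cf cg cw cv e e0.
have [k [k0 kP]] := continuous_bounded cf; have [l [l0 lP]] := continuous_bounded cg.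
pose d := Num.min 1 (e / (k + l + 1)).
have kl : 0 < k + l + 1 by rewrite !addr_gt0.
have d0 : 0 < d by rewrite lt_min ltr01 divr_gt0.
have d1 : d <= 1 by rewrite ge_min lexx.
have de : d * (k + l + 1) <= e by rewrite -ler_pdivlMr// ge_min lexx orbT.
apply: filterS2 (cw _ d0) (cv _ d0) => t wt vt x.
have -> : w t x * v t x - f x * g x =
  (w t x - f x) * (v t x - g x) + (f x * (v t x - g x) + (w t x - f x) * g x) by ring.
apply: le_trans (ler_normD _ _) _; rewrite normrM.
have h1 : `|w t x - f x| * `|v t x - g x| <= d * 1.
  by apply: ler_pM => //; exact: le_trans (vt x) d1.
have h2 : `|f x * (v t x - g x) + (w t x - f x) * g x| <= k * d + d * l.
  apply: le_trans (ler_normD _ _) _; rewrite !normrM; apply: lerD; exact: ler_pM.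
apply: le_trans (lerD h1 h2) _; apply: le_trans de.
by rewrite le_eqVlt; apply/orP; left; apply/eqP; ring.
Qed.

Lemma ucvg_mean w f : (\forall t \near F, continuous (w t)) -> continuous f ->
  ucvg w f -> mean (w t) @[t --> F] --> mean f.
Proof.
move=> cw cf uw; apply/cvgrPdist_le => e e0.
apply: filterS2 cw (uw e e0) => t ct wt; rewrite distrC -(meanB volM ct cf).
apply: (mean_bound volM) wt; exact: cont_sub.
Qed.

(** Compactness in its near-covering form: an estimate valid near each point and eventually along
    the filter is eventually valid everywhere. *)
Lemma ucvg_compact w f :
  (forall x (e : R), 0 < e -> \forall y \near x & t \near F, `|w t y - f y| <= e) ->
  ucvg w f.
Proof.
move=> H e e0; have /compact_near_coveringP nc := @sf_compact R M.
have := nc I F (fun t x => `|w t x - f x| <= e) FF (fun x _ => H x e e0).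
by apply: filterS => t wt x; exact: wt.
Qed.

End Filter.

(** Joint continuity at positive times; what happens at time 0 is always a separate limit from the
    right. *)
Definition JC (w : R -> M -> R) :=
  forall (t : R) x, 0 < t -> {for (t, x), continuous (fun p : R * M => w p.1 p.2)}.

Lemma JC_add w v : JC w -> JC v -> JC (fun t x => w t x + v t x).
Proof. by move=> cw cv t x t0; exact: continuous_add (cw t x t0) (cv t x t0). Qed.

Lemma JC_mul w v : JC w -> JC v -> JC (fun t x => w t x * v t x).
Proof. by move=> cw cv t x t0; exact: continuous_mul (cw t x t0) (cv t x t0). Qed.

Lemma JC_opp w : JC w -> JC (fun t x => - w t x).
Proof. by move=> cw t x t0; exact: continuous_opp (cw t x t0). Qed.

Lemma JC_expR w : JC w -> JC (fun t x => expR (w t x)).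
Proof.
move=> cw t x t0.
exact: (@continuous_comp _ _ _ (fun p : R * M => w p.1 p.2) expR _ (cw t x t0)
  (@continuous_expR _ _)).
Qed.

Lemma JC_space (f : M -> R) : continuous f -> JC (fun _ => f).
Proof.
move=> cf t x t0; have cs : {for (t, x), continuous (snd : R * M -> M)} by exact: cvg_snd.
exact: (continuous_comp cs (cf x)).
Qed.

Lemma JC_time (a : R -> R) : (forall t, 0 < t -> {for t, continuous a}) ->
  JC (fun t _ => a t).
Proof.
move=> ca t x t0; have cs : {for (t, x), continuous (fst : R * M -> R)} by exact: cvg_fst.
exact: (continuous_comp cs (ca t t0)).
Qed.

Lemma JC_slice w (t : R) : JC w -> 0 < t -> continuous (w t).
Proof.
move=> cw t0 x.
apply: (@continuous_comp _ _ _ (fun y : M => (t, y)) (fun p : R * M => w p.1 p.2)).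
  exact: (cvg_pair (f := cst t) (g := id) (cvg_cst t) cvg_id).
exact: cw.
Qed.

Lemma JC_ucvg w (t : R) : JC w -> 0 < t -> ucvg (nbhs t) w (w t).
Proof.
move=> cw t0; apply: ucvg_compact => x e e0.
have e2 : 0 < e / 2 by rewrite divr_gt0.
have /cvgrPdist_lt /(_ _ e2) [[A B] /= [At Bx] AB] := cw t x t0.
exists (B, A) => // -[y s] [/= By As].
have h1 := AB (s, y) (conj As By); have h2 := AB (t, y) (conj (nbhs_singleton At) By).
rewrite /= distrC in h1; rewrite /= in h2.
rewrite (_ : w s y - w t y = (w s y - w t x) + (w t x - w t y)); last by ring.
by apply: le_trans (ler_normD _ _) _; rewrite (splitr e); apply: lerD; exact: ltW.
Qed.

Lemma near_gt0 (t : R) : 0 < t -> \forall s \near t, 0 < s.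
Proof. exact: lt_nbhsr. Qed.

Lemma JC_mean w (t : R) : JC w -> 0 < t -> {for t, continuous (fun s => mean (w s))}.
Proof.
move=> cw t0; apply: ucvg_mean (JC_ucvg cw t0); last exact: JC_slice.
by apply: filterS (near_gt0 t0) => s s0; exact: JC_slice.
Qed.

Section Derivative.
Variables (w w' : R -> M -> R).
Hypothesis dw : forall (t : R) x, 0 < t -> is_derive t 1 (fun s : R => w s x) (w' t x).
Hypothesis cw' : JC w'.

(** For each [x] the quotient is the value of [w'] at an intermediate time. That time depends on
    [x], but the closeness of [w'] to [w' t] is uniform in [x]. *)
Lemma ucvg_quotient (t : R) : 0 < t ->
  ucvg (0 : R)^' (fun h x => h^-1 * (w (h + t) x - w t x)) (w' t).
Proof.
move=> t0 e e0.
have /nbhs_ballP[d /= d0 dP] : \forall s \near t,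
    (forall x, `|w' s x - w' t x| <= e) /\ 0 < s.
  by apply: filterI; [exact: JC_ucvg|exact: near_gt0].
exists d => //= h; rewrite /ball/= sub0r normrN => hd h0 x.
have [|c cb E] := @MVT_between R (fun s => w s x) (fun s => w' s x) t (h + t).
  move=> s; rewrite addrK => sh; apply: dw.
  by have [] := dP s _ => //; rewrite /ball/= distrC; exact: le_lt_trans sh hd.
rewrite /= E addrK mulrCA mulVf// mulr1.
rewrite addrK in cb.
by have [H _] := dP c (ltac:(by rewrite /ball/= distrC; exact: le_lt_trans cb hd)).
Qed.

Lemma is_derive_mean (t : R) : (forall s, 0 < s -> continuous (w s)) -> 0 < t ->
  is_derive t 1 (fun s : R => mean (w s)) (mean (w' t)).
Proof.
move=> cw t0.
have near_pos : \forall h \near (0 : R)^', 0 < h + t.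
  have /nbhs_ballP[d /= d0 dP] := near_gt0 t0.
  exists d => //= h; rewrite /ball/= sub0r normrN => hd _; apply: dP.
  by rewrite /ball/= opprD addrCA subrr addr0 normrN.
have cq h : 0 < h + t -> continuous (fun x => h^-1 * (w (h + t) x - w t x)).
  by move=> ht; apply: cont_scale; apply: cont_sub; exact: cw.
have H : mean (fun x => h^-1 * (w (h + t) x - w t x)) @[h --> (0 : R)^'] --> mean (w' t).
  apply: ucvg_mean (ucvg_quotient t0); last exact: JC_slice.
  by apply: filterS near_pos => h; exact: cq.
have {}H : h^-1 *: (((fun s => mean (w s)) \o shift t) (h *: (1 : R)) - mean (w t))
    @[h --> (0 : R)^'] --> mean (w' t).
  apply: cvg_trans H; apply: near_eq_cvg; apply: filterS near_pos => h ht.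
  have cs : continuous (fun x => w (h + t) x - w t x) by apply: cont_sub; exact: cw.
  rewrite (meanZ volM _ cs) (meanB volM (cw _ ht) (cw _ t0)) /=.
  by rewrite [h *: _]mulr1.
by apply: DeriveDef; [apply/cvg_ex; exists (mean (w' t))|exact/cvg_lim].
Qed.

End Derivative.
End Uniform.

(** * Volume, energy and Dirichlet integral along the flow *)

Lemma within_segment0 (R : realType) (phi : R -> R) (T : R) : 0 < T ->
  (forall t, 0 < t -> {for t, continuous phi}) -> phi t @[t --> 0^'+] --> phi 0 ->
  {within `[0, T], continuous phi}.
Proof.
move=> T0 cphi phi0; apply/continuous_within_itvP => //; split=> //.
- by move=> t; rewrite in_itv/= => /andP[t0 _]; exact: cphi.
- by apply: cvg_at_left_filter; exact: cphi.
Qed.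

Lemma derivable_continuous1 (R : realType) (phi : R -> R) (t d : R) :
  is_derive t 1 phi d -> {for t, continuous phi}.
Proof. by move=> [+ _] => /derivable1_diffP /differentiable_continuous. Qed.

Lemma ucvg_comp1 (R : realType) (M : closed_surface R) (I : Type) (F : set_system I)
    {FF : Filter F} (w : I -> M -> R) (k : R) (h : R -> R) :
  {for k, continuous h} -> ucvg F w (fun=> k) ->
  ucvg F (fun t x => h (w t x)) (fun=> h k).
Proof.
move=> ch uw e e0; have /cvgrPdist_le /(_ _ e0)/nbhs_ballP[d /= d0 dP] := ch.
have d2 : 0 < d / 2 by rewrite divr_gt0.
apply: filterS (uw _ d2) => t wt x; rewrite distrC; apply: dP.
by rewrite /ball/= distrC; apply: le_lt_trans (wt x) _; rewrite ltr_pdivrMr// ltr_pMr// ltr1n.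
Qed.

Section Flow.
Variables (R : realType) (M : closed_surface R).
Hypothesis volM : sf_vol M [set: borel M] = 1%E.
Variables (K A : R) (f : M -> R) (u : R -> M -> R).
Hypotheses (A_gt0 : 0 < A) (sf : smooth_fun f).
Let kappa : R := 2^-1 * ln A.
Hypothesis flow : global_flow_solution K A f (fun=> kappa) u.
Implicit Types (x y : M) (t s : R) (w : R -> M -> R).

Let u0E x : u 0 x = kappa. Proof. by have [_ ->] := flow. Qed.

Let cf : continuous f.
Proof. exact: C1M_continuous (C2M_C1M (smooth_C2M sf)). Qed.

Let expkappa : expR (2 * kappa) = A.
Proof. by rewrite /kappa mulrA divff ?pnatr_eq0// mul1r lnK// posrE. Qed.

Let su : forall i : sf_idx M, smooth_on
  [set z : R * (R * R) | 0 < z.1 /\ (sf_chart i @` sf_dom i) z.2]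
  (fun z : R * (R * R) => u z.1 (sf_inv i z.2)).
Proof. by have [[_ _ _ su] _ _] := flow. Qed.

Lemma JC_cst (k : R) : JC (fun (_ : R) (_ : M) => k).
Proof. by apply: JC_space; exact: cst_continuous. Qed.

Lemma JC_flow : JC u.
Proof.
have [[cu _ _ _] _ _] := flow; move=> t x t0.
have /subspace_continuousP/(_ (t, x) (ltW t0)) := cu.
rewrite within_interior//; exists ([set s : R | 0 < s], setT).
  by split; [exact: near_gt0|exact: filterT].
by move=> [s y] [/= s0 _]; exact: ltW.
Qed.

Lemma ucvg_flow0 : ucvg 0^'+ u (fun=> kappa).
Proof.
apply: ucvg_compact => x e e0; have [[cu _ _ _] _ _] := flow.
have /subspace_continuousP/(_ (0, x) (lexx 0)) := cu.
move=> /cvgrPdist_le /(_ _ e0)[[B C] /= [B0 Cx] BC].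
exists (C, [set s | 0 < s /\ B s]).
  split=> //=; apply: filterI; first exact: nbhs_right_gt.
  exact: cvg_within B0.
move=> [y s] [/= Cy [s0 Bs]]; rewrite distrC -(u0E x).
exact: (BC (s, y) (conj Bs Cy) (ltW s0)).
Qed.

Definition e2u t x := expR (2 * u t x).

Let JC_e2u : JC e2u.
Proof.
by apply: JC_expR; apply: JC_mul JC_flow; apply: JC_space; exact: cst_continuous.
Qed.

Let ucvg_e2u : ucvg 0^'+ e2u (fun=> A).
Proof.
rewrite -expkappa; apply: (ucvg_comp1 (h := fun s => expR (2 * s))) ucvg_flow0.
apply: (@continuous_comp _ _ _ (fun s : R => 2 * s) expR); last exact: continuous_expR.
by apply: continuous_mul; [exact: cst_continuous|exact: cvg_id].
Qed.

Let near0_gt0 : \forall t \near (0 : R)^'+, 0 < t.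
Proof. exact: nbhs_right_gt. Qed.

Lemma cvg_mean0 (w : R -> M -> R) (k : R) : JC w -> ucvg 0^'+ w (fun=> k) ->
  mean (w t) @[t --> 0^'+] --> k.
Proof.
move=> cw uw; rewrite -[X in _ --> X](mean_cst volM k).
apply: (ucvg_mean volM) uw; last exact: cst_continuous.
by apply: filterS near0_gt0 => t t0; exact: JC_slice.
Qed.

Lemma cvg_mean0f (w : R -> M -> R) (k : R) : JC w -> ucvg 0^'+ w (fun x => f x * k) ->
  mean (w t) @[t --> 0^'+] --> k * mean f.
Proof.
move=> cw uw; rewrite -(meanZ volM k cf).
rewrite (_ : (fun x => k * f x) = (fun x => f x * k)); last first.
  by apply/funext => x; rewrite mulrC.
apply: (ucvg_mean volM) uw.
  by apply: filterS near0_gt0 => t t0; exact: JC_slice.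
by apply: cont_mul => //; exact: cst_continuous.
Qed.

Definition vol t := mean (e2u t).
Definition fvol t := mean (fun x => f x * e2u t x).
Definition al t := alpha K A f (u t).

Let JC_fe2u : JC (fun t x => f x * e2u t x).
Proof. by apply: JC_mul JC_e2u; exact: JC_space. Qed.

Lemma alE t : al t = A^-1 * (fvol t - K). Proof. by []. Qed.

Local Opaque mean laplace_beltrami.

Lemma fvol_al t : fvol t = A * al t + K.
Proof. by rewrite alE mulrA divff ?gt_eqF// mul1r subrK. Qed.

Let fvol_continuous t : 0 < t -> {for t, continuous fvol}.
Proof. by move=> t0; apply: (JC_mean volM) t0. Qed.

Let al_continuous t : 0 < t -> {for t, continuous al}.
Proof.
move=> t0; apply: (@continuous_mul _ _ (fun=> A^-1) (fun t => fvol t - K)).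
  exact: cst_continuous.
by apply: continuous_sub; [exact: fvol_continuous|exact: cst_continuous].
Qed.

Definition lapu t x := laplace_beltrami (u t) x.

Lemma JC_lapu : JC lapu.
Proof. by move=> t x t0; exact: joint_laplacian. Qed.

Lemma flow_C2Mu t : 0 < t -> C2M (u t).
Proof. by move=> t0; apply: (@flow_C2M _ _ u su). Qed.

Definition ut t x := f x - conformal_curv K (u t) x - al t.

(** The conformal factor cancels the exponential in the curvature; what remains involves the
    Laplacian of the fixed metric, to which Green's formula applies. *)
Lemma utE t x : e2u t x * ut t x = lapu t x - K + f x * e2u t x - al t * e2u t x.
Proof.
rewrite /ut /conformal_curv -/(lapu t x).
have -> : expR (-2 * u t x) = (e2u t x)^-1 by rewrite mulNr expRN.
have : e2u t x != 0 by rewrite gt_eqF// expR_gt0.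
by move: (e2u t x) (lapu t x) (al t) (f x) => e l a g e0; field.
Qed.

Lemma JC_ut : JC ut.
Proof.
have cK := @JC_cst K.
have c2 : JC (fun t x => -2 * u t x) := JC_mul (@JC_cst (-2)) JC_flow.
have c3 := JC_add (JC_opp JC_lapu) cK.
have c4 : JC (fun (t : R) (_ : M) => al t) := JC_time al_continuous.
exact: JC_add (JC_add (JC_space cf) (JC_opp (JC_mul (JC_expR c2) c3))) (JC_opp c4).
Qed.

Lemma is_derive_u t x : 0 < t -> is_derive t 1 (fun s => u s x) (ut t x).
Proof. by have [_ _] := flow; apply. Qed.

Lemma is_derive_comp_u (h h' : R -> R) t x : (forall y : R, is_derive y 1 h (h' y)) ->
  0 < t -> is_derive t 1 (fun s => h (u s x)) (h' (u t x) * ut t x).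
Proof. by move=> dh t0; exact: is_derive1_comp (dh (u t x)) (is_derive_u x t0). Qed.

Lemma is_derive_exp2 (y : R) : is_derive y 1 (fun s => expR (2 * s)) (2 * expR (2 * y)).
Proof.
have H : is_derive y 1 (fun s : R => 2 * s) 2.
  by apply: is_derive_eq; rewrite [_ *: 1]mulr1.
have E := is_derive_expR (2 * y).
apply: is_derive_eq (is_derive1_comp E H) _.
by rewrite mulrC.
Qed.

Lemma is_derive_e2u t x : 0 < t ->
  is_derive t 1 (fun s => e2u s x) (2 * e2u t x * ut t x).
Proof. by move=> t0; have := is_derive_comp_u x is_derive_exp2 t0. Qed.

Let slice (w : R -> M -> R) t : JC w -> 0 < t -> continuous (w t).
Proof. exact: JC_slice. Qed.

Lemma mean_lapu t : 0 < t -> mean (lapu t) = 0.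
Proof.
move=> t0; have := green volM (C1M_cst 1) (flow_C2Mu t0).
have -> : mean (gradip (fun=> 1) (u t)) = 0.
  by rewrite -[RHS](mean_cst volM); apply: eq_mean => x; exact: gradip_cst.
by rewrite oppr0 => <-; apply: eq_mean => x; rewrite mul1r.
Qed.

Lemma mean_e2ut t : 0 < t -> mean (fun x => e2u t x * ut t x) = al t * (A - vol t).
Proof.
move=> t0; under eq_mean do rewrite utE.
have c1 := slice JC_lapu t0; have c2 := slice JC_fe2u t0; have c3 := slice JC_e2u t0.
have cK : continuous (fun _ : M => K) by exact: cst_continuous.
have c4 : continuous (fun x => al t * e2u t x) by exact: cont_scale.
rewrite (meanB volM (cont_add (cont_sub c1 cK) c2) c4) (meanD volM (cont_sub c1 cK) c2).
rewrite (meanB volM c1 cK) (meanZ volM _ c3) mean_lapu// (mean_cst volM).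
by rewrite -/(fvol t) fvol_al -/(vol t); ring.
Qed.

Lemma is_derive_vol t : 0 < t -> is_derive t 1 vol (2 * (al t * (A - vol t))).
Proof.
move=> t0; rewrite -mean_e2ut//.
have cm : JC (fun t x => e2u t x * ut t x) by exact: JC_mul JC_e2u JC_ut.
rewrite -(meanZ volM 2 (slice cm t0)).
rewrite (eq_mean (v := fun x => 2 * e2u t x * ut t x)); last by move=> x; rewrite mulrA.
apply: (is_derive_mean volM (w' := fun t x => 2 * e2u t x * ut t x)) => //.
- by move=> s x s0; exact: is_derive_e2u.
- apply: JC_mul JC_ut; apply: JC_mul JC_e2u; apply: JC_space; exact: cst_continuous.
- by move=> s s0; exact: slice JC_e2u s0.
Qed.

Let vol0 : vol 0 = A.
Proof.
rewrite /vol (eq_mean (v := fun=> A)) ?(mean_cst volM)//.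
by move=> x; rewrite /e2u u0E.
Qed.

(** As [al] is normalised by [A] and not by the current volume, the volume solves the linear
    equation [vol' = 2 al (A - vol)]. Conservation is uniqueness for this equation: with [- L] a
    lower bound of [al], the function [(vol - A)^2 e^{- 4 L s}] is nonincreasing and starts at 0. *)
Lemma vol_eq t : 0 <= t -> vol t = A.
Proof.
rewrite le_eqVlt => /predU1P[<-//|T0]; set T := t in T0 *.
have cvol s : 0 < s -> {for s, continuous vol}.
  by move=> s0; exact: derivable_continuous1 (is_derive_vol s0).
have cvol0 : vol s @[s --> 0^'+] --> vol 0 by rewrite vol0; exact: cvg_mean0.
have cfvol0 : fvol s @[s --> 0^'+] --> A * mean f.
  apply: cvg_mean0f => //; apply: ucvgM ucvg_e2u => //; first exact: cst_continuous.
  exact: ucvg_cst.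
have [L LP] : exists L : R, forall s, 0 < s < T -> - L <= al s.
  (* [al] with its limit from the right inserted at time 0: continuous on a compact interval, it
     attains the minimum that provides [L]. *)
  pose psi s := if s <= 0 then A^-1 * (A * mean f - K) else al s.
  have psiE s : 0 < s -> psi s = al s by move=> s0; rewrite /psi leNgt s0.
  have cpsi : {within `[0, T], continuous psi}.
    apply: within_segment0 => // [s s0|].
      apply: near_continuous_eq (al_continuous s0).
      by apply: filterS (near_gt0 s0) => y /psiE.
    rewrite {2}/psi lexx.
    have H : al s @[s --> 0^'+] --> A^-1 * (A * mean f - K).
      by apply: cvgM; [exact: cvg_cst|apply: cvgB => //; exact: cvg_cst].
    by apply: cvg_trans H; apply: near_eq_cvg; apply: filterS near0_gt0 => y /psiE.
  have [s0 _ sP] := EVT_min (ltW T0) cpsi.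
  exists (- psi s0) => s /andP[sp sT]; rewrite opprK -(psiE _ sp).
  by apply: sP; rewrite in_itv/= (ltW sp) (ltW sT).
pose phi s := (vol s - A) ^+ 2 * expR (- (4 * L) * s).
have dphi s : 0 < s -> is_derive s 1 phi
    (- (4 * (al s + L)) * (vol s - A) ^+ 2 * expR (- (4 * L) * s)).
  move=> s0; have dv := is_derive_vol s0.
  have d1 : is_derive s 1 (fun s => vol s - A) (2 * (al s * (A - vol s))).
    by apply: is_derive_eq; rewrite subr0.
  have d2 : is_derive s 1 (fun s => (vol s - A) * (vol s - A))
      ((vol s - A) * (2 * (al s * (A - vol s))) + (vol s - A) * (2 * (al s * (A - vol s)))).
    exact: (is_deriveM d1 d1).
  have d3 : is_derive s 1 (fun s => - (4 * L) * s) (- (4 * L)).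
    by apply: is_derive_eq; rewrite [_ *: 1]mulr1.
  have d4 := is_derive1_comp (is_derive_expR (- (4 * L) * s)) d3.
  have d5 := is_deriveM d2 d4.
  apply: (@is_derive_eq _ _ _ _ _ _ _ _ d5 _).
  by rewrite /= /GRing.scale /=; ring.
have phi0 : phi 0 = 0 by rewrite /phi vol0 subrr expr0n mul0r.
have cphi : {within `[0, T], continuous phi}.
  apply: within_segment0 => // [s s0|].
    exact: derivable_continuous1 (dphi s s0).
  apply: cvgM.
    have H : (vol s - A) @[s --> 0^'+] --> vol 0 - A by apply: cvgB => //; exact: cvg_cst.
    rewrite expr2; under eq_fun do rewrite expr2; exact: cvgM.
  apply: cvg_at_right_filter.
  apply: (@continuous_comp _ _ _ (fun s : R => - (4 * L) * s) expR); last exact: continuous_expR.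
  by apply: continuous_mul; [exact: cst_continuous|exact: cvg_id].
have dec : phi T <= phi 0.
  apply: (ler0_derive1_nincr _ _ cphi) => //.
  - by move=> s; rewrite in_itv/= => /andP[s0 _]; have [] := dphi s s0.
  - move=> s; rewrite in_itv/= => /andP[s0 sT].
    rewrite derive1E; have [_ ->] := dphi s s0.
    rewrite -mulrA mulNr oppr_le0 mulr_ge0//; last by rewrite mulr_ge0 ?sqr_ge0 ?expR_ge0.
    by have := LP s; rewrite s0 sT => /(_ isT); lra.
  - exact: ltW.
have : phi T = 0.
  by apply/eqP; rewrite eq_le -{1}phi0 dec /phi mulr_ge0 ?sqr_ge0 ?expR_ge0.
move/eqP; rewrite /phi mulf_eq0 (gt_eqF (expR_gt0 _)) orbF sqrf_eq0 subr_eq0.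
by move/eqP.
Qed.

Definition dirichlet t := mean (gradip (u t) (u t)).

Lemma dirichletE t : 0 < t -> dirichlet t = - mean (fun x => u t x * lapu t x).
Proof.
move=> t0; have c2 := flow_C2Mu t0.
by rewrite -[LHS]opprK; congr (- _); exact: esym (green volM (C2M_C1M c2) c2).
Qed.

Lemma dirichlet_ge0 t : 0 <= dirichlet t.
Proof. by apply: mean_ge0 => x; exact: gradip_ge0. Qed.

Let cu t : 0 < t -> continuous (u t). Proof. exact: slice JC_flow. Qed.

Lemma mean_lapu_sym s t : 0 < s -> 0 < t ->
  mean (fun x => u s x * lapu t x) = mean (fun x => u t x * lapu s x).
Proof.
move=> s0 t0; have cs := flow_C2Mu s0; have ct := flow_C2Mu t0.
have gC : gradip (u s) (u t) = gradip (u t) (u s) by apply/funext => x; exact: gradipC.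
apply: etrans (green volM (C2M_C1M cs) ct) _.
by rewrite gC; exact: esym (green volM (C2M_C1M ct) cs).
Qed.

(** The cross terms cancel by the symmetry of the Laplacian. In this form the difference quotient of
    [dirichlet] needs the time derivative of [u] but not that of its gradient. *)
Lemma dirichletB s t : 0 < s -> 0 < t -> dirichlet s - dirichlet t =
  - mean (fun x => (u s x - u t x) * (lapu s x + lapu t x)).
Proof.
move=> s0 t0; have cs := cu s0; have ct := cu t0.
have ls := slice JC_lapu s0; have lt := slice JC_lapu t0.
pose a := mean (fun x => u s x * lapu s x); pose b := mean (fun x => u s x * lapu t x).
pose c := mean (fun x => u t x * lapu s x); pose d := mean (fun x => u t x * lapu t x).
have Ds : dirichlet s = - a := dirichletE s0.
have Dt : dirichlet t = - d := dirichletE t0.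
have bc : b = c := mean_lapu_sym s0 t0.
have -> : mean (fun x => (u s x - u t x) * (lapu s x + lapu t x)) = (a + b) - (c + d).
  rewrite -(meanD volM (cont_mul cs ls) (cont_mul cs lt)).
  rewrite -(meanD volM (cont_mul ct ls) (cont_mul ct lt)).
  rewrite -(meanB volM (cont_add (cont_mul cs ls) (cont_mul cs lt))
    (cont_add (cont_mul ct ls) (cont_mul ct lt))).
  apply: eq_mean => x; move: (u s x) (u t x) (lapu s x) (lapu t x) => p q m n.
  by ring.
by rewrite Ds Dt bc; clearbody a b c d; ring.
Qed.

Lemma is_derive_dirichlet t : 0 < t ->
  is_derive t 1 dirichlet (-2 * mean (fun x => ut t x * lapu t x)).
Proof.
move=> t0.
have near_pos : \forall h \near (0 : R)^', 0 < h + t.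
  have /nbhs_ballP[d /= d0 dP] := near_gt0 t0.
  exists d => //= h; rewrite /ball/= sub0r normrN => hd _; apply: dP.
  by rewrite /ball/= opprD addrCA subrr addr0 normrN.
have lt := slice JC_lapu t0.
have uq : ucvg (0 : R)^' (fun h x => h^-1 * (u (h + t) x - u t x)) (ut t).
  exact: (ucvg_quotient (fun t x => @is_derive_u t x) JC_ut t0).
have ul : ucvg (0 : R)^' (fun h x => lapu (h + t) x + lapu t x) (fun x => lapu t x + lapu t x).
  apply: ucvgD; last exact: ucvg_cst.
  move=> e e0; have /nbhs_ballP[d /= d0 dP] := JC_ucvg JC_lapu t0 e0.
  exists d => //= h; rewrite /ball/= sub0r normrN => hd _; apply: dP.
  by rewrite /ball/= opprD addrCA subrr addr0 normrN.
have cut : continuous (ut t) by exact: slice JC_ut t0.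
have um := ucvgM cut (cont_add lt lt) uq ul.
have cq h : 0 < h + t -> continuous (fun x => h^-1 * (u (h + t) x - u t x)).
  by move=> ht; apply: cont_scale; apply: cont_sub; exact: cu.
have cl h : 0 < h + t -> continuous (fun x => lapu (h + t) x + lapu t x).
  by move=> ht; apply: cont_add lt; exact: slice JC_lapu ht.
have H : mean (fun x => h^-1 * (u (h + t) x - u t x) * (lapu (h + t) x + lapu t x))
    @[h --> (0 : R)^'] --> mean (fun x => ut t x * (lapu t x + lapu t x)).
  have nc : \forall h \near (0 : R)^', continuous (fun x =>
      h^-1 * (u (h + t) x - u t x) * (lapu (h + t) x + lapu t x)).
    by apply: filterS near_pos => h ht; exact: cont_mul (cq h ht) (cl h ht).
  apply: (ucvg_mean volM nc); [exact: cont_mul cut (cont_add lt lt)|exact: um].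
have mE : mean (fun x => ut t x * (lapu t x + lapu t x)) = 2 * mean (fun x => ut t x * lapu t x).
  rewrite -(meanZ volM 2 (cont_mul cut lt)); apply: eq_mean => x.
  by move: (ut t x) (lapu t x) => a b; ring.
have {}H : h^-1 *: ((dirichlet \o shift t) (h *: (1 : R)) - dirichlet t)
    @[h --> (0 : R)^'] --> -2 * mean (fun x => ut t x * lapu t x).
  rewrite mulNr -mE; apply: cvg_trans (cvgN H); apply: near_eq_cvg.
  apply: filterS near_pos => h ht.
  rewrite /= [h *: _]mulr1 (dirichletB ht t0).
  have cs : continuous (fun x => (u (h + t) x - u t x) * (lapu (h + t) x + lapu t x)).
    by apply: cont_mul (cl h ht); apply: cont_sub; exact: cu.
  have E : mean (fun x => h^-1 * (u (h + t) x - u t x) * (lapu (h + t) x + lapu t x)) =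
      h^-1 * mean (fun x => (u (h + t) x - u t x) * (lapu (h + t) x + lapu t x)).
    by rewrite -(meanZ volM _ cs); apply: eq_mean => x; rewrite mulrA.
  exact: (etrans (congr1 -%R E) (esym (mulrN _ _))).
by apply: DeriveDef; [apply/cvg_ex; eexists; exact: H|exact/cvg_lim].
Qed.

Definition umean t := mean (u t).

Definition energy t := 2^-1 * dirichlet t + K * umean t - 2^-1 * fvol t.

(** The gradient structure of the flow: multiplying [utE] by [ut] reproduces the derivative of the
    energy, except for the term with [al], which has zero mean because the volume is conserved. *)
Lemma is_derive_energy t : 0 < t ->
  is_derive t 1 energy (- mean (fun x => e2u t x * ut t x ^+ 2)).
Proof.
move=> t0; have dD := is_derive_dirichlet t0.
have cut : continuous (ut t) by exact: slice JC_ut t0.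
have ce : continuous (e2u t) by exact: slice JC_e2u t0.
have cl : continuous (lapu t) by exact: slice JC_lapu t0.
have dU : is_derive t 1 umean (mean (ut t)).
  exact: (is_derive_mean volM (fun t x => @is_derive_u t x) JC_ut cu t0).
have dF : is_derive t 1 fvol (mean (fun x => f x * (2 * e2u t x * ut t x))).
  apply: (is_derive_mean volM (w' := fun t x => f x * (2 * e2u t x * ut t x))) => //.
  - move=> s x s0; have := is_derive_e2u x s0 => de.
    by have := is_deriveZ (f x) de.
  - apply: JC_mul; first exact: JC_space.
    by apply: JC_mul JC_ut; apply: JC_mul JC_e2u; exact: JC_cst.
  - by move=> s s0; exact: slice JC_fe2u s0.
have d1 := is_deriveZ 2^-1 dD; have d2 := is_deriveZ K dU; have d3 := is_deriveZ 2^-1 dF.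
have d4 := is_deriveB (is_deriveD d1 d2) d3.
apply: (@is_derive_eq _ _ _ _ _ _ _ _ d4 _).
rewrite /GRing.scale /=.
have m0 : mean (fun x => e2u t x * ut t x) = 0.
  by rewrite mean_e2ut// vol_eq ?(ltW t0)// subrr mulr0.
have c1 := cont_mul cut cl; have c2 := cont_mul ce cut.
have c3 : continuous (fun x => f x * (2 * e2u t x * ut t x)).
  by apply: cont_mul => //; apply: cont_mul => //; exact: cont_scale.
have c4 : continuous (fun x => e2u t x * ut t x ^+ 2).
  by apply: cont_mul => //; exact: cont_sqr.
have H : mean (fun x => e2u t x * ut t x ^+ 2) =
    mean (fun x => (ut t x * lapu t x - K * ut t x) +
      (2^-1 * (f x * (2 * e2u t x * ut t x)) - al t * (e2u t x * ut t x))).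
  apply: eq_mean => x; rewrite expr2 mulrA [in LHS]utE.
  by move: (e2u t x) (lapu t x) (al t) (f x) (ut t x) => e l a g v; field.
rewrite H (meanD volM (cont_sub c1 (cont_scale (k := K) cut))
  (cont_sub (cont_scale (k := 2^-1) c3) (cont_scale (k := al t) c2))).
rewrite (meanB volM c1 (cont_scale (k := K) cut)).
rewrite (meanB volM (cont_scale (k := 2^-1) c3) (cont_scale (k := al t) c2)).
rewrite (meanZ volM K cut) (meanZ volM 2^-1 c3) (meanZ volM (al t) c2) m0.
move: (mean (fun x => ut t x * lapu t x)) (mean (ut t)) (mean _) => a b d.
by field.
Qed.

Lemma energy_nincr s t : 0 < s -> s <= t -> energy t <= energy s.
Proof.
move=> s0 st; have cE r : s <= r -> {for r, continuous energy}.
  move=> sr; exact: derivable_continuous1 (is_derive_energy (lt_le_trans s0 sr)).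
apply: (@ler0_derive1_nincr R energy s t) => //.
- move=> r; rewrite in_itv/= => /andP[sr _].
  by have [] := is_derive_energy (lt_trans s0 sr).
- move=> r; rewrite in_itv/= => /andP[sr _].
  rewrite derive1E; have [_ ->] := is_derive_energy (lt_trans s0 sr).
  rewrite oppr_le0; apply: mean_ge0 => x.
  by apply: mulr_ge0; [exact: expR_ge0|exact: sqr_ge0].
- apply: continuous_in_subspaceT => r; rewrite inE/= in_itv/= => /andP[sr _].
  exact: cE.
Qed.

End Flow.

(** * The entropy and the bound on the Dirichlet integral *)

Section FlowBound.
Variables (R : realType) (M : closed_surface R).
Hypothesis volM : sf_vol M [set: borel M] = 1%E.
Variables (K A : R) (f : M -> R) (u : R -> M -> R).
Hypotheses (A_gt0 : 0 < A) (sf : smooth_fun f).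
Let kappa : R := 2^-1 * ln A.
Hypothesis flow : global_flow_solution K A f (fun=> kappa) u.
Implicit Types (x y : M) (t s : R) (w : R -> M -> R).

Local Notation e2u := (e2u u).
Local Notation fvol := (fvol f u).
Local Notation al := (al K A f u).
Local Notation ut := (ut K A f u).
Local Notation lapu := (lapu u).
Local Notation dirichlet := (dirichlet u).
Local Notation umean := (umean u).

Let cf : continuous f.
Proof. exact: C1M_continuous (C2M_C1M (smooth_C2M sf)). Qed.

Let u0E x : u 0 x = kappa. Proof. by have [_ ->] := flow. Qed.

Let expkappa : expR (2 * kappa) = A.
Proof. by rewrite /kappa mulrA divff ?pnatr_eq0// mul1r lnK// posrE. Qed.

Let Ju : JC u := JC_flow flow.

Let Je : JC e2u := JC_expR (JC_mul (@JC_cst R M 2) Ju).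

Let Jf : JC (fun (_ : R) => f) := JC_space cf.

Let ue : ucvg 0^'+ e2u (fun=> A).
Proof.
rewrite -expkappa; apply: (ucvg_comp1 (h := fun s => expR (2 * s))) (ucvg_flow0 flow).
apply: (@continuous_comp _ _ _ (fun s : R => 2 * s) expR); last exact: continuous_expR.
by apply: continuous_mul; [exact: cst_continuous|exact: cvg_id].
Qed.

Lemma cvg_fvol0 : fvol t @[t --> 0^'+] --> A * mean f.
Proof.
apply: (cvg_mean0f volM sf (JC_mul Jf Je)).
by apply: ucvgM ue => //; [exact: cst_continuous|exact: ucvg_cst].
Qed.

Let umean0 : umean t @[t --> 0^'+] --> kappa.
Proof. by apply: (cvg_mean0 volM Ju); exact: ucvg_flow0 flow. Qed.

Let al0 : al t @[t --> 0^'+] --> A^-1 * (A * mean f - K).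
Proof. by apply: cvgM; [exact: cvg_cst|apply: cvgB; [exact: cvg_fvol0|exact: cvg_cst]]. Qed.

(** The antiderivative of [expR (2 * s) * (s - k)] that vanishes at [s = k]. The weight is the
    conformal factor, so along the flow the Laplacian appears tested against [u - k], which yields
    minus the Dirichlet integral. *)
Definition entropy (k s : R) := expR (2 * s) * (2^-1 * (s - k) - 4^-1) + 4^-1 * expR (2 * k).

Lemma is_derive_entropy (k s : R) :
  is_derive s 1 (entropy k) (expR (2 * s) * (s - k)).
Proof.
have d1 := is_derive_exp2 s.
have d2 : is_derive s 1 (fun s : R => 2^-1 * (s - k) - 4^-1) 2^-1.
  by apply: is_derive_eq; rewrite !scaler0 !subr0 [_ *: 1]mulr1.
have d3 := is_derive_cst (4^-1 * expR (2 * k)) s (1 : R).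
apply: (@is_derive_eq _ _ _ _ _ _ _ _ (is_deriveD (is_deriveM d1 d2) d3) _).
by rewrite /GRing.scale /=; field.
Qed.

Lemma entropy_ge0 (k s : R) : 0 <= entropy k s.
Proof.
(* This reduces the sign to [1 + y <= expR y] at [y = 2 * (k - s)]. *)
have -> : entropy k s =
    4^-1 * (expR (2 * s) * (expR (2 * (k - s)) - (1 + 2 * (k - s)))).
  rewrite /entropy (_ : expR (2 * k) = expR (2 * s) * expR (2 * (k - s))); last first.
    by rewrite -expRD; congr expR; ring.
  by move: (expR (2 * s)) (expR (2 * (k - s))) => a b; field.
by rewrite mulr_ge0// mulr_ge0 ?expR_ge0// subr_ge0 expR_ge1Dx.
Qed.

(** The part of the derivative of the entropy free of the Laplacian. It tends to 0 with [t], since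
    [u - kappa] does so uniformly and the other factor converges uniformly. *)
Let rem t := mean (fun x => (u t x - kappa) * (f x * e2u t x - K - al t * e2u t x)).

Let Jal : JC (fun t (_ : M) => al t).
Proof.
apply: JC_time => t t0.
apply: (@continuous_mul _ _ (fun=> A^-1) (fun t => fvol t - K)); first exact: cst_continuous.
apply: continuous_sub; last exact: cst_continuous.
exact: (JC_mean volM (JC_mul Jf Je) t0).
Qed.

Let Jrem2 : JC (fun t x => f x * e2u t x - K - al t * e2u t x).
Proof.
exact: JC_add (JC_add (JC_mul Jf Je) (JC_opp (@JC_cst R M K))) (JC_opp (JC_mul Jal Je)).
Qed.

Let Jrem1 : JC (fun t x => u t x - kappa).
Proof. exact: JC_add Ju (JC_opp (@JC_cst R M kappa)). Qed.

Let rem0 : rem t @[t --> 0^'+] --> 0.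
Proof.
have cst (k : R) : continuous (fun _ : M => k) by exact: cst_continuous.
pose a0 := A^-1 * (A * mean f - K).
have u1 : ucvg 0^'+ (fun t x => u t x - kappa) (fun=> kappa - kappa).
  by apply: ucvgD; [exact: ucvg_flow0 flow|exact: ucvg_cst].
have u2 : ucvg 0^'+ (fun t x => f x * e2u t x - K - al t * e2u t x)
    (fun x => f x * A - K - a0 * A).
  apply: ucvgD.
    apply: ucvgD; last exact: ucvg_cst.
    by apply: ucvgM ue => //; exact: ucvg_cst.
  have v1 : ucvg 0^'+ (fun t x => al t * e2u t x) (fun=> a0 * A).
    have v0 : ucvg 0^'+ (fun t (_ : M) => al t) (fun=> a0) by apply: ucvg_num; exact: al0.
    exact: ucvgM (cst a0) (cst A) v0 ue.
  move=> e e0; apply: filterS (v1 e e0) => t ht x.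
  rewrite (_ : _ - _ = - (al t * e2u t x - a0 * A)); last by ring.
  by rewrite normrN; exact: ht.
have c2 : continuous (fun x => f x * A - K - a0 * A).
  by apply: cont_sub => //; apply: cont_sub => //; exact: cont_mul.
have H := ucvgM (cst _) c2 u1 u2.
rewrite -[X in _ --> X](mean_cst volM).
rewrite (_ : (fun=> 0) = (fun x => (kappa - kappa) * (f x * A - K - a0 * A))); last first.
  by apply/funext => x; rewrite subrr mul0r.
have nc : \forall t \near (0 : R)^'+, continuous (fun x =>
    (u t x - kappa) * (f x * e2u t x - K - al t * e2u t x)).
  have near0_gt0 : \forall t \near (0 : R)^'+, 0 < t by exact: nbhs_right_gt.
  by apply: filterS near0_gt0 => t t0; exact: JC_slice (JC_mul Jrem1 Jrem2) t0.
by apply: (ucvg_mean volM nc); [exact: cont_mul (cst _) c2|exact: H].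
Qed.

Local Opaque mean laplace_beltrami.

Let ent t := mean (fun x => entropy kappa (u t x)).

Let Jent : JC (fun t x => entropy kappa (u t x)).
Proof.
exact: JC_add (JC_mul Je (JC_add (JC_mul (@JC_cst R M 2^-1) Jrem1) (@JC_cst R M (- 4^-1))))
  (@JC_cst R M (4^-1 * expR (2 * kappa))).
Qed.

Let is_derive_ent t : 0 < t -> is_derive t 1 ent (rem t - dirichlet t).
Proof.
move=> t0; have Jut := JC_ut volM sf flow; have Jl := JC_lapu volM flow.
have E : mean (fun x => e2u t x * (u t x - kappa) * ut t x) = rem t - dirichlet t.
  have c1 := JC_slice (JC_mul Jrem1 Jrem2) t0.
  have c2 : continuous (fun x => u t x * lapu t x) by exact: JC_slice (JC_mul Ju Jl) t0.
  have c3 : continuous (lapu t) by exact: JC_slice Jl t0.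
  rewrite (dirichletE volM flow t0) opprK.
  (* The vanishing mean of the Laplacian, times [kappa], is inserted to turn [u] into
     [u - kappa]. *)
  rewrite -[RHS]addr0 -(oppr0) -(mulr0 kappa) -(mean_lapu volM flow t0).
  rewrite -(meanZ volM kappa c3) -(meanD volM c1 c2).
  rewrite -(meanB volM (cont_add c1 c2) (cont_scale (k := kappa) c3)).
  apply: eq_mean => x; rewrite mulrAC (utE K A f u).
  move: (u t x) (lapu t x) (f x) (e2u t x) (al t) => p q r s a; ring.
rewrite -E.
apply: (is_derive_mean volM (w' := fun t x => e2u t x * (u t x - kappa) * ut t x)) t0.
- move=> s x s0.
  exact: (is_derive_comp_u flow x (is_derive_entropy kappa) s0).
- exact: JC_mul (JC_mul Je Jrem1) Jut.
- by move=> s s0; exact: JC_slice Jent s0.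
Qed.

(* The entropy vanishes at time 0 and is nonnegative, so the mean value theorem
   produces arbitrarily small times at which its derivative, which is
   [rem - dirichlet], is nonnegative. *)
Lemma dirichlet_small (e d : R) : 0 < e -> 0 < d ->
  exists2 t, 0 < t < d & dirichlet t <= e.
Proof.
move=> e0 d0.
have /cvgrPdist_le/(_ _ e0) near_e := rem0.
have near_d : \forall t \near (0 : R)^'+, t < d by exact: nbhs_right_lt.
have [r /= r0 rP] : \forall t \near (0 : R)^'+, `|0 - rem t| <= e /\ t < d.
  by apply: filterI.
pose T := r / 2; have T0 : 0 < T by rewrite divr_gt0.
have ent0 : ent 0 = 0.
  rewrite /ent (eq_mean (v := fun=> 0)) ?(mean_cst volM)// => x.
  by rewrite u0E /entropy subrr mulr0 sub0r mulrN mulrC addNr.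
have cent : {within `[0, T], continuous ent}.
  apply: within_segment0 => // [t t0|].
    exact: derivable_continuous1 (is_derive_ent t0).
  rewrite ent0; apply: (cvg_mean0 volM Jent).
  rewrite -[X in ucvg _ _ (fun=> X)](_ : entropy kappa kappa = 0); last first.
    by rewrite /entropy subrr mulr0 sub0r mulrN mulrC addNr.
  apply: (ucvg_comp1 (h := entropy kappa)) (ucvg_flow0 flow).
  exact: derivable_continuous1 (is_derive_entropy kappa kappa).
have [t|t] := @MVT R ent (fun t => rem t - dirichlet t) 0 T T0 _ cent.
  by rewrite in_itv/= => /andP[t0 _]; exact: is_derive_ent.
rewrite in_itv/= => /andP[t0 tT]; rewrite ent0 !subr0 => E.
have h : 0 <= rem t - dirichlet t.
  rewrite -(pmulr_lge0 _ T0) -E; apply: mean_ge0 => x; exact: entropy_ge0.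
have [|he td] := rP t _ t0.
  rewrite /ball/= sub0r normrN gtr0_norm//; apply: lt_trans tT _.
  by rewrite /T ltr_pdivrMr// ltr_pMr// ltr1n.
exists t; first by rewrite t0 td.
move: he; rewrite sub0r normrN => he.
by have := ler_norm (rem t); lra.
Qed.

Lemma dirichlet_le t : K < 0 -> 0 < t -> dirichlet t <= fvol t - A * mean f.
Proof.
move=> K0 t0.
(* The tangent to the exponential at [kappa] gives [A * (1 + 2 * (u - kappa)) <= e2u], and the
   right-hand side has mean [A]. *)
have jensen : umean t <= kappa.
  have c1 : continuous (u t) := JC_slice Ju t0.
  have c2 : continuous (fun _ : M => (1 - 2 * kappa) * A) by exact: cst_continuous.
  have c3 : continuous (fun x => (2 * A) * u t x) by exact: cont_scale.
  have h : mean (fun x => (1 - 2 * kappa) * A + (2 * A) * u t x) <= mean (e2u t).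
    apply: (mean_le volM); [exact: cont_add c2 c3|exact: JC_slice Je t0|move=> x].
    have -> : e2u t x = A * expR (2 * (u t x - kappa)).
      by rewrite -[in RHS]expkappa -expRD; congr expR; ring.
    have -> : (1 - 2 * kappa) * A + 2 * A * u t x = A * (1 + 2 * (u t x - kappa)) by ring.
    by rewrite ler_pM2l//; exact: expR_ge1Dx.
  move: h; rewrite (meanD volM c2 c3) (mean_cst volM) (meanZ volM _ c1).
  rewrite -/(vol u t) (vol_eq volM A_gt0 sf flow (ltW t0)) -/(umean t) => h.
  have : 0 <= (2 * A) * (kappa - umean t) by lra.
  by rewrite pmulr_rge0 ?mulr_gt0// subr_ge0.
have En : energy K f u t <= K * kappa - 2^-1 * (A * mean f).
  apply/ler_addgt0Pr => e e0.
  have e2 : 0 < e / 2 by rewrite divr_gt0.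
  have cg : K * umean s - 2^-1 * fvol s @[s --> 0^'+] --> K * kappa - 2^-1 * (A * mean f).
    apply: cvgB; first by apply: cvgM umean0; exact: cvg_cst.
    by apply: cvgM cvg_fvol0; exact: cvg_cst.
  have /cvgrPdist_le/(_ _ e2) near_e := cg.
  have near_t : \forall s \near (0 : R)^'+, s < t by exact: nbhs_right_lt.
  have [r /= r0 rP] : \forall s \near (0 : R)^'+, `|K * kappa - 2^-1 * (A * mean f) -
      (K * umean s - 2^-1 * fvol s)| <= e / 2 /\ s < t.
    by apply: filterI.
  (* At this time half the Dirichlet integral costs at most [e / 2], and the distance of the other
     terms from their limit another [e / 2]. *)
  have [s /andP[s0 sr] sD] := dirichlet_small e0 r0.
  have [|he st] := rP s _ s0; first by rewrite /ball/= sub0r normrN gtr0_norm.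
  apply: le_trans (energy_nincr volM A_gt0 sf flow s0 (ltW st)) _.
  rewrite /energy; move: he; rewrite ler_norml => /andP[he _].
  by lra.
(* The sign of [K] turns the upper bound on the mean of [u] into a lower bound for its term in the
   energy. *)
have h : K * (kappa - umean t) <= 0 by apply: mulr_le0_ge0; [exact: ltW|rewrite subr_ge0].
by move: En; rewrite /energy; lra.
Qed.

End FlowBound.

(** * Bootstrap and limit *)

Section Bootstrap.
Variables (R : realType) (M : closed_surface R).
Hypothesis volM : sf_vol M [set: borel M] = 1%E.
Variables (K A c C ystar : R) (f : M -> R) (u : R -> M -> R).
Hypotheses (K_lt0 : K < 0) (A_gt0 : 0 < A) (sf : smooth_fun f).
Hypothesis flow : global_flow_solution K A f (fun=> 2^-1 * ln A) u.
Hypothesis C_gt0 : 0 < C.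
Hypothesis sobolev : forall v : M -> R, C1M v ->
  mean (fun x => expR (v x) ^+ 2) <= C * (mean (fun x => expR (v x)) ^+ 2 +
    mean (fun x => expR (v x) ^+ 2) * mean (gradip v v)).
Hypotheses (ystar_gt0 : 0 < ystar) (ystar_le : 8 * C * ystar <= 1).
Let h x := f x + c.
Hypothesis mean_h : A * mean h < ystar.
Hypothesis mean_h2 : mean (fun x => h x ^+ 2) * (2 * C * A ^+ 2) < ystar ^+ 2.
Implicit Types (t s : R).

Definition quartic t := mean (fun x => e2u u t x ^+ 2).

Let cf : continuous f.
Proof. exact: C1M_continuous (C2M_C1M (smooth_C2M sf)). Qed.

Let ch : continuous h.
Proof. by apply: cont_add => //; exact: cst_continuous. Qed.

Let Ju : JC u := JC_flow flow.
Let Je : JC (e2u u) := JC_expR (JC_mul (@JC_cst R M 2) Ju).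

(** The integral of [(f + c) e^{2u}], called [y] in the overview, with the conserved value [A] put
    in for the volume. *)
Definition excess t := fvol f u t + c * A.

Let excessE t : 0 < t -> excess t = mean (fun x => e2u u t x * h x).
Proof.
move=> t0; have ce := JC_slice Je t0.
rewrite /excess -{1}(vol_eq volM A_gt0 sf flow (ltW t0)) /vol /fvol.
rewrite -(meanZ volM c ce) -(meanD volM (cont_mul cf ce) (cont_scale (k := c) ce)).
by apply: eq_mean => x; rewrite /h; move: (e2u u t x) (f x) => p q; ring.
Qed.

Let mean_hE : A * mean h = A * mean f + c * A.
Proof.
rewrite /h (meanD volM cf); last exact: cst_continuous.
by rewrite (mean_cst volM) mulrDr [A * c]mulrC.
Qed.

Let quartic_gt0 t : 0 < t -> 0 < quartic t.
Proof.
move=> t0; apply: (mean_gt0 volM (x := point)).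
- exact: cont_sqr (JC_slice Je t0).
- by move=> x; exact: sqr_ge0.
- by rewrite exprn_gt0// expR_gt0.
Qed.

Hypothesis h_ge0 : forall x, 0 <= h x.

Let dirichlet_excess t : 0 < t -> dirichlet u t <= excess t.
Proof.
move=> t0; apply: le_trans (dirichlet_le volM A_gt0 sf flow K_lt0 t0) _.
rewrite /excess lerD2l; have : 0 <= A * mean h.
  by apply: mulr_ge0; [exact: ltW|exact: mean_ge0].
by rewrite mean_hE; lra.
Qed.

(** The Sobolev inequality for [2 u], whose Dirichlet integral is four times that of [u]. By
    [8 * C * ystar <= 1] the factor [4 * C * dirichlet] is at most one half, and the last term is
    absorbed into the left-hand side. *)
Lemma quartic_le t : 0 < t -> excess t <= ystar -> quartic t <= 2 * C * A ^+ 2.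
Proof.
move=> t0 yt; have c2 := C2M_C1M (flow_C2Mu flow t0).
have c2u : C1M (fun x => 2 * u t x) by exact: C1M_mul (C1M_cst 2) c2.
have := sobolev c2u; rewrite -/(quartic t).
have -> : mean (fun x => expR (2 * u t x)) = A := vol_eq volM A_gt0 sf flow (ltW t0).
have -> : mean (gradip (fun x => 2 * u t x) (fun x => 2 * u t x)) = 4 * dirichlet u t.
  rewrite -(meanZ volM 4 (gradip_continuous c2 c2)).
  by apply: eq_mean => x; rewrite (gradipZ 2 x c2); congr (_ * _); ring.
have w0 := ltW (quartic_gt0 t0); have D := le_trans (dirichlet_excess t0) yt.
have D0 := dirichlet_ge0 u t.
have CD : 4 * (C * dirichlet u t) <= 2^-1.
  have : C * dirichlet u t <= C * ystar by rewrite ler_pM2l.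
  by move: ystar_le; rewrite -mulrA; lra.
have WD : quartic t * (4 * (C * dirichlet u t)) <= quartic t * 2^-1 by exact: ler_wpM2l.
rewrite mulrDr => H.
have E : C * (quartic t * (4 * dirichlet u t)) = quartic t * (4 * (C * dirichlet u t)).
  by move: (quartic t) (dirichlet u t) => p q; ring.
have {}H : quartic t <= C * A ^+ 2 + quartic t * 2^-1.
  by apply: le_trans H _; rewrite lerD2l E.
by move: H; move: (quartic t) => p H; rewrite -mulrA; lra.
Qed.

Let excess_continuous t : 0 < t -> {for t, continuous excess}.
Proof.
move=> t0; apply: continuous_add; last exact: cst_continuous.
exact: (JC_mean volM (JC_mul (JC_space cf) Je) t0).
Qed.

Let excess0 : excess 0 = A * mean f + c * A.
Proof.
rewrite /excess /fvol -(meanZ volM A cf); congr (_ + _); apply: eq_mean => x.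
rewrite mulrC; congr (_ * _); rewrite /e2u; have [_ -> _] := flow.
by rewrite mulrA divff ?pnatr_eq0// mul1r lnK// posrE.
Qed.

Lemma excess_lt t : 0 < t -> excess t < ystar.
Proof.
move=> t0; rewrite ltNge; apply/negP => yt.
have cw : {within `[0, t], continuous excess}.
  apply: (within_segment0 t0); first by move=> s s0; exact: excess_continuous.
  rewrite excess0; apply: cvgD; last exact: cvg_cst.
  exact: (cvg_fvol0 volM A_gt0 sf flow).
have y0 : excess 0 < ystar by rewrite excess0 -mean_hE.
(* At a time of exact contact the non-strict assumption of [quartic_le] still holds, while [mean_h2]
   is strict: Cauchy-Schwarz would give [ystar ^+ 2 < ystar ^+ 2]. *)
have [|s] := IVT (v := ystar) (ltW t0) cw.
  by rewrite ge_min le_max (ltW y0) yt orbT.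
rewrite in_itv/= le_eqVlt => /andP[/predU1P[<-|s0] _] ys.
  by move: y0; rewrite ys ltxx.
have W : quartic s <= 2 * C * A ^+ 2 by apply: (quartic_le s0); rewrite ys.
have := mean_cauchy_schwarz volM (JC_slice Je s0) ch (quartic_gt0 s0).
rewrite -(excessE s0) ys -/(quartic s) leNgt => /negP; apply.
apply: le_lt_trans mean_h2; rewrite mulrC ler_wpM2l//.
by apply: mean_ge0 => x; exact: sqr_ge0.
Qed.

End Bootstrap.

(** * Passage to the limit along the sequence of times *)

Section Limit.
Variables (R : realType) (M : closed_surface R).
Hypothesis volM : sf_vol M [set: borel M] = 1%E.
Local Notation mu := (sf_vol M).
Implicit Types (v U g : M -> R).
Local Open Scope ereal_scope.

(** The Sobolev norm is the limit of norms of smooth approximations, each including an [L^2] term;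
    Minkowski's inequality carries the comparison to [v], as the error tends to 0 in [L^2]. *)
Lemma sobolev_norm_L2 v (e : R) : sobolev_norm 2 2 v < e%:E ->
  measurable_fun [set: borel M] (v : borel M -> R) /\
  'N[mu]_(2%:E)[EFin \o v] < e%:E.
Proof.
move=> /ereal_inf_lt[N [mv [phi_ [sphi _ cphi] cN]] Ne]; split=> //.
apply: le_lt_trans Ne.
have mphi n : measurable_fun [set: borel M] (phi_ n : borel M -> R).
  exact: continuous_borel (C1M_continuous (C2M_C1M (smooth_C2M (sphi n)))).
have le_n n : 'N[mu]_(2%:E)[EFin \o v] <=
    smooth_sobolev_norm 2 2 (phi_ n) + 'N[mu]_(2%:E)[EFin \o (phi_ n \- v)%R].
  have mN : measurable_fun [set: borel M] ((v \- phi_ n)%R : borel M -> R).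
    exact: measurable_funB.
  have := minkowski_EFin mu (mphi n) mN (_ : (1 <= 2)%R) => /(_ (ler1n _ 2)).
  have -> : (phi_ n \+ (v \- phi_ n))%R = v by apply/funext => x /=; rewrite addrC subrK.
  move=> H; apply: (le_trans H); apply: leeD.
    rewrite /smooth_sobolev_norm big_ord_recl /nabla_norm.
    rewrite (_ : 'N[mu]_(2%:E)[EFin \o phi_ n] = 'N[mu]_2%:E[EFin \o (fun x => `|phi_ n x|%R)]).
      by rewrite leeDl// sume_ge0// => i _; exact: Lnorm_ge0.
    by rewrite -[LHS]Lnorm_abse.
  rewrite (_ : EFin \o (v \- phi_ n)%R = \- (EFin \o (phi_ n \- v)%R)) ?oppe_Lnorm//.
  apply/funext => x; apply: etrans (EFinN (phi_ n x - v x)); congr EFin.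
  exact: esym (opprB _ _).
have cs : smooth_sobolev_norm 2 2 (phi_ n) + 'N[mu]_(2%:E)[EFin \o (phi_ n \- v)%R]
    @[n --> \oo] --> N + 0.
  apply: cvgeD => //; exact: fin_num_adde_defl.
rewrite adde0 in cs.
rewrite -(cvg_lim _ cs)//; apply: lime_ge; first by apply/cvg_ex; exists N.
by apply: nearW.
Qed.

Lemma L2_integral v (e : R) : 'N[mu]_(2%:E)[EFin \o v] < e%:E ->
  \int[mu]_x ((v x) ^+ 2)%:E <= (e ^+ 2)%:E.
Proof.
move=> ve; have := poweR_Lnorm mu (EFin \o v) (_ : 2 != 0 :> R)%R.
move=> /(_ (lt0r_neq0 (ltr0n _ 2))) H.
have -> : \int[mu]_x ((v x) ^+ 2)%:E = 'N[mu]_(2%:E)[EFin \o v] `^ 2.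
  rewrite H; apply: eq_integral => x _.
  by rewrite /= powR_mulrn ?normr_ge0 // real_normK ?num_real.
have N0 := Lnorm_ge0 mu 2%:E (EFin \o v).
move: ve N0; case: ('N[mu]_(2%:E)[EFin \o v]) => // r; rewrite lte_fin lee_fin => re r0.
by rewrite poweR_EFin lee_fin powR_mulrn// ler_pXn2r// ?nnegrE ?ltW// (le_lt_trans r0).
Qed.

End Limit.

Section LimitIntegrals.
Variables (R : realType) (M : closed_surface R).
Hypothesis volM : sf_vol M [set: borel M] = 1%E.
Local Notation mu := (sf_vol M).
Implicit Types (v U g : M -> R).

Lemma young_le (s a b : R) : 0 < s -> 2 * (a * b) <= s * a ^+ 2 + s^-1 * b ^+ 2.
Proof.
move=> s0; rewrite -subr_ge0.
rewrite [leRHS](_ : _ = s^-1 * (s * a - b) ^+ 2).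
  by rewrite mulr_ge0 ?sqr_ge0// invr_ge0 ltW.
by field; rewrite gt_eqF.
Qed.

(** Convexity, with the tangent at [a]: the difference [a - b] is weighted by the exponential of [a]
    alone, so the function under control can be put in that place. *)
Lemma exp_tangent (a b : R) : expR (2 * a) <= expR (2 * b) + 2 * (expR (2 * a) * (a - b)).
Proof.
have -> : expR (2 * b) = expR (2 * a) * expR (2 * (b - a)).
  by rewrite -expRD; congr expR; ring.
have := expR_ge1Dx (2 * (b - a)).
have := expR_gt0 (2 * a); move: (expR (2 * a)) (expR (2 * (b - a))) => p q p0 h.
have : 0 <= p * (q - (1 + 2 * (b - a))) by apply: mulr_ge0; [exact: ltW|rewrite subr_ge0].
by lra.
Qed.

Section Integrals.
Variables (U v : M -> R) (s eta : R).
Hypotheses (cU : continuous U) (mv : measurable_fun [set: borel M] (v : borel M -> R)).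
Hypothesis s_gt0 : 0 < s.
Hypothesis Uv : (\int[mu]_x ((U x - v x) ^+ 2)%:E <= (eta)%:E)%E.

Let meas_exp (w : M -> R) : measurable_fun [set: borel M] (w : borel M -> R) ->
  measurable_fun [set: borel M] ((fun x => expR (2 * w x)) : borel M -> R).
Proof.
by move=> mw; apply: measurableT_comp => //; exact: measurable_funM.
Qed.

Let md2 : measurable_fun [set: borel M] ((fun x => (U x - v x) ^+ 2) : borel M -> R).
Proof.
by apply: measurable_funX; apply: measurable_funB => //; exact: continuous_borel.
Qed.

Let d2_ge0 (k : R) x : 0 <= k -> 0 <= k * (s^-1 * (U x - v x) ^+ 2).
Proof.
move=> k0; apply: mulr_ge0 => //; apply: mulr_ge0; last exact: sqr_ge0.
by rewrite invr_ge0; exact: ltW.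
Qed.

Let integral_d2 (k : R) : 0 <= k ->
  (\int[mu]_x (k * (s^-1 * (U x - v x) ^+ 2))%:E <= (k * (s^-1 * eta))%:E)%E.
Proof.
move=> k0; have sk0 : 0 <= k * s^-1 by rewrite mulr_ge0// invr_ge0 ltW.
under eq_integral do rewrite mulrA EFinM.
rewrite ge0_integralZl_EFin//.
- by rewrite mulrA [(_ * eta)%:E]EFinM; apply: lee_wpmul2l => //; rewrite lee_fin.
- by move=> x _; rewrite lee_fin sqr_ge0.
- exact/measurable_EFinP.
Qed.

(** The tangent is taken at [U], whose exponential is bounded in [L^2] along the flow. Young's
    inequality with weight [s] separates this bound from the distance to [v]; the integral of the
    possibly unbounded [expR (2 * v)] stays in the extended reals. *)
Lemma limit_lower g (c : R) : continuous g -> (forall x, 0 <= g x <= c) -> 0 <= c ->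
  ((mean (fun x => g x * expR (2 * U x)))%:E <=
   \int[mu]_x (g x * expR (2 * v x))%:E +
   (c * (s * mean (fun x => expR (2 * U x) ^+ 2) + s^-1 * eta))%:E)%E.
Proof.
move=> cg gc c0; have ce : continuous (fun x => expR (2 * U x)).
  by apply: cont_expR; exact: cont_scale.
have mg : measurable_fun [set: borel M] (g : borel M -> R) by exact: continuous_borel.
have me := meas_exp mv.
have m1 : measurable_fun [set: borel M] ((fun x => g x * expR (2 * v x)) : borel M -> R).
  exact: measurable_funM.
have c2 : continuous (fun x => c * s * expR (2 * U x) ^+ 2) by apply: cont_scale; exact: cont_sqr.
have m2 := continuous_borel c2.
have n2 x : 0 <= c * s * expR (2 * U x) ^+ 2.
  by apply: mulr_ge0 (sqr_ge0 _); apply: mulr_ge0 => //; exact: ltW.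
have m3 : measurable_fun [set: borel M]
    ((fun x => c * (s^-1 * (U x - v x) ^+ 2)) : borel M -> R).
  by apply: measurable_funM => //; exact: measurable_funM.
rewrite -(integral_mean volM (cont_mul cg ce)).
apply: (@le_trans _ _ (\int[mu]_x ((g x * expR (2 * v x))%:E +
    ((c * s * expR (2 * U x) ^+ 2)%:E + (c * (s^-1 * (U x - v x) ^+ 2))%:E))%E)%E).
  apply: ge0_le_integral => //.
  - by move=> x _; rewrite lee_fin mulr_ge0 ?expR_ge0//; case/andP: (gc x).
  - by apply/measurable_EFinP; exact: continuous_borel (cont_mul cg ce).
  - apply: emeasurable_funD; first exact/measurable_EFinP.
    by apply: emeasurable_funD; exact/measurable_EFinP.
  - move=> x _; rewrite -!EFinD lee_fin.
    have /andP[g0 gc1] := gc x.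
    have h1 := exp_tangent (U x) (v x); have h2 := young_le (expR (2 * U x)) `|U x - v x| s_gt0.
    rewrite real_normK ?num_real// in h2.
    have h3 := ler_norm (U x - v x); have e0 := expR_gt0 (2 * U x).
    move: (expR (2 * U x)) (expR (2 * v x)) (U x - v x) h1 h2 h3 e0 => p q d h1 h2 h3 p0.
    (* The claim is the sum of four nonnegative products: the tangent inequality weighted by [g],
       then [d <= |d|], then [g <= c], then Young's inequality weighted by [c]. *)
    have a1 : 0 <= g x * (q + 2 * (p * d) - p) by apply: mulr_ge0 => //; rewrite subr_ge0.
    have a2 : 0 <= g x * p * (`|d| - d).
      by apply: mulr_ge0; [apply: mulr_ge0 => //; exact: ltW|rewrite subr_ge0].
    have a3 : 0 <= (c - g x) * (p * `|d|).
      by apply: mulr_ge0; [rewrite subr_ge0|apply: mulr_ge0 => //; exact: ltW].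
    have a4 : 0 <= c * (s * p ^+ 2 + s^-1 * d ^+ 2 - 2 * (p * `|d|)).
      by apply: mulr_ge0 => //; rewrite subr_ge0.
    by lra.
rewrite ge0_integralD//; last 4 first.
- by move=> x _; rewrite lee_fin mulr_ge0 ?expR_ge0//; case/andP: (gc x).
- exact/measurable_EFinP.
- by move=> x _; rewrite -EFinD lee_fin; exact: addr_ge0 (n2 x) (d2_ge0 x c0).
- by apply: emeasurable_funD; exact/measurable_EFinP.
rewrite leeD2l// ge0_integralD//; last 4 first.
- by move=> x _; rewrite lee_fin; exact: n2.
- exact/measurable_EFinP.
- by move=> x _; rewrite lee_fin; exact: d2_ge0.
- exact/measurable_EFinP.
rewrite mulrDr EFinD; apply: leeD; last exact: integral_d2.
by rewrite (integral_mean volM c2) (meanZ volM _ (cont_sqr ce)) mulrA.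
Qed.

(* Truncating at [L] bounds the factor of [U - v] in the tangent inequality, as no
   integrability of [expR (2 * v)] is available yet. *)
Lemma limit_upper (L : R) :
  (\int[mu]_x (expR (2 * Num.min (v x) L))%:E <=
   (mean (fun x => expR (2 * U x)) + expR (2 * L) * (s + s^-1 * eta))%:E)%E.
Proof.
have ce : continuous (fun x => expR (2 * U x)).
  by apply: cont_expR; exact: cont_scale.
have mm : measurable_fun [set: borel M] ((fun x => Num.min (v x) L) : borel M -> R).
  by apply: measurable_minr => //; exact: measurable_cst.
have c2 : continuous (fun x => expR (2 * U x) + expR (2 * L) * s).
  by apply: cont_add ce _; exact: cst_continuous.
have m3 : measurable_fun [set: borel M]
    ((fun x => expR (2 * L) * (s^-1 * (U x - v x) ^+ 2)) : borel M -> R).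
  by apply: measurable_funM => //; exact: measurable_funM.
apply: (@le_trans _ _ (\int[mu]_x ((expR (2 * U x) + expR (2 * L) * s)%:E +
    (expR (2 * L) * (s^-1 * (U x - v x) ^+ 2))%:E)%E)%E).
  apply: ge0_le_integral => //.
  - by apply/measurable_EFinP; exact: meas_exp mm.
  - by apply: emeasurable_funD; [apply/measurable_EFinP|exact/measurable_EFinP];
      exact: continuous_borel.
  - move=> x _; rewrite -EFinD lee_fin.
    have m1 : Num.min (v x) L <= v x by rewrite ge_min lexx.
    have m2 : Num.min (v x) L <= L by rewrite ge_min lexx orbT.
    move: (Num.min (v x) L) m1 m2 => m m1 m2.
    have h1 := exp_tangent m (U x); have h2 := young_le 1 `|U x - v x| s_gt0.
    rewrite real_normK ?num_real// expr1n mulr1 mul1r in h2.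
    have h3 := ler_norm (v x - U x); rewrite distrC in h3.
    have h4 : expR (2 * m) <= expR (2 * L) by rewrite ler_expR ler_pM2l.
    have e0 := expR_gt0 (2 * m); have mv' : m - U x <= v x - U x by rewrite lerB.
    move: (expR (2 * U x)) (expR (2 * m)) (expR (2 * L)) h1 h4 e0 => p q r h1 h4 e0.
    have h5 : m - U x <= `|U x - v x| by exact: le_trans mv' h3.
    have b1 : 0 <= q * (`|U x - v x| - (m - U x)).
      by apply: mulr_ge0; [exact: ltW|rewrite subr_ge0].
    have b2 : 0 <= (r - q) * `|U x - v x| by apply: mulr_ge0 => //; rewrite subr_ge0.
    have b3 : 0 <= r * (s + s^-1 * (U x - v x) ^+ 2 - 2 * `|U x - v x|).
      by apply: mulr_ge0; [exact: le_trans (ltW e0) h4|rewrite subr_ge0].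
    by lra.
rewrite ge0_integralD//; last 4 first.
- move=> x _; rewrite lee_fin; apply: addr_ge0 (expR_ge0 _) _.
  by apply: mulr_ge0 (expR_ge0 _) _; exact: ltW.
- by apply/measurable_EFinP; exact: continuous_borel.
- by move=> x _; rewrite lee_fin; apply: d2_ge0; exact: expR_ge0.
- exact/measurable_EFinP.
have -> : mean (fun x => expR (2 * U x)) + expR (2 * L) * (s + s^-1 * eta) =
    mean (fun x => expR (2 * U x)) + expR (2 * L) * s + expR (2 * L) * (s^-1 * eta).
  by rewrite mulrDr addrA.
rewrite [leRHS]EFinD; apply: leeD; last by apply: integral_d2; exact: expR_ge0.
rewrite (integral_mean volM c2) (meanD volM ce); last exact: cst_continuous.
by rewrite (mean_cst volM).
Qed.

End Integrals.

(** The bound holds for every truncation of [v], with the level fixed before the approximation [U]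
    is chosen; monotone convergence then removes the truncation. *)
Lemma integral_exp_limit_le v (A : R) : measurable_fun [set: borel M] (v : borel M -> R) ->
  (forall eta : R, 0 < eta -> exists U, [/\ continuous U,
     mean (fun x => expR (2 * U x)) = A &
     (\int[mu]_x ((U x - v x) ^+ 2)%:E <= eta%:E)%E]) ->
  (\int[mu]_x (expR (2 * v x))%:E <= A%:E)%E.
Proof.
move=> mv H.
have upper (L : R) : (\int[mu]_x (expR (2 * Num.min (v x) L))%:E <= A%:E)%E.
  apply/lee_addgt0Pr => e e0.
  (* With [eta = s * s] the error term of [limit_upper] is [2 * s * expR (2 * L)], which is [e]. *)
  pose s := e / (2 * expR (2 * L)).
  have s0 : 0 < s by rewrite divr_gt0// mulr_gt0// expR_gt0.
  have [U [cU UA Uv]] := H (s * s) (mulr_gt0 s0 s0).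
  apply: le_trans (limit_upper cU mv s0 Uv L) _.
  rewrite UA -EFinD lee_fin lerD2l mulrA mulVf ?gt_eqF// mul1r /s.
  by rewrite le_eqVlt; apply/orP; left; apply/eqP; field; rewrite gt_eqF// expR_gt0.
pose g (n : nat) (x : borel M) := (expR (2 * Num.min (v x) n%:R))%:E.
have mg n : measurable_fun setT (g n).
  apply/measurable_EFinP; apply: measurableT_comp => //; apply: measurable_funM => //.
  by apply: measurable_minr => //; exact: measurable_cst.
have gE x : (expR (2 * v x))%:E = limn (g ^~ x).
  apply/esym/cvg_lim => //; apply: cvg_near_cst.
  have [n vn] : exists n : nat, v x <= n%:R.
    by exists (Num.bound `|v x|); apply: le_trans (ler_norm _) (ltW (archi_boundP (normr_ge0 _))).
  exists n => // m /= nm; rewrite /g (min_idPl _)// (le_trans vn)// ler_nat; exact: nm.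
rewrite [leLHS](_ : _ = \int[mu]_x limn (g ^~ x))%E; last first.
  by apply: eq_integral => x _; exact: gE.
rewrite (monotone_convergence mu measurableT mg).
- apply: lime_le; last by apply: nearW => n; exact: upper.
  apply: ereal_nondecreasing_is_cvgn => m n mn; apply: ge0_le_integral => //.
  + by move=> x _; rewrite lee_fin expR_ge0.
  + move=> x _; rewrite lee_fin ler_expR ler_pM2l// le_min !ge_min lexx /=.
    by rewrite ler_nat mn orbT.
- by move=> n x _; rewrite lee_fin expR_ge0.
- move=> x _ m n mn; rewrite lee_fin ler_expR ler_pM2l// le_min !ge_min lexx /=.
  by rewrite ler_nat mn orbT.
Qed.

End LimitIntegrals.

(** * Constants as Sobolev functions *)

Section Constant.
Variables (R : realType) (M : closed_surface R).
Hypothesis volM : sf_vol M [set: borel M] = 1%E.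
Local Notation mu := (sf_vol M).

Lemma smooth_fun_cst (k : R) : smooth_fun (fun _ : M => k).
Proof.
move=> i n; rewrite /in_chart.
have H (V W : normedModType R) (Z : set V) (a : W) m : Ck_on m Z (fun=> a).
  elim: m a => [|m IH] a; split=> //; try by move=> x _; exact: cst_continuous.
  move=> v; split; first by move=> x _; exact: derivable_cst.
  by rewrite (_ : (fun x => 'D_v _ x) = fun=> 0)//; apply/funext => x; exact: derive_cst.
exact: (H _ _ _ k).
Qed.

Lemma nabla_norm_cst (j : nat) (k : R) :
  nabla_norm j (fun _ : M => k) = fun=> (if j is 0 then `|k| else 0).
Proof.
apply/funext => x; case: j => [//|[|j]] /=; rewrite /at_point.
  rewrite /grad_sqnorm big1 ?sqrtr0// => a _; rewrite big1// => b _.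
  by rewrite (pderiv_cst k) mulr0 mul0r.
have p1 a : pderiv a (in_chart (sf_at x) (fun _ : M => k)) = fun=> 0.
  by apply/funext => z; exact: (pderiv_cst k).
have h0 : hessian (sf_metric (sf_at x)) (in_chart (sf_at x) (fun _ : M => k))
    (sf_chart (sf_at x) x) = 0.
  apply/matrixP => a b; rewrite !mxE big1.
    by rewrite p1 (pderiv_cst 0) subr0.
  by move=> l _; rewrite p1 mulr0.
by rewrite /hess_sqnorm h0 mulmx0 mul0mx mul0mx linear0 sqrtr0.
Qed.

Lemma smooth_sobolev_norm_cst (p k : R) : p != 0 ->
  smooth_sobolev_norm 2 p (fun _ : M => k) = ('N[mu]_(p%:E)[EFin \o (fun=> `|k|%R)])%E.
Proof.
move=> p0; rewrite /smooth_sobolev_norm !big_ord_recl big_ord0 !nabla_norm_cst /=.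
by rewrite (Lnorm0 mu) ?eqe// !adde0.
Qed.

Lemma in_sobolev_cst (p k : R) : 0 < p -> in_sobolev 2 p (fun _ : M => k).
Proof.
move=> p0; have p_neq0 : p != 0 by rewrite gt_eqF.
have N0 : ('N[mu]_(p%:E)[EFin \o (fun=> 0%R)] = 0)%E by rewrite (Lnorm0 mu) ?eqe.
apply: (@le_lt_trans _ _ ('N[mu]_(p%:E)[EFin \o (fun=> `|k|%R)])%E); last first.
  rewrite unlock /=; under eq_integral do rewrite normr_id.
  by rewrite integral_cst// [X in (_ * X)%E]volM mule1 poweR_EFin ltry.
apply: ereal_inf_lbound; split; first exact: measurable_cst.
exists (fun _ _ => k).
  split.
  - by move=> n; exact: smooth_fun_cst.
  - move=> e e0; exists 0%N => m n _ _.
    have -> : ((fun _ : M => k) \- (fun _ : M => k)) = (fun=> 0).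
      by apply/funext => x /=; rewrite subrr.
    by rewrite smooth_sobolev_norm_cst// normr0 N0 lte_fin.
  - have -> : ((fun _ : M => k) \- (fun _ : M => k)) = (fun=> 0).
      by apply/funext => x /=; rewrite subrr.
    by rewrite N0; exact: cvg_cst.
by rewrite smooth_sobolev_norm_cst//; exact: cvg_cst.
Qed.

End Constant.

(** * The sign of lambda and of the limit curvature *)

Section LambdaPositive.
Variables (R : realType) (M : closed_surface R).
Hypothesis volM : sf_vol M [set: borel M] = 1%E.
Local Notation mu := (sf_vol M).

Lemma in_sobolev_measurable k (p : R) (v : M -> R) :
  in_sobolev k p v -> measurable_fun [set: borel M] (v : borel M -> R).
Proof. by move=> /ereal_inf_lt[N [mv _] _]. Qed.

Lemma sobolev_cvg_L2 (v_ : nat -> M -> R) (v : M -> R) (eta : R) :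
  sobolev_cvg 2 2 v_ v -> 0 < eta ->
  \forall n \near \oo, (\int[mu]_x ((v_ n x - v x) ^+ 2)%:E <= eta%:E)%E.
Proof.
move=> [_ cN] eta0; have e0 : 0 < Num.sqrt eta by rewrite sqrtr_gt0.
have H : \forall n \near \oo, (sobolev_norm 2 2 (v_ n \- v)%R < (Num.sqrt eta)%:E)%E.
  apply: (cN [set x | (x < (Num.sqrt eta)%:E)%E]); apply: open_nbhs_nbhs.
  by split; [exact: open_ereal_lt_ereal|rewrite /= lte_fin].
apply: filterS H => n /sobolev_norm_L2[_ /L2_integral].
by rewrite sqr_sqrtr// ltW.
Qed.

Lemma integral_exp_weight_le (g v : M -> R) (k A : R) :
  measurable_fun [set: borel M] (g : borel M -> R) ->
  measurable_fun [set: borel M] (v : borel M -> R) ->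
  (forall x, 0 <= g x <= k) -> 0 <= k ->
  (\int[mu]_x (expR (2 * v x))%:E <= A%:E)%E ->
  (\int[mu]_x (g x * expR (2 * v x))%:E <= (k * A)%:E)%E.
Proof.
move=> mg mv gk k0 vA.
have me : measurable_fun [set: borel M] ((fun x => expR (2 * v x)) : borel M -> R).
  by apply: measurableT_comp => //; exact: measurable_funM.
apply: (@le_trans _ _ (\int[mu]_x (k%:E * (expR (2 * v x))%:E))%E); last first.
  rewrite ge0_integralZl_EFin//.
  - by rewrite EFinM; apply: lee_wpmul2l => //; rewrite lee_fin.
  - exact/measurable_EFinP.
apply: ge0_le_integral => //.
- by move=> x _; rewrite lee_fin; apply: mulr_ge0 (expR_ge0 _); case/andP: (gk x).
- by apply/measurable_EFinP; exact: measurable_funM.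
- by apply/measurable_EFinP; exact: measurable_funM.
- move=> x _; rewrite -EFinM lee_fin; apply: ler_wpM2r; first exact: expR_ge0.
  by case/andP: (gk x).
Qed.

Variables (K A c C ystar : R) (f : M -> R) (u : R -> M -> R).
Hypotheses (K_lt0 : K < 0) (A_gt0 : 0 < A) (sf : smooth_fun f).
Hypothesis fc : forall x, - c <= f x <= 0.
Hypothesis flow : global_flow_solution K A f (fun=> 2^-1 * ln A) u.
Hypothesis C_gt0 : 0 < C.
Hypothesis sobolev : forall v : M -> R, C1M v ->
  mean (fun x => expR (v x) ^+ 2) <= C * (mean (fun x => expR (v x)) ^+ 2 +
    mean (fun x => expR (v x) ^+ 2) * mean (gradip v v)).
Hypotheses (ystar_le : 8 * C * ystar <= 1) (ystar_le2 : ystar <= (K + c * A) / 2).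
Hypothesis delta_gt0 : 0 < K + c * A.
Hypothesis mean_h : A * mean (fun x => f x + c) < ystar.
Hypothesis mean_h2 :
  mean (fun x => (f x + c) ^+ 2) * (2 * C * A ^+ 2) < ystar ^+ 2.
Variables (t_ : nat -> R) (v : M -> R).
Hypotheses (t_oo : t_ n @[n --> \oo] --> +oo)
  (uv : sobolev_cvg 2 2 (fun n => u (t_ n)) v).

(** With this sign the integrals against [expR (2 * v)] are those of nonnegative functions,
    meaningful before their finiteness is known. *)
Let g x := - f x.

Let gc x : 0 <= g x <= c.
Proof. by rewrite /g oppr_ge0 lerNl andbC. Qed.

Let c_ge0 : 0 <= c.
Proof. by have /andP[g0 g1] := gc point; exact: le_trans g1. Qed.

Let c_gt0 : 0 < c.
Proof.
rewrite lt_neqAle c_ge0 andbT; apply/eqP => c0.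
by move: delta_gt0; rewrite -c0 mul0r addr0 ltNge ltW.
Qed.

Let mv : measurable_fun [set: borel M] (v : borel M -> R).
Proof. by have [+ _] := uv; exact: in_sobolev_measurable. Qed.

Let cf : continuous f.
Proof. exact: C1M_continuous (C2M_C1M (smooth_C2M sf)). Qed.

Let cg : continuous g.
Proof.
have H := cont_scale (k := -1) cf.
by rewrite (_ : g = (fun x => -1 * f x))//; apply/funext => x; rewrite mulN1r.
Qed.

Let cu t : 0 < t -> continuous (u t).
Proof. by move=> t0; exact: C1M_continuous (C2M_C1M (flow_C2Mu flow t0)). Qed.

Let approx (eta : R) : 0 < eta ->
  exists2 t, 0 < t & (\int[mu]_x ((u t x - v x) ^+ 2)%:E <= eta%:E)%E.
Proof.
move=> eta0; have H1 := sobolev_cvg_L2 uv eta0.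
have H2 : \forall n \near \oo, 0 < t_ n by exact: (t_oo (nbhs_pinfty_gt (num_real 0))).
have [n [h1 h2]] := filter_ex (filterI H1 H2).
by exists (t_ n).
Qed.

Let vA : (\int[mu]_x (expR (2 * v x))%:E <= A%:E)%E.
Proof.
apply: (integral_exp_limit_le volM mv) => eta /approx[t t0 H].
exists (u t); split=> //; first exact: cu.
exact: (vol_eq volM A_gt0 sf flow (ltW t0)).
Qed.

Let gv_ge0 : (0 <= \int[mu]_x (g x * expR (2 * v x))%:E)%E.
Proof.
apply: integral_ge0 => x _; rewrite lee_fin; apply: mulr_ge0 (expR_ge0 _).
by case/andP: (gc x).
Qed.

Let gv_le (k : R) : (forall x, g x <= k) ->
  (\int[mu]_x (g x * expR (2 * v x))%:E <= (k * A)%:E)%E.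
Proof.
move=> gk; have gk' x : 0 <= g x <= k by rewrite gk; case/andP: (gc x) => ->.
apply: (integral_exp_weight_le (continuous_borel cg) mv gk' _ vA).
by have /andP[g0 g1] := gk' point; exact: le_trans g1.
Qed.

Let G := fine (\int[mu]_x (g x * expR (2 * v x))%:E).

Let GE : (\int[mu]_x (g x * expR (2 * v x))%:E = G%:E)%E.
Proof.
rewrite fineK// ge0_fin_numE//; apply: le_lt_trans (gv_le _) (ltry (c * A)).
by move=> x; case/andP: (gc x).
Qed.

Let lambdaE : lambda K A f v = A^-1 * (K + G).
Proof.
rewrite /lambda; congr (_ * (_ + _)).
rewrite /Rintegral -fineN; congr fine.
apply: (canLR oppeK); rewrite -integral_ge0N.
  by apply: eq_integral => x _; rewrite -EFinN /g mulNr opprK.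
by move=> x _; rewrite lee_fin; apply: mulr_ge0 (expR_ge0 _); case/andP: (gc x).
Qed.

(** With [d = K + c * A], the choices of [s] and [eta] make each of the two error terms of
    [limit_lower] at most [d / 8]. The excess costs less than [d / 2], so more than [d / 4] is
    left. *)
Let G_gt : 0 < K + G.
Proof.
pose d := K + c * A.
pose W := 2 * C * A ^+ 2.
have W0 : 0 < W by rewrite /W; apply: mulr_gt0 (exprn_gt0 _ A_gt0); exact: mulr_gt0.
pose s := d / (8 * (c * W)).
have s0 : 0 < s by apply: divr_gt0 => //; apply: mulr_gt0 => //; exact: mulr_gt0.
pose eta := s * (d / (8 * c)).
have eta0 : 0 < eta by apply: mulr_gt0 => //; apply: divr_gt0 => //; exact: mulr_gt0.
have [t t0 H] := approx eta0.
have := limit_lower volM (cu t0) mv s0 H cg gc c_ge0.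
rewrite GE -EFinD lee_fin.
have h0 x : 0 <= f x + c by case/andP: (fc x); rewrite -subr_ge0 opprK.
have ex := excess_lt volM K_lt0 A_gt0 sf flow C_gt0 sobolev ystar_le mean_h mean_h2 h0 t0.
have := quartic_le volM K_lt0 A_gt0 sf flow C_gt0 sobolev ystar_le h0 t0 (ltW ex).
rewrite /quartic /e2u -/W => W4.
have -> : mean (fun x => g x * expR (2 * u t x)) = - fvol f u t.
  have ce : continuous (e2u u t) by apply: cont_expR; apply: cont_scale; exact: cu.
  rewrite -mulN1r /fvol -(meanZ volM (-1) (cont_mul cf ce)).
  by apply: eq_mean => x; rewrite mulN1r -mulNr.
move: ex; rewrite /excess.
move: (fvol f u t) (mean (fun x => expR (2 * u t x) ^+ 2)) W4 => F m mW FE.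
have E1 : c * (s * m) <= d / 8.
  have -> : d / 8 = c * (s * W) by rewrite /s; field; rewrite !gt_eqF.
  by apply: ler_wpM2l => //; apply: ler_wpM2l => //; exact: ltW.
have E2 : c * (s^-1 * eta) = d / 8.
  by rewrite /eta mulKf ?gt_eqF//; field; rewrite gt_eqF.
rewrite mulrDr E2 => L.
by move: E1 L ystar_le2 delta_gt0; rewrite /d; move: (c * (s * m)) => q; lra.
Qed.

Lemma flow_limit_lambda_gt0 : 0 < lambda K A f v.
Proof. by rewrite lambdaE; apply: mulr_gt0 => //; rewrite invr_gt0. Qed.

Lemma flow_limit_curvature_neg : exists x, f x + lambda K A f v < 0.
Proof.
apply: contrapT => /forallNP N.
have gl x : g x <= lambda K A f v.
  by rewrite /g lerNl -subr_ge0 opprK leNgt; apply/negP/N.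
(* As [A] times lambda is [K + G], the bound says [G <= K + G]. *)
have := gv_le gl; rewrite GE lee_fin lambdaE mulrAC mulVf ?gt_eqF// mul1r.
by move: K_lt0 => k0; rewrite -subr_ge0 addrK leNgt k0.
Qed.

End LambdaPositive.

Theorem theorem3p4 (R : realType) (M : closed_surface R) (chi : int) (Kbar : R)
  (chiM : euler_characteristic R M chi) (chi_lt0 : chi < 0)
  (volM : sf_vol M [set: borel M] = 1%E)
  (curvM : @has_gauss_curvature R M Kbar)
  (KbarE : Kbar = 2 * pi * chi%:~R)
  (p : R) (p_gt2 : 2 < p) (A c : R) (A_gt0 : 0 < A) (c_gt : - (Kbar / A) < c) :
  exists2 eps : R, 0 < eps &
    let u0 : M -> R := fun=> 2^-1 * ln A in
    C_pA p A u0 /\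
    forall f : M -> R,
      smooth_fun f -> (forall x, - c <= f x <= 0) ->
      ('N[sf_vol M]_1[EFin \o (fun x => f x + c)%R] < eps%:E)%E ->
    forall u : R -> M -> R, global_flow_solution Kbar A f u0 u ->
    forall (t_ : nat -> R) (u_oo : M -> R),
      t_ n @[n --> \oo] --> +oo ->
      sobolev_cvg 2 2 (fun n => u (t_ n)) u_oo ->
    let lam := lambda Kbar A f u_oo in
    0 < lam /\
    ((exists x, f x = 0) ->
       (exists x, 0 < f x + lam) /\ (exists x, f x + lam < 0)).
Proof.
have K0 : Kbar < 0.
  by rewrite KbarE pmulr_rlt0 ?ltrz0// mulr_gt0// pi_gt0.
have d0 : 0 < Kbar + c * A.
  by rewrite addrC -ltrBlDr sub0r -ltr_pdivrMr// mulNr.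
have c0 : 0 < c.
  by apply: le_lt_trans c_gt; rewrite -mulNr divr_ge0 ?oppr_ge0 ?ltW.
have [C C0 sob] := sobolev_exp volM.
(* The first bound serves the absorption in [quartic_le], the second the margin in the limit. *)
pose ystar := Num.min (8 * C)^-1 ((Kbar + c * A) / 2).
have y0 : 0 < ystar.
  by rewrite lt_min invr_gt0 !mulr_gt0// invr_gt0.
have y1 : 8 * C * ystar <= 1.
  by rewrite -ler_pdivlMl ?mulr_gt0// mulr1 ge_min lexx.
have y2 : ystar <= (Kbar + c * A) / 2 by rewrite ge_min lexx orbT.
have W0 : 0 < 2 * C * A ^+ 2 by apply: mulr_gt0 (exprn_gt0 _ A_gt0); exact: mulr_gt0.
(* The first bound puts the initial excess, [A] times the mean of [f + c], below the threshold. The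
   second gives the [L^2] smallness required by Cauchy-Schwarz, since [(f + c)^2 <= c (f + c)]. *)
exists (Num.min (ystar / A) (ystar ^+ 2 / (c * (2 * C * A ^+ 2)))).
  by rewrite lt_min !divr_gt0// ?exprn_gt0// mulr_gt0.
move=> u0; split.
  split; first by apply: (in_sobolev_cst volM); exact: lt_trans p_gt2.
  rewrite /u0 mulrA divff ?pnatr_eq0// mul1r lnK ?posrE//.
  by rewrite integral_cst// [X in (_ * X)%E]volM mule1.
move=> f sf fc fL u flow t_ v t_oo uv lam.
have h0 x : 0 <= f x + c by case/andP: (fc x); rewrite -subr_ge0 opprK.
have hc x : f x + c <= c by case/andP: (fc x) => _ f0; rewrite gerDr.
have cf : continuous f := C1M_continuous (C2M_C1M (smooth_C2M sf)).
have ch : continuous (fun x => f x + c).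
  by apply: cont_add => //; exact: cst_continuous.
move: fL; rewrite Lnorm1 (_ : (\int[sf_vol M]_x _)%E = (mean (fun x => f x + c))%:E); last first.
  rewrite -(integral_mean volM ch); apply: eq_integral => x _.
  by rewrite /= ger0_norm.
rewrite lte_fin lt_min => /andP[m1 m2].
have m1' : A * mean (fun x => f x + c) < ystar by rewrite mulrC -ltr_pdivlMr.
rewrite ltr_pdivlMr in m2; last exact: mulr_gt0.
have m2' : mean (fun x => (f x + c) ^+ 2) * (2 * C * A ^+ 2) < ystar ^+ 2.
  apply: le_lt_trans m2; rewrite [leRHS](mulrA _ c); apply: ler_wpM2r; first exact: ltW.
  rewrite mulrC -(meanZ volM c ch); apply: (mean_le volM); first exact: cont_sqr ch.
  - exact: cont_scale.
  - by move=> x; rewrite expr2; apply: ler_wpM2r.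
have lam0 : 0 < lam :=
  flow_limit_lambda_gt0 volM K0 A_gt0 sf fc flow C0 sob y1 y2 d0 m1' m2' t_oo uv.
split=> // -[x fx]; split; first by exists x; rewrite fx add0r.
exact: (flow_limit_curvature_neg volM K0 A_gt0 sf fc flow t_oo uv).
Qed.
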